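(* Suppose that $\overline{\mathbf{Q}}^{\,r}(0) \Rightarrow \mathbf{z}(0)$ (convergence in distribution) as $r \to \infty$, where $\mathbf{z}(0)$ is a random vector in $\mathbb{R}_+^I$. Then, as $r\to\infty$, the processes $\overline{\mathbf{Q}}^{\,r}(\cdot)$ converge weakly in the Skorokhod space $\mathbf{D}(\mathbb{R}_+, \mathbb{R}_+^I)$ to the unique fluid model solution with (random) initial state $\mathbf{z}(0)$.
   Context: Notation: $\mathbb{R}_+=[0,\infty)$, $\|\mathbf{x}\|_1=\sum_{i=1}^I |x_i|$ for $\mathbf{x}\in\mathbb{R}^I$. $\mathbf{D}(\mathbb{R}_+,\mathbb{R}_+^I)$ is the space of functions $f\colon\mathbb{R}_+\to\mathbb{R}_+^I$ that are right-continuous with left limits, endowed with the Skorokhod $J_1$-topology; $\Rightarrow$ denotes weak convergence. Parameters: an integer $I\ge 1$ and positive reals $\lambda,\mu_1,\dots,\mu_I,\nu$. Standing assumption (overload): $\lambda\sum_{i=1}^I 1/\mu_i>1$. Stochastic model. For each $r>0$, consider a processor-sharing queue with Poisson arrivals of rate $\lambda$, where each customer goes through $I$ consecutive stages of service with exponential service requirement of parameter $\mu_i$ at stage $i$, and abandons when its exponential patience time of parameter $\nu/r$ expires, if service has not been completed. The arrival process, all service requirements and all patience times are mutually independent. $Q_i^r(t)$ is the number of customers in stage $i$ at time $t$, and $\mathbf{Q}^r=(Q_1^r,\dots,Q_I^r)$. All models are defined on one probability space, and $\mathbf{Q}^r$ is represented as the unique solution of: for $t\ge0$, $$Q_1^r(t)=Q_1^r(0)+A(t)-D_1^{r,\mathrm{s}}(t)-D_1^{r,\mathrm{a}}(t),$$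 $$Q_i^r(t)=Q_i^r(0)+D_{i-1}^{r,\mathrm{s}}(t)-D_i^{r,\mathrm{s}}(t)-D_i^{r,\mathrm{a}}(t),\quad 2\le i\le I,$$ $$D_i^{r,\mathrm{s}}(t)=\Pi_i^{\mathrm{s}}\Bigl(\mu_i\int_0^t\frac{Q_i^r(u)}{\|\mathbf{Q}^r(u)\|_1}\,du\Bigr),\qquad D_i^{r,\mathrm{a}}(t)=\Pi_i^{\mathrm{a}}\Bigl(\frac{\nu}{r}\int_0^t Q_i^r(u)\,du\Bigr),$$ where the ratio is $0$ by convention when $\mathbf{Q}^r(u)=\mathbf{0}$. Here $A$ is a Poisson process of rate $\lambda$, and $\Pi_i^{\mathrm{s}},\Pi_i^{\mathrm{a}}$ ($1\le i\le I$) are unit-rate Poisson processes. The processes $A,\Pi_i^{\mathrm{s}},\Pi_i^{\mathrm{a}}$ are mutually independent and independent of the family of initial states $\mathbf{Q}^r(0)$, which take values in $\{0,1,2,\dots\}^I$. Fluid scaling: $\overline{\mathbf{Q}}^{\,r}(t):=\mathbf{Q}^r(rt)/r$, $t\ge0$. Fluid model solution (FMS): a continuous function $\mathbf{z}=(z_1,\dots,z_I)\colon\mathbb{R}_+\to\mathbb{R}_+^I$ with $\inf_{t\ge\delta}\|\mathbf{z}(t)\|_1>0$ for every $\delta>0$ that satisfies, for all $t>0$, $$z_1'(t)=\lambda-\mu_1\frac{z_1(t)}{\|\mathbf{z}(t)\|_1}-\nu z_1(t),$$ $$z_i'(t)=\mu_{i-1}\frac{z_{i-1}(t)}{\|\mathbf{z}(t)\|_1}-\mu_i\frac{z_i(t)}{\|\mathbf{z}(t)\|_1}-\nu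 z_i(t),\quad 2\le i\le I.$$ For every initial state in $\mathbb{R}_+^I$ there is exactly one FMS starting from it; the limit process is the FMS started from the random initial state $\mathbf{z}(0)$. *)

(* Defs.v *)
From HB Require Import structures.
From mathcomp Require Import all_boot all_order all_algebra.
From mathcomp Require Import all_classical all_reals all_analysis.

Set Implicit Arguments.
Unset Strict Implicit.
Unset Printing Implicit Defensive.

Import Order.TTheory GRing.Theory Num.Theory.
Import numFieldNormedType.Exports.

Local Open Scope classical_set_scope.
Local Open Scope ring_scope.

(** * The path space D(R_+, R_+^I) with the Skorokhod J1 topology *)

(** A path on [0, +oo[ is encoded as a function on R that is constant on
    ]-oo, 0].  Right-continuity, left limits and continuity on R then amount
    to the same properties on [0, +oo[, and equality of paths is equality on
    [0, +oo[. *)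
Definition cadlag_nneg (R : realType) (I : nat) (f : R -> 'rV[R]_I) : Prop :=
  [/\ forall t : R, t < 0 -> f t = f 0,
      forall (t : R) (i : 'I_I), 0 <= f t 0 i,
      forall t : R, f s @[s --> t^'+] --> f t
    & forall t : R, cvg (f s @[s --> t^'-])].

Record skorokhod (R : realType) (I : nat) := Skorokhod {
  sample_path :> R -> 'rV[R]_I;
  sample_path_cadlag : cadlag_nneg sample_path
}.

Lemma skorokhod_eq (R : realType) (I : nat) (x y : skorokhod R I) :
  (forall t, 0 <= t -> x t = y t) -> x = y.
Proof.
case: x y => [x hx] [y hy] /= xy.
have e : x = y.
  apply/funext => t; have [t0|/xy//] := ltP t 0.
  by case: hx hy => + _ _ _ [+ _ _ _] => -> // ->//; rewrite xy.
by subst y; congr Skorokhod; exact: Prop_irrelevance.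
Qed.

HB.instance Definition _ (R : realType) (I : nat) :=
  gen_eqMixin (skorokhod R I).
HB.instance Definition _ (R : realType) (I : nat) :=
  gen_choiceMixin (skorokhod R I).

Lemma cadlag_nneg0 (R : realType) (I : nat) :
  cadlag_nneg (fun _ : R => 0 : 'rV[R]_I).
Proof.
split=> // [t i|t|t]; first by rewrite mxE.
  exact: cvg_cst.
exact: is_cvg_cst.
Qed.

HB.instance Definition _ (R : realType) (I : nat) :=
  isPointed.Build (skorokhod R I) (Skorokhod (@cadlag_nneg0 R I)).

Definition time_change (R : realType) (lam : R -> R) : Prop :=
  set_bij [set s | 0 <= s] [set s | 0 <= s] lam /\
  (forall s t : R, 0 <= s -> s < t -> lam s < lam t).

(** The sets [J1_basic N e] form a base of a uniformity inducing the J1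
    topology: [x_k] converges to [x] iff there are time changes [lam_k] such
    that [sup_s |lam_k s - s|] and, for every [N],
    [sup_(s <= N) |x_k (lam_k s) - x s|] tend to 0
    (Jacod and Shiryaev, Limit Theorems for Stochastic Processes, VI.1.14). *)
Definition J1_basic (R : realType) (I : nat) (N e : R) :
    set (skorokhod R I * skorokhod R I) :=
  [set xy : skorokhod R I * skorokhod R I | exists lam : R -> R,
    [/\ time_change lam,
        forall s : R, 0 <= s -> `|lam s - s| < e
      & forall s : R, 0 <= s <= N -> `|xy.1 s - xy.2 (lam s)| < e]].

Definition J1_entourage (R : realType) (I : nat) :
    set_system (skorokhod R I * skorokhod R I) :=
  filter_from [set Ne : R * R | 0 < Ne.2] (fun Ne => @J1_basic R I Ne.1 Ne.2).

Section J1_uniformity.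
Variables (R : realType) (I : nat).
Local Notation D := (skorokhod R I).

Let J1_basic_le N N' e e' : N <= N' -> e' <= e ->
  @J1_basic R I N' e' `<=` J1_basic N e.
Proof.
move=> NN ee [x y] /= [lam [lamP h1 h2]]; exists lam; split=> // s s0.
  exact: lt_le_trans (h1 _ s0) ee.
apply: lt_le_trans (h2 _ _) ee.
by case/andP: s0 => -> /= /le_trans ->.
Qed.

Lemma J1_entourage_filter : Filter (@J1_entourage R I).
Proof.
apply: filter_from_filter; first by exists (0, 1) => /=.
move=> [N e] [N' e'] /= e0 e'0; exists (Num.max N N', Num.min e e') => /=.
  by rewrite lt_min e0.
by move=> xy h; split; apply: J1_basic_le h; rewrite ?le_max ?ge_min ?lexx ?orbT.
Qed.

Lemma J1_entourage_diagonal A : @J1_entourage R I A -> diagonal `<=` A.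
Proof.
move=> [[N e] /= e0 sA] [x y] /= xy; have {xy}<- : x = y := xy; apply: sA; exists id; split=> /=.
- by split => //; split => // s s0; exists s.
- by move=> s _; rewrite subrr normr0.
- by move=> s _; rewrite subrr normr0.
Qed.

Lemma J1_entourage_inv A : @J1_entourage R I A -> @J1_entourage R I A^-1%relation.
Proof.
move=> [[N e] /= e0 sA]; exists (N + e, e) => //= -[x y] [lam [[lamb lamh] h1 h2]].
apply: sA => /=.
have /choice[mu muP] : forall s : R, exists t, 0 <= s -> 0 <= t /\ lam t = s.
  move=> s; have [s0|] := leP 0 s; last by exists 0; rewrite leNgt; case: ltP.
  by case: lamb => _ _ /(_ s s0) [t t0 ts]; exists t.
exists mu; split=> /=.
- split; first split.
  + by move=> s /= /muP[].
  + move=> s t /set_mem /= /muP[_ hs] /set_mem /= /muP[_ ht] mst.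
    by rewrite -hs mst ht.
  + move=> t /= t0; exists (lam t); first by case: lamb => + _ _; exact.
    have /muP[m0 ml] : 0 <= lam t by case: lamb => + _ _; apply.
    by case: lamb => _ + _; apply => //; exact/mem_set.
  + move=> s t s0 st; have [ms0 ls] := muP _ s0.
    have [mt0 lt] := muP _ (le_trans s0 (ltW st)).
    rewrite ltNge; apply/negP; rewrite le_eqVlt => /orP[/eqP E|/(lamh _ _ mt0)].
      by move: st; rewrite -ls -lt E ltxx.
    by rewrite ls lt ltNge (ltW st).
- by move=> s /muP[m0 ls]; rewrite -{2}ls distrC h1.
- move=> s /andP[s0 sN]; have [m0 ls] := muP _ s0.
  rewrite distrC -{2}ls h2// m0/=.
  have := h1 _ m0; rewrite ls ltr_norml => /andP[+ _].
  rewrite ltrBrDl => /ltW; rewrite -lerBrDr opprK => /le_trans; apply.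
  by rewrite lerD2r.
Qed.

Lemma J1_entourage_split_ex A : @J1_entourage R I A ->
  exists2 B, @J1_entourage R I B & (B \; B `<=` A)%relation.
Proof.
move=> [[N e] /= e0 sA].
pose e' := Num.min 1 (e / 2).
have e'0 : 0 < e' by rewrite lt_min ltr01 divr_gt0.
exists (J1_basic (N + 1) e'); first by exists (N + 1, e').
have hsplit : e' + e' <= e by rewrite [leRHS]splitr lerD// ge_min lexx orbT.
move=> [x z] /= [y [lam [[lamb lamh] h1 h2]] [mu [[mub muh] k1 k2]]].
have lam0 s : 0 <= s -> 0 <= lam s by case: lamb => + _ _; exact.
apply: sA; exists (mu \o lam); split=> /=.
- split; first exact: set_bij_comp lamb mub.
  by move=> s t s0 st; apply: muh; [exact: lam0|exact: lamh].
- move=> s s0; rewrite -(subrK (lam s) (mu _)) -addrA.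
  by rewrite (le_lt_trans (ler_normD _ _))// (lt_le_trans _ hsplit)// ltrD ?h1 ?k1 ?lam0.
- move=> s /andP[s0 sN]; rewrite -(subrK (y (lam s)) (x s)) -addrA.
  rewrite (le_lt_trans (ler_normD _ _))// (lt_le_trans _ hsplit)// ltrD//.
    by rewrite h2// s0/= (le_trans sN)// lerDl.
  apply: k2; rewrite lam0//=.
  have := h1 _ s0; rewrite ltr_norml => /andP[_].
  rewrite ltrBlDr => /ltW/le_trans; apply.
  by rewrite addrC lerD// ge_min lexx.
Qed.

HB.instance Definition _ := isUniform.Build (skorokhod R I)
  J1_entourage_filter J1_entourage_diagonal J1_entourage_inv
  J1_entourage_split_ex.

Lemma J1_nbhsP (x : D) (A : set D) :
  nbhs x A <-> exists N e : R, 0 < e /\ forall y, J1_basic N e (x, y) -> A y.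
Proof.
split=> [[B [[N e] /= e0 sB] h]|[N [e [e0 h]]]].
  by exists N, e; split=> // y hy; apply: h; exact/mem_set/sB.
by exists (J1_basic N e); [exists (N, e)|move=> y /set_mem; exact: h].
Qed.

End J1_uniformity.

(** [r] is used only when positive; the absolute values make the operation
    total. *)
Lemma cadlag_nneg_fluid_scaling (R : realType) (I : nat) (r : R)
    (x : skorokhod R I) : cadlag_nneg (fun t => `|r|^-1 *: x (`|r| * t)).
Proof.
have [->|r0] := eqVneq r 0.
  under eq_fun do rewrite normr0 invr0 scale0r.
  exact: cadlag_nneg0.
have {}r0 : 0 < `|r| by rewrite normr_gt0.
case: (sample_path_cadlag x) => xneg xnn xr xl; split.
- by move=> t t0; rewrite xneg ?pmulr_rlt0// mulr0.
- by move=> t i; rewrite mxE mulr_ge0// invr_ge0.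
- move=> t; apply: cvgZr.
  apply: (cvg_comp _ _ _ (xr (`|r| * t))).
  move=> A [e /= e0 hA]; exists (e / `|r|) => /=; first exact: divr_gt0.
  move=> s /= st ts; apply: hA; rewrite /= ?ltr_pM2l//.
  by rewrite -mulrBr normrM normr_id mulrC -ltr_pdivlMr.
- move=> t; apply: is_cvgZr.
  apply: (cvgP (lim (x s @[s --> (`|r| * t)^'-]))).
  apply: (cvg_comp _ _ _ (xl (`|r| * t))).
  move=> A [e /= e0 hA]; exists (e / `|r|) => /=; first exact: divr_gt0.
  move=> s /= st ts; apply: hA; rewrite /= ?ltr_pM2l//.
  by rewrite -mulrBr normrM normr_id mulrC -ltr_pdivlMr.
Qed.

Definition fluid_scaling (R : realType) (I : nat) (r : R) (x : skorokhod R I) :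
    skorokhod R I :=
  Skorokhod (cadlag_nneg_fluid_scaling r x).

(** * Random elements and convergence in distribution *)

Definition borel (S : ptopologicalType) := g_sigma_algebraType (@open S).

Definition random_element (d : measure_display) (T : measurableType d)
    (S : ptopologicalType) (X : T -> S) : Prop :=
  measurable_fun [set: T] (X : T -> borel S).

(** The family [X] is indexed by [r > 0]; its members and the limit may live
    on different probability spaces. *)
Definition cvg_in_distribution (R : realType) (S : ptopologicalType)
    (d : measure_display) (T : measurableType d) (P : probability T R)
    (X : R -> T -> S)
    (d' : measure_display) (T' : measurableType d') (P' : probability T' R)
    (Y : T' -> S) : Prop :=
  [/\ forall r : R, 0 < r -> random_element (X r),
      random_element Y
    & forall F : S -> R, continuous F -> (exists M : R, forall x, `|F x| <= M) ->
        ('E_P[F \o X r])%E @[r --> +oo%R] --> ('E_P'[F \o Y])%E].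

(** * Independence and Poisson processes *)

Definition mutual_independence (R : realType) (d : measure_display)
    (T : measurableType d) (P : probability T R) (K : eqType)
    (G : K -> set (set T)) : Prop :=
  forall (J : seq K) (E : K -> set T), uniq J ->
    (forall k, k \in J -> G k (E k)) ->
    P (\bigcap_(k in [set` J]) E k) = (\prod_(k <- J) P (E k))%E.

Definition sigma_of (T : Type) (d : measure_display) (S : measurableType d)
    (A : Type) (D : set A) (X : A -> T -> S) : set (set T) :=
  <<s \bigcup_(a in D) preimage_set_system setT (X a) measurable >>.

Definition poisson_process (R : realType) (d : measure_display)
    (T : measurableType d) (P : probability T R) (rate : R)
    (N : T -> R -> nat) : Prop :=
  [/\ forall t : R, 0 <= t -> measurable_fun setT (fun w => N w t),
      forall w, [/\ N w 0 = 0%N,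
        forall s t : R, 0 <= s -> s <= t -> (N w s <= N w t)%N
        & forall t : R, 0 <= t -> N w s @[s --> t^'+] --> N w t],
      forall t : nat -> R, 0 <= t 0%N -> (forall k, t k <= t k.+1) ->
        mutual_independence P (fun k : nat =>
          preimage_set_system setT (fun w => (N w (t k.+1) - N w (t k))%N)
            measurable)
    & forall s t : R, 0 <= s -> s < t -> forall k : nat,
        P [set w | (N w t - N w s)%N = k]
          = (poisson_pmf (rate * (t - s)) k)%:E].

(** * The processor-sharing queue *)

Definition norm1 (R : realType) (I : nat) (x : 'rV[R]_I) : R :=
  \sum_(i < I) `|x 0 i|.

Section queue.
Variables (R : realType) (I : nat).
Implicit Types (mu : 'I_I -> R) (nu r : R) (q : skorokhod R I).

(** At [q u = 0] the ratio is [0], as division by [0] gives [0]. *)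
Definition service_departures mu (Ps : 'I_I -> R -> nat) q (i : 'I_I) (t : R)
    : nat :=
  Ps i (mu i * \int[lebesgue_measure]_(u in `[0, t]) (q u 0 i / norm1 (q u))).

Definition abandonments nu r (Pa : 'I_I -> R -> nat) q (i : 'I_I) (t : R)
    : nat :=
  Pa i (nu / r * \int[lebesgue_measure]_(u in `[0, t]) q u 0 i).

(** Stages are numbered from [0]. *)
Definition queue_equations mu nu r (A : R -> nat) (Ps Pa : 'I_I -> R -> nat) q
    : Prop :=
  forall t : R, 0 <= t ->
    (forall i : 'I_I, i = 0%N :> nat ->
       q t 0 i = q 0 0 i + (A t)%:R - (service_departures mu Ps q i t)%:R
                 - (abandonments nu r Pa q i t)%:R) /\
    (forall i j : 'I_I, i = j.+1 :> nat ->
       q t 0 i = q 0 0 i + (service_departures mu Ps q j t)%:R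
                 - (service_departures mu Ps q i t)%:R
                 - (abandonments nu r Pa q i t)%:R).

End queue.

Inductive source (I : nat) :=
  Arrivals | Services of 'I_I | Patience of 'I_I | InitialStates.
Arguments Arrivals {I}.
Arguments InitialStates {I}.

HB.instance Definition _ (I : nat) := gen_eqMixin (source I).

Definition source_sigma (R : realType) (I : nat) (d : measure_display)
    (T : measurableType d) (A : T -> R -> nat) (Ps Pa : 'I_I -> T -> R -> nat)
    (Q : R -> T -> skorokhod R I) (k : source I) : set (set T) :=
  match k with
  | Arrivals => sigma_of [set t : R | 0 <= t] (fun t w => A w t)
  | Services i => sigma_of [set t : R | 0 <= t] (fun t w => Ps i w t)
  | Patience i => sigma_of [set t : R | 0 <= t] (fun t w => Pa i w t)
  | InitialStates =>
      sigma_of [set r : R | 0 < r] (fun r w => Q r w 0 : borel 'rV[R]_I)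
  end.

(** The family [Q] of queue-length processes is indexed by [r > 0]. *)
Definition queue_model (R : realType) (I : nat) (lambda : R) (mu : 'I_I -> R)
    (nu : R) (d : measure_display) (T : measurableType d) (P : probability T R)
    (A : T -> R -> nat) (Ps Pa : 'I_I -> T -> R -> nat)
    (Q : R -> T -> skorokhod R I) : Prop :=
  [/\ poisson_process P lambda A,
      forall i, poisson_process P 1 (Ps i) /\ poisson_process P 1 (Pa i),
      mutual_independence P (source_sigma A Ps Pa Q),
      forall r : R, 0 < r -> random_element (Q r) /\
        forall w i, exists k : nat, Q r w 0 0 i = k%:R
    & forall r : R, 0 < r -> {ae P, forall w,
        queue_equations mu nu r (A w) (Ps ^~ w) (Pa ^~ w) (Q r w)}].

(** * Fluid model solutions *)

Definition fluid_model_solution (R : realType) (I : nat) (lambda : R)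
    (mu : 'I_I -> R) (nu : R) (z : skorokhod R I) : Prop :=
  [/\ {within [set t : R | 0 <= t], continuous z},
      forall delta : R, 0 < delta ->
        0 < inf [set norm1 (z t) | t in [set t : R | delta <= t]]
    & forall t : R, 0 < t ->
        (forall i : 'I_I, i = 0%N :> nat ->
           is_derive t 1 (fun s : R => z s 0 i)
             (lambda - mu i * (z t 0 i / norm1 (z t)) - nu * z t 0 i)) /\
        (forall i j : 'I_I, i = j.+1 :> nat ->
           is_derive t 1 (fun s : R => z s 0 i)
             (mu j * (z t 0 j / norm1 (z t)) - mu i * (z t 0 i / norm1 (z t))
              - nu * z t 0 i))].

(* Main.v *)
Require Import Defs.
From mathcomp Require Import all_boot all_order all_algebra.
From mathcomp Require Import all_classical all_reals all_analysis.
From mathcomp Require Import measurable_realfun.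
From mathcomp Require Import ring lra.
Import Order.TTheory GRing.Theory Num.Theory.
Import numFieldNormedType.Exports.
Local Open Scope classical_set_scope.
Local Open Scope ring_scope.

(** The queue in fluid scale satisfies the integral form of the fluid equations
    up to the fluctuations of the scaled Poisson processes, which vanish by
    the law of large numbers ([poisson_lln], [queue_residual]).  The sources
    do not depend on [r], so this holds sample path by sample path.  The
    theorem then follows from the analysis of the limiting equations, whose
    drift is discontinuous at the origin, and from a passage from paths to
    laws.

    Leaving the origin.  Weigh the content of stage [k] by the mean service
    that a customer in this stage still needs.  Service lowers the workload so
    obtained at rate one whatever the composition of the queue, and arrivals
    raise it at rate [lambda * \sum_i (mu i)^-1 > 1].  Hence the workload of any
    limit is at least [kappa / nu * (1 - expR (- nu * t))] with [kappa > 0], even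
    when it starts from zero ([limit_workload]).  At positive times the drift
    is therefore continuous along the limit, and limits of approximate
    solutions are fluid model solutions ([ultra_fluid_limit]).  Limits are taken
    along ultrafilters.  Existence follows, with Euler's scheme as approximate
    solutions ([fluid_solution_exists]).

    Uniqueness.  From a nonzero state it is Gronwall's inequality
    ([unique_from_nonzero]).  From the empty state, run time at speed
    [1 / mass] and discount abandonments: the equations become linear, with a
    positive matrix off the diagonal and a positive eigenvector [v]
    ([growth_rate]).  The ratios of a solution to [v] evolve under a Markov
    generator with a spectral gap, so their normalised variance decays at
    least like the exponential of minus a multiple of the new time.  The new
    time elapsed since time [0] is infinite, so the variance is zero and the
    solution is a multiple of [v] at all times ([profile_of_zero_start]).

    Continuity and weak convergence.  Compactness and uniqueness give locally
    uniform convergence of approximate solutions ([fluid_limit]), hence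
    continuity of the map [Psi] from initial states to solutions ([fluid_map])
    and, for good sample paths, convergence of the scaled queue whenever its
    initial states converge ([queue_fluid_limit]).  The initial states converge
    only in law, so the scaled queue is compared with the solution issued from
    its own initial state: their difference vanishes along paths with bounded
    initial states ([pathwise_comparison]), a cutoff takes care of the others
    ([comparison_cvg]), and the law of the comparison process converges because
    [Psi] is continuous. *)

Set Implicit Arguments.
Unset Strict Implicit.
Unset Printing Implicit Defensive.

(** * Calculus on the half-line *)

Section calculus.
Variable R : realType.
Implicit Types (f g F : R -> R) (s t a b : R).

Lemma is_derive_add t f g a b : is_derive t 1 f a -> is_derive t 1 g b ->
  is_derive t 1 (fun x => f x + g x) (a + b).
Proof. by move=> ? ?; exact: is_deriveD. Qed.

Lemma is_derive_sub t f g a b : is_derive t 1 f a -> is_derive t 1 g b ->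
  is_derive t 1 (fun x => f x - g x) (a - b).
Proof. by move=> ? ?; exact: is_deriveB. Qed.

Lemma is_derive_mul t f g a b : is_derive t 1 f a -> is_derive t 1 g b ->
  is_derive t 1 (fun x => f x * g x) (a * g t + f t * b).
Proof.
move=> fa gb; have := is_deriveM fa gb.
by rewrite /GRing.scale/= addrC (mulrC a).
Qed.

Lemma is_derive_scale t f c a : is_derive t 1 f a ->
  is_derive t 1 (fun x => c * f x) (c * a).
Proof. by move=> fa; exact: is_deriveZ. Qed.

Lemma is_derive_bigsum t m (f : nat -> R -> R) (a : nat -> R) :
  (forall k, (k < m)%N -> is_derive t 1 (f k) (a k)) ->
  is_derive t 1 (fun x => \sum_(k < m) f k x) (\sum_(k < m) a k).
Proof.
move=> fa; rewrite (_ : (fun x => _) = \sum_(k < m) f k).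
  by apply: is_derive_sum => i; exact: fa.
by apply/funext => x; rewrite fct_sumE.
Qed.

Lemma is_derive_inv t f a : f t != 0 -> is_derive t 1 f a ->
  is_derive t 1 (fun x => (f x)^-1) (- a / (f t) ^+ 2).
Proof.
move=> ft0 fa; apply: (is_derive_eq (is_deriveV ft0 fa)).
by rewrite /GRing.scale/= !mulNr mulrC.
Qed.

Lemma is_derive_expRM t c : is_derive t 1 (fun x => expR (c * x)) (c * expR (c * t)).
Proof.
apply: (is_derive_eq (is_derive1_comp (f := expR) (g := fun x => c * x) (is_derive_expR _) (is_derive_scale _ (is_derive_id _ _)))).
by rewrite mulr1 mulrC.
Qed.

Lemma is_derive_continuous t f a : is_derive t 1 f a -> {for t, continuous f}.
Proof. by move=> [df _]; exact/differentiable_continuous/derivable1_diffP. Qed.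

Lemma continuous_withinT f s t : {in `[s, t], continuous f} -> {within `[s, t], continuous f}.
Proof. by move=> fc; apply: continuous_in_subspaceT => x; rewrite inE/= => xst; exact: fc. Qed.

Lemma derivative_bounds f F s t m M : s <= t ->
  (forall u, s < u < t -> is_derive u 1 F (f u)) ->
  (forall u, s <= u <= t -> {for u, continuous F}) ->
  (forall u, s < u < t -> m <= f u <= M) ->
  m * (t - s) <= F t - F s <= M * (t - s).
Proof.
rewrite le_eqVlt => /predU1P[<-|st] dF cF mM; first by rewrite !subrr !mulr0 lexx.
have hd u : u \in `]s, t[ -> is_derive u 1 F (f u).
  by rewrite in_itv/=; exact: dF.
have hc : {within `[s, t], continuous F}.
  by apply: continuous_withinT => u; rewrite in_itv/=; exact: cF.
have [u uin ->] := MVT st hd hc.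
have /mM/andP[mf fM] : s < u < t by move: uin; rewrite in_itv.
by rewrite !ler_pM2r ?subr_gt0// mf fM.
Qed.

Lemma derivative_le0 f F s t : s <= t ->
  (forall u, s < u < t -> is_derive u 1 F (f u)) ->
  (forall u, s <= u <= t -> {for u, continuous F}) ->
  (forall u, s < u < t -> f u <= 0) -> F t <= F s.
Proof.
rewrite le_eqVlt => /predU1P[<-|st] dF cF f0; first exact: lexx.
have hd u : u \in `]s, t[ -> is_derive u 1 F (f u).
  by rewrite in_itv/=; exact: dF.
have hc : {within `[s, t], continuous F}.
  by apply: continuous_withinT => u; rewrite in_itv/=; exact: cF.
have [u uin E] := MVT st hd hc.
have /f0 fu : s < u < t by move: uin; rewrite in_itv.
by rewrite -subr_le0 E mulr_le0_ge0// subr_ge0 ltW.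
Qed.

(** The product [expR (- C * u) * E u] has a nonpositive derivative. *)
Lemma gronwall_zero (E dE : R -> R) C t : 0 <= t -> E 0 = 0 ->
  (forall u, 0 <= u <= t -> 0 <= E u) ->
  (forall u, 0 <= u <= t -> {for u, continuous E}) ->
  (forall u, 0 < u < t -> is_derive u 1 E (dE u)) ->
  (forall u, 0 < u < t -> dE u <= C * E u) -> E t = 0.
Proof.
move=> t0 E0 Ege cE dE' hle.
pose F u := expR (- C * u) * E u.
have : F t <= F 0.
  apply: (@derivative_le0 (fun u => - C * expR (- C * u) * E u + expR (- C * u) * dE u)) => //.
  - by move=> u ut; apply: is_derive_mul; [exact: is_derive_expRM|exact: dE'].
  - move=> u ut; apply: continuousM; last exact: cE.
    exact: is_derive_continuous (is_derive_expRM _ _).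
  - move=> u ut; rewrite [X in X <= _](_ : _ = expR (- C * u) * (dE u - C * E u)); last by ring.
    by rewrite pmulr_rle0 ?expR_gt0// subr_le0 hle.
rewrite /F E0 mulr0 pmulr_rle0 ?expR_gt0// => Et.
by apply/eqP; rewrite eq_le Et Ege// t0 lexx.
Qed.

End calculus.

(** * Ultrafilters, uniform convergence and primitives *)

Section filters.
Context {R : realType} {X : Type}.
Implicit Types (U : set_system X) (f g : X -> R) (a b c l : R).

Lemma limit_ge U {FU : ProperFilter U} f c l :
  f i @[i --> U] --> l -> (\forall i \near U, c <= f i) -> c <= l.
Proof. by move=> fl cf; rewrite -(cvg_lim _ fl)//; apply: limr_ge => //; apply: cvgP fl. Qed.

Lemma limit_le U {FU : ProperFilter U} f c l :
  f i @[i --> U] --> l -> (\forall i \near U, f i <= c) -> l <= c.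
Proof. by move=> fl cf; rewrite -(cvg_lim _ fl)//; apply: limr_le => //; apply: cvgP fl. Qed.

Lemma cvg_bigsum U {FU : Filter U} m (f : nat -> X -> R) (l : nat -> R) :
  (forall k, (k < m)%N -> f k i @[i --> U] --> l k) ->
  (\sum_(k < m) f k i) @[i --> U] --> \sum_(k < m) l k.
Proof.
elim: m => [_|m IH h].
  by under eq_fun do rewrite big_ord0; rewrite big_ord0; exact: cvg_cst.
under eq_fun do rewrite big_ord_recr; rewrite big_ord_recr/=.
by apply: cvgD; [apply: IH => k km; apply: h; exact: ltnW|exact: h].
Qed.

Lemma ultra_bounded_cvg U {UU : UltraFilter U} f a b :
  (\forall i \near U, a <= f i <= b) -> cvg (f i @[i --> U]).
Proof.
move=> fab.
have UF : UltraFilter (f @ U).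
  apply: Build_UltraFilter => G GF sG; apply/seteqP; split => // A GA.
  have [//|nA] := in_ultra_setVsetC (f @^-1` A) UU.
  have GnA : G (~` A) by apply: sG.
  have G0 : G set0 by rewrite -(setICr A); exact: (@filterI _ G (@filter_filter _ G GF)).
  by have := @filter_not_empty _ G GF G0.
have := @segment_compact R a b; rewrite compact_ultra => /(_ _ UF) [].
  by apply: filterS fab => i; rewrite /= in_itv.
by move=> l [_ h]; apply: cvgP h.
Qed.

(** Otherwise [U] and the complement of [P] would generate a proper filter, and
    some ultrafilter above it would contain [P] and its complement. *)
Lemma ultra_near U {FU : ProperFilter U} (P : set X) :
  (forall G, UltraFilter G -> U `<=` G -> G P) -> U P.
Proof.
move=> h; apply: contrapT => nUP.
pose F := filter_from U (fun A => A `&` ~` P).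
have FF : ProperFilter F.
  apply: filter_from_proper.
    apply: filter_from_filter; first by exists setT; exact: filterT.
    move=> A B UA UB; exists (A `&` B); first exact: filterI.
    by move=> x [[Ax Bx] nP].
  move=> A UA; apply: contrapT => /nonemptyPn A0; apply: nUP.
  by apply: filterS UA => x Ax; apply: contrapT => nP; rewrite -[False]/(set0 x) -A0.
have [G [GU FG]] := ultraFilterLemma FF.
have GnP : G (~` P).
  by apply: FG; exists setT; [exact: filterT|move=> x []].
have GP : G P.
  apply: h => A UA; apply: FG; exists A => //; by move=> x [].
have G0 : G set0 by rewrite -(setICr P); exact: filterI.
by have := @filter_not_empty _ G (@ultra_proper _ G GU) G0.
Qed.

(** Functions that are Lipschitz up to an error [e] that vanishes along the
    filter may have jumps, yet pointwise convergence is still uniform: it is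
    enough to control them on a finite grid whose mesh is small compared
    with [e / L]. *)
Lemma equicontinuous_uniform_cvg U {FU : ProperFilter U} (f : X -> R -> R)
    (g : R -> R) (N L : R) : 0 <= L ->
  (forall e, 0 < e -> \forall i \near U, forall s t, 0 <= s -> s <= t -> t <= N ->
     `|f i t - f i s| <= L * (t - s) + e) ->
  (forall t, 0 <= t <= N -> f i t @[i --> U] --> g t) ->
  (forall s t, 0 <= s -> s <= t -> t <= N -> `|g t - g s| <= L * (t - s)) /\
  (forall e, 0 < e -> \forall i \near U, forall t, 0 <= t <= N -> `|f i t - g t| < e).
Proof.
move=> L0 fL fg.
have gL s t : 0 <= s -> s <= t -> t <= N -> `|g t - g s| <= L * (t - s).
  move=> s0 st tN; apply/ler_addgt0Pr => e e0.
  have h : `|f i t - f i s| @[i --> U] --> `|g t - g s|.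
    have ft : f i t @[i --> U] --> g t by apply: fg; rewrite (le_trans s0 st).
    have fs : f i s @[i --> U] --> g s by apply: fg; rewrite s0 (le_trans st tN).
    exact: cvg_norm (cvgB ft fs).
  by apply: (limit_le h); apply: filterS (fL e e0) => i; exact.
split=> // e e0.
have [N0|N0] := ltP N 0.
  apply: filterE => i t /andP[t0 tN]; by have := le_lt_trans (le_trans t0 tN) N0; rewrite ltxx.
pose m := (Num.truncn (4 * (L * N + 1) / e)).
have m0 : 0 < m.+1%:R :> R by rewrite ltr0n.
pose d := N / m.+1%:R.
have d0 : 0 <= d by rewrite divr_ge0// ltW.
have Ld : L * d <= e / 4.
  have := truncnS_gt (4 * (L * N + 1) / e); rewrite -/m => hm.
  rewrite /d mulrA ler_pdivrMr//.
  move: hm; rewrite ltr_pdivrMr// => hm; lra.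
have e8 : 0 < e / 8 by lra.
near=> i.
have grid : forall k : 'I_m.+2, 0 <= k%:R * d <= N -> `|f i (k%:R * d) - g (k%:R * d)| < e / 8.
  near: i; apply: filter_forall => k.
  have [kN|kN] := boolP (0 <= k%:R * d <= N); last by apply: filterE.
  have := fg _ kN => /cvgrPdist_lt /(_ _ e8); apply: filterS => i; rewrite distrC //.
have fL8 : forall s t, 0 <= s -> s <= t -> t <= N -> `|f i t - f i s| <= L * (t - s) + e / 8.
  by near: i; exact: fL.
move=> t /andP[t0 tN].
have [d00|dne] := eqVneq d 0.
  have N00 : N = 0.
    by move: d00 => /eqP; rewrite mulf_eq0 invr_eq0 (gt_eqF m0) orbF => /eqP.
  have -> : t = 0 by apply/le_anti; rewrite t0 -{1}N00 tN.
  have := grid ord0; rewrite /= mul0r lexx N0 => /(_ isT) h; lra.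
have dp : 0 < d by rewrite lt_def dne.
pose k := Num.truncn (t / d).
have td0 : 0 <= t / d by rewrite divr_ge0.
have /andP[k1 k2] := truncn_itv td0; rewrite -/k in k1 k2.
have k1' : k%:R * d <= t by rewrite -ler_pdivlMr.
have k2' : t < k%:R * d + d.
  by move: k2; rewrite ltr_pdivrMr// -natr1 mulrDl mul1r.
have km : (k < m.+2)%N.
  rewrite ltnS -(ler_nat R); apply: le_trans k1 _.
  by rewrite ler_pdivrMr// /d mulrC divfK// gt_eqF.
have kd0 : 0 <= k%:R * d by rewrite mulr_ge0.
have g1 := grid (Ordinal km); rewrite /= kd0/= (le_trans k1' tN) in g1; have {}g1 := g1 isT.
have f1 := fL8 _ _ kd0 k1' tN.
have g2 := gL _ _ kd0 k1' tN.
have Lt : L * (t - k%:R * d) <= e / 4.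
  by apply: le_trans Ld; rewrite ler_wpM2l//; lra.
rewrite (_ : f i t - g t = (f i t - f i (k%:R * d)) + (f i (k%:R * d) - g (k%:R * d)) - (g t - g (k%:R * d))); last by ring.
have h1 := ler_normB (f i t - f i (k%:R * d) + (f i (k%:R * d) - g (k%:R * d))) (g t - g (k%:R * d)).
have h2 := ler_normD (f i t - f i (k%:R * d)) (f i (k%:R * d) - g (k%:R * d)).
lra.
Unshelve. all: by end_near. Qed.

End filters.

Section primitives.
Context {R : realType}.

(** This property of [J t = \int_0^t f] is stable under pointwise limits of [J]
    and determines [J'] wherever [f] is continuous; the passage to the fluid
    limit works with it instead of with integrals. *)
Definition mean_value_primitive (f J : R -> R) := forall s t m M,
  0 <= s -> s <= t -> (forall u, s <= u <= t -> m <= f u <= M) ->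
  m * (t - s) <= J t - J s <= M * (t - s).

Lemma primitive_of_derivative (f J : R -> R) : (forall u : R, 0 <= u -> {for u, continuous J}) ->
  (forall u : R, 0 < u -> is_derive u 1 J (f u)) -> mean_value_primitive f J.
Proof.
move=> cJ dJ s t m M s0 st fmM; apply: (@derivative_bounds _ f) => //.
- by move=> u /andP[su _]; apply: dJ; exact: le_lt_trans su.
- by move=> u /andP[su _]; apply: cJ; exact: le_trans su.
- by move=> u /andP[su ut]; apply: fmM; rewrite !ltW.
Qed.

Context {X : Type} (U : set_system X) {FU : ProperFilter U}.

(** Convergence along the product filter says that [f i] is uniformly close to
    [l] near [t], so the difference quotients of all [F i] are close to [l]
    together; so are those of the pointwise limit [G]. *)
Lemma primitive_limit_is_derive (f F : X -> R -> R) (G : R -> R) (l t : R) :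
  0 < t -> (forall i, mean_value_primitive (f i) (F i)) ->
  (forall s, 0 <= s -> F i s @[i --> U] --> G s) ->
  f p.1 p.2 @[p --> filter_prod U (nbhs t)] --> l ->
  is_derive t 1 G l.
Proof.
move=> t0 mvp FG fl.
have H : h^-1 *: ((G \o shift t) (h *: 1) - G t) @[h --> 0^'] --> l.
  apply/cvgrPdist_le => e e0.
  have /cvgrPdist_le /(_ e e0) := fl.
  move=> [[A B] /= [UA /nbhs_ballP[d /= d0 dB]] AB].
  have key s s' : 0 <= s -> s <= s' -> t - d < s -> s' < t + d ->
      (l - e) * (s' - s) <= G s' - G s <= (l + e) * (s' - s).
    move=> s0 ss ts st.
    have GF : F i s' - F i s @[i --> U] --> G s' - G s.
      exact: cvgB (FG _ (le_trans s0 ss)) (FG _ s0).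
    have b i : A i -> (l - e) * (s' - s) <= F i s' - F i s <= (l + e) * (s' - s).
      move=> Ai; apply: mvp => // u /andP[su us].
      have : B u by apply: dB; rewrite /ball/= ltr_norml; apply/andP; split; lra.
      move=> Bu; have := AB (i, u) (conj Ai Bu); rewrite /= ler_norml => /andP[? ?].
      by apply/andP; split; lra.
    by apply/andP; split; [apply: (limit_ge GF)|apply: (limit_le GF)];
      apply: filterS UA => i /b /andP[].
  near=> h.
  have h0 : h != 0 by near: h; exact: nbhs_dnbhs_neq.
  have hd : `|h| < Num.min d t.
    near: h; apply: nbhs_dnbhs; apply: (@nbhs0_lt R R).
    by rewrite lt_min d0 t0.
  have {hd} [hd ht] : `|h| < d /\ `|h| < t.
    by move: hd; rewrite lt_min => /andP[].
  rewrite /= (_ : h *: 1 = h); last by rewrite /GRing.scale/= mulr1.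
  move: hd ht; rewrite !ltr_norml => /andP[hd1 hd2] /andP[ht1 ht2].
  rewrite -[X in `|X - _|](mulKf h0 l) /GRing.scale/= -mulrBr normrM normfV.
  rewrite ler_pdivrMl ?normr_gt0//.
  have [hp|hn] := ltP 0 h.
    have /andP[k1 k2] : (l - e) * (t + h - t) <= G (t + h) - G t <= (l + e) * (t + h - t).
      by apply: key; lra.
    rewrite (addrC h) (gtr0_norm hp) ler_norml; apply/andP; split; nra.
  have {}hn : h < 0 by rewrite lt_neqAle h0.
  have /andP[k1 k2] : (l - e) * (t - (t + h)) <= G t - G (t + h) <= (l + e) * (t - (t + h)).
    by apply: key; lra.
  rewrite (addrC h) (ltr0_norm hn) ler_norml; apply/andP; split; nra.
apply: DeriveDef; first exact: cvgP H.
exact: cvg_lim H.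
Unshelve. all: by end_near. Qed.

End primitives.

(** * Drift, workload and surplus of a tandem network *)

Section tandem_algebra.
Context {R : realType}.
Implicit Types (F c : nat -> R) (a : R).

(** Rate or amount entering stage [k]: [a] from outside at stage [0], the output
    of the previous stage elsewhere. *)
Definition inflow a F (k : nat) : R := if k is j.+1 then F j else a.

(** Summation by parts along the stages. *)
Lemma sum_inflow n c a F : c n.+1 = 0 ->
  \sum_(k < n.+1) c k * (inflow a F k - F k)
    = c 0%N * a - \sum_(k < n.+1) (c k - c k.+1) * F k.
Proof.
move=> cn.
under eq_bigr do rewrite mulrBr.
rewrite sumrB big_ord_recl/=.
under [in RHS]eq_bigr do rewrite mulrBl.
rewrite sumrB.
rewrite [\sum_(i < n.+1) c i.+1 * F i]big_ord_recr/= cn mul0r addr0.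
rewrite opprB addrA -addrA; congr (_ + _); rewrite addrC -addrA.
Qed.

End tandem_algebra.

Section fluid_model.
Context {R : realType}.
Variables (n : nat) (la nu : R) (mu : nat -> R).
Hypotheses (la_gt0 : 0 < la) (nu_gt0 : 0 < nu) (mu_gt0 : forall k, 0 < mu k).
Hypothesis overload : 1 < la * \sum_(k < n.+1) (mu k)^-1.
Implicit Types (z q J K : nat -> R -> R) (x : nat -> R).

Definition mass x : R := \sum_(k < n.+1) x k.

Definition share x k : R := x k / mass x.

Definition drift x k : R :=
  inflow la (fun j => mu j * share x j) k - mu k * share x k - nu * x k.

Definition fluid_solution z : Prop :=
  [/\ forall k, (k <= n)%N -> continuous (z k) /\ (forall t, t <= 0 -> z k t = z k 0),
      forall k t, 0 <= z k t,
      forall d, 0 < d -> exists2 c, 0 < c & forall t, d <= t -> c <= mass (z ^~ t)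
    & forall (t : R) k, 0 < t -> (k <= n)%N -> is_derive t 1 (z k) (drift (z ^~ t) k)].

(** [J k t] and [K k t] stand for the integrals over [[0, t]] of the share and of
    the content of stage [k].  The bound on the sum of the [J k] is recorded
    separately because mean value bounds for each share do not add up to a
    mean value bound for the sum. *)
Definition clocks q J K : Prop :=
  [/\ forall k t, 0 <= t -> 0 <= q k t,
      forall k, (k <= n)%N -> [/\ J k 0 = 0, K k 0 = 0 & forall t, 0 <= t -> 0 <= K k t],
      forall k, (k <= n)%N -> mean_value_primitive (fun u => share (q ^~ u) k) (J k),
      forall k, (k <= n)%N -> mean_value_primitive (q k) (K k)
    & forall s t, 0 <= s -> s <= t -> \sum_(k < n.+1) (J k t - J k s) <= t - s].

(** The error made by a path in the integral form of the fluid equations. *)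
Definition residual q J K k t : R :=
  q k t - (q k 0 + inflow (la * t) (fun j => mu j * J j t) k
           - mu k * J k t - nu * K k t).

Lemma mass_ge0 x : (forall k, 0 <= x k) -> 0 <= mass x.
Proof. by move=> x0; apply: sumr_ge0. Qed.

Lemma mass_ge x k : (forall k, 0 <= x k) -> (k <= n)%N -> x k <= mass x.
Proof.
move=> x0 kn; rewrite /mass (bigD1 (Ordinal (kn : (k < n.+1)%N)))//= lerDl.
exact: sumr_ge0.
Qed.

Lemma share_ge0 x k : (forall k, 0 <= x k) -> 0 <= share x k.
Proof. by move=> x0; rewrite divr_ge0// mass_ge0. Qed.

Lemma share_le1 x k : (forall k, 0 <= x k) -> (k <= n)%N -> share x k <= 1.
Proof.
move=> x0 kn; have := mass_ge0 x0; rewrite le_eqVlt => /predU1P[T0|T0].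
  by rewrite /share -T0 invr0 mulr0 ler01.
by rewrite /share ler_pdivrMr// mul1r mass_ge.
Qed.

Lemma sum_share x : mass x != 0 -> \sum_(k < n.+1) share x k = 1.
Proof. by move=> T0; rewrite -mulr_suml divff. Qed.

(** Expected service requirement from stage [k] on. *)
Definition work k : R := \sum_(k <= j < n.+1) (mu j)^-1.

Definition workload x : R := \sum_(k < n.+1) work k * x k.

(** By [workload_drift], the net growth rate of the workload when nobody
    abandons; it is positive in overload. *)
Definition surplus : R := la * work 0 - 1.

Lemma surplus_gt0 : 0 < surplus.
Proof. by rewrite subr_gt0 /work big_mkord. Qed.

Lemma work_ge0 k : 0 <= work k.
Proof. by apply: sumr_ge0 => i _; rewrite invr_ge0 ltW. Qed.

Lemma workS k : (k <= n)%N -> work k - work k.+1 = (mu k)^-1.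
Proof. by move=> kn; rewrite /work big_ltn// addrK. Qed.

Lemma work_last : work n.+1 = 0.
Proof. by rewrite /work big_geq. Qed.

Lemma work_le k : work k <= work 0.
Proof.
have [kn|kn] := leqP k n.+1; last first.
  by rewrite {1}/work big_geq; [exact: work_ge0|exact: ltnW].
rewrite [leRHS]/work (big_cat_nat (n := k))//= lerDr sumr_ge0// => i _.
by rewrite invr_ge0 ltW.
Qed.

Lemma work0_gt0 : 0 < work 0.
Proof. by have := surplus_gt0; rewrite subr_gt0 => /(lt_trans ltr01); rewrite pmulr_rgt0. Qed.

Lemma workload_ge0 x : (forall k, 0 <= x k) -> 0 <= workload x.
Proof. by move=> x0; apply: sumr_ge0 => k _; rewrite mulr_ge0// work_ge0. Qed.

Lemma workload_le x : (forall k, 0 <= x k) -> workload x <= work 0 * mass x.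
Proof.
by move=> x0; rewrite mulr_sumr; apply: ler_sum => k _; rewrite ler_wpM2r// work_le.
Qed.

Lemma workload_gt0 x : (forall k, 0 <= x k) -> 0 < mass x -> 0 < workload x.
Proof.
move=> x0 T0; have wn : 0 < (mu n)^-1 by rewrite invr_gt0.
have : (mu n)^-1 * mass x <= workload x.
  rewrite mulr_sumr; apply: ler_sum => k _; rewrite ler_wpM2r//.
  have kn : (k <= n)%N by rewrite -ltnS.
  rewrite /work big_nat_recr//= lerDr sumr_ge0// => i _.
  by rewrite invr_ge0 ltW.
by apply: lt_le_trans; rewrite mulr_gt0.
Qed.

(** One unit of service lowers the workload by one unit whatever its stage. *)
Lemma sum_work_inflow a (F : nat -> R) :
  \sum_(k < n.+1) work k * (inflow a (fun j => mu j * F j) k - mu k * F k)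
    = work 0 * a - \sum_(k < n.+1) F k.
Proof.
rewrite (@sum_inflow _ n work a (fun j => mu j * F j)) ?work_last//; congr (_ - _).
apply: eq_bigr => k _; rewrite workS; last by rewrite -ltnS.
by rewrite mulKf// gt_eqF.
Qed.

Lemma workload_drift x : mass x != 0 ->
  \sum_(k < n.+1) work k * drift x k = surplus - nu * workload x.
Proof.
move=> T0; rewrite /drift; under eq_bigr do rewrite mulrBr.
rewrite sumrB sum_work_inflow sum_share// /surplus mulrC; congr (_ - _).
by rewrite /workload mulr_sumr; apply: eq_bigr => k _; rewrite mulrCA.
Qed.

(** If the last hypothesis were an equality, [w] would solve the linear equation
    [w' = kap - nu * w].  In general [f u = w u + nu * W u - kap * u] is only
    nondecreasing, and replacing [f] by its final value bounds [W t] from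
    above by the solution of a linear equation. *)
Lemma workload_lower_bound (w W : R -> R) (kap t : R) : 0 <= t ->
  W 0 = 0 -> (forall u : R, 0 <= u -> {for u, continuous W}) ->
  (forall u : R, 0 < u -> is_derive u 1 W (w u)) ->
  0 <= w 0 ->
  (forall s u, 0 <= s -> s <= u ->
     w s + nu * W s - kap * s <= w u + nu * W u - kap * u) ->
  kap / nu * (1 - expR (- nu * t)) <= w t.
Proof.
move=> t0 W0 cW dW w0 mono.
pose f u := w u + nu * W u - kap * u.
(* [g] is the distance from [W] to a particular solution of
   [y' = f t + kap * u - nu * y]. *)
pose g u := W u - (f t / nu + kap / nu * u - kap / nu ^+ 2).
pose m u := expR (nu * u) * g u.
have nu0 : nu != 0 by rewrite gt_eqF.
have dg (u : R) : 0 < u -> is_derive u 1 g (w u - kap / nu).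
  move=> u0.
  have -> : w u - kap / nu = w u - (0 + kap / nu * 1 - 0) by ring.
  have h : is_derive u 1 (fun u => f t / nu + kap / nu * u - kap / nu ^+ 2)
      (0 + kap / nu * 1 - 0).
    apply: is_derive_sub; apply: is_derive_add; exact: is_derive_scale.
  exact: is_derive_sub (dW u u0) h.
have cg (u : R) : 0 <= u -> {for u, continuous g}.
  move=> u0; apply: continuousB; first exact: cW.
  apply: continuousB; last exact: cvg_cst.
  by apply: continuousD; [exact: cvg_cst|apply: continuousM; [exact: cvg_cst|exact: cvg_id]].
have : m t <= m 0.
  apply: (@derivative_le0 R (fun u => nu * expR (nu * u) * g u + expR (nu * u) * (w u - kap / nu))) => //.
  - by move=> u /andP[u0 _]; apply: is_derive_mul; [exact: is_derive_expRM|exact: dg].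
  - move=> u /andP[u0 _].
    have e1 := is_derive_continuous (is_derive_expRM u nu).
    exact: continuousM e1 (cg _ u0).
  - move=> u /andP[u0 ut].
    rewrite [X in X <= 0](_ : _ = expR (nu * u) * (f u - f t)); last by rewrite /g /f; field.
    by rewrite pmulr_rle0 ?expR_gt0// subr_le0 mono// ltW.
rewrite /m mulr0 expR0 mul1r /g W0 => h.
have ft : 0 <= f t.
  have := mono 0 t (lexx _) t0; rewrite W0 !mulr0 addr0 subr0; exact: le_trans.
have e1 : expR (nu * t) * expR (- nu * t) = 1 by rewrite -expRD mulNr subrr expR0.
have ep := expR_gt0 (- nu * t).
have {h} := ler_wpM2l (ltW ep) h.
rewrite mulrA (mulrC (expR (- nu * t))) e1 mul1r mulr0 addr0.
move=> h.
have {h} := ler_wpM2l (ltW nu_gt0) h.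
rewrite (_ : nu * (W t - _) = nu * W t - f t - kap * t + kap / nu); last by field.
rewrite (_ : nu * (_ * _) = expR (- nu * t) * (kap / nu - f t)); last by field.
have := mulr_ge0 (ltW ep) ft.
rewrite /f; lra.
Qed.

End fluid_model.

(** * Ultralimits of approximate solutions *)

(** A path on the half-line is extended by its initial value. *)
Lemma lipschitz_half_line_continuous (R : realType) (f : R -> R) :
  (forall t, f t = f (Num.max t 0)) ->
  (forall N, exists2 L, 0 <= L & forall s t, 0 <= s -> s <= t -> t <= N ->
     `|f t - f s| <= L * (t - s)) ->
  continuous f.
Proof.
move=> f0 fL t; apply/cvgrPdist_le => e e0.
have [L L0 hL] := fL (`|t| + 1).
have key a b : a <= b -> b <= `|t| + 1 -> `|f b - f a| <= L * (b - a).
  move=> ab bN; rewrite (f0 a) (f0 b).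
  have m1 : 0 <= Num.max a 0 by rewrite le_max lexx orbT.
  have m2 : Num.max a 0 <= Num.max b 0 by rewrite ge_max !le_max ab lexx orbT.
  have m3 : Num.max b 0 <= `|t| + 1 by rewrite ge_max bN/= addr_ge0.
  apply: le_trans (hL _ _ m1 m2 m3) _; rewrite ler_wpM2l//.
  by rewrite /Num.max; case: ltP => ?; case: ltP => ?; lra.
near=> s.
have st1 : `|t - s| < 1 by near: s; apply: cvgr_dist_lt.
have st2 : `|t - s| < e / (L + 1).
  near: s; apply: cvgr_dist_lt => //; first by rewrite divr_gt0// ltr_wpDl.
have Le : L * `|t - s| <= e.
  move: st2; rewrite ltr_pdivlMr ?ltr_wpDl// => h.
  by have := normr_ge0 (t - s); nra.
have tt := ler_norm t.
move: st1; rewrite ltr_norml => /andP[h1 h2].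
apply: le_trans Le; have [st|/ltW ts] := leP s t.
  by rewrite (ger0_norm (_ : 0 <= t - s)) ?subr_ge0//; apply: key => //; lra.
rewrite distrC [X in L * X]distrC (ger0_norm (_ : 0 <= s - t)) ?subr_ge0//.
by apply: key => //; lra.
Unshelve. all: by end_near. Qed.

Section fluid_limit.
Context {R : realType}.
Variables (n : nat) (la nu : R) (mu : nat -> R).
Hypotheses (la_gt0 : 0 < la) (nu_gt0 : 0 < nu) (mu_gt0 : forall k, 0 < mu k).
Hypothesis overload : 1 < la * \sum_(k < n.+1) (mu k)^-1.
Context {X : Type} (U : set_system X) {UU : UltraFilter U}.
Variables (q J K : X -> nat -> R -> R) (x : nat -> R).
Hypothesis q_clocks : forall i, clocks n (q i) (J i) (K i).
Hypothesis q_residual : forall k N e, (k <= n)%N -> 0 < e ->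
  \forall i \near U, forall t, 0 <= t <= N ->
    `|residual la nu mu (q i) (J i) (K i) k t| <= e.
Hypothesis q_start : forall k, (k <= n)%N -> q i k 0 @[i --> U] --> x k.

Let inrate k : R := inflow la mu k.

Lemma inrate_ge0 k : 0 <= inrate k.
Proof. by case: k => [|k]; rewrite ltW// mu_gt0. Qed.

Let J_lip i k (s t : R) : (k <= n)%N -> 0 <= s -> s <= t -> 0 <= J i k t - J i k s <= t - s.
Proof.
move=> kn s0 st; have [q0 _ hJ _ _] := q_clocks i.
have := hJ k kn s t 0 1 s0 st; rewrite mul0r mul1r; apply => u /andP[su _].
by rewrite share_ge0 ?share_le1// => j; apply: q0; exact: le_trans su.
Qed.

Let J_bound i k (t : R) : (k <= n)%N -> 0 <= t -> 0 <= J i k t <= t.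
Proof.
move=> kn t0; have [_ h _ _ _] := q_clocks i; have [J0 _ _] := h k kn.
by have := J_lip i kn (lexx 0) t0; rewrite J0 !subr0.
Qed.

Let inflow_lip i k (s t : R) : (k <= n)%N -> 0 <= s -> s <= t ->
  0 <= inflow (la * t) (fun j => mu j * J i j t) k
       - inflow (la * s) (fun j => mu j * J i j s) k <= inrate k * (t - s).
Proof.
move=> + s0 st; case: k => [|k] kn.
  by rewrite /= -mulrBr lexx mulr_ge0// ?subr_ge0// ltW.
rewrite /= -mulrBr; have /andP[h1 h2] := J_lip i (ltnW kn) s0 st.
by rewrite mulr_ge0//= ?ler_wpM2l// ltW.
Qed.

Let inflow_bound i k (t : R) : (k <= n)%N -> 0 <= t ->
  inflow (la * t) (fun j => mu j * J i j t) k <= inrate k * t.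
Proof.
move=> kn t0; have /andP[_] := inflow_lip i kn (lexx 0) t0.
rewrite subr0; case: k kn => [|k] kn /=; first by rewrite mulr0 subr0.
have [_ h _ _ _] := q_clocks i; have [J0 _ _] := h k (ltnW kn).
by rewrite J0 mulr0 subr0.
Qed.

(** The content of a stage is at most its initial content plus what entered it,
    and a stage serves at most at its full rate. *)
Lemma eventually_bounded k N : (k <= n)%N -> exists2 C, 0 <= C &
  \forall i \near U, forall t, 0 <= t <= N -> 0 <= q i k t <= C.
Proof.
move=> kn; exists (`|x k| + 2 + inrate k * `|N|).
  by rewrite !addr_ge0// mulr_ge0// inrate_ge0.
near=> i => t /andP[t0 tN]; have [q0 JK0 _ _ _] := q_clocks i.
rewrite q0//=.
have r1 : `|residual la nu mu (q i) (J i) (K i) k t| <= 1.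
  have : forall t, 0 <= t <= N -> `|residual la nu mu (q i) (J i) (K i) k t| <= 1.
    by near: i; exact: q_residual.
  by apply; rewrite t0.
have x1 : `|x k - q i k 0| < 1 by near: i; apply: cvgr_dist_lt; first exact: q_start.
have i1 := inflow_bound i kn t0.
have /andP[j1 _] := J_bound i kn t0.
have [_ _ k0] := JK0 k kn; have {}k0 := k0 t t0.
have m1 := mulr_ge0 (ltW (mu_gt0 k)) j1.
have m2 := mulr_ge0 (ltW nu_gt0) k0.
have iN : inrate k * t <= inrate k * `|N|.
  by rewrite ler_wpM2l ?inrate_ge0// (le_trans tN)// ler_norm.
have xx := ler_norm (x k).
move: r1 x1; rewrite /residual ler_norml ltr_norml => /andP[_ r1] /andP[x1 _].
lra.
Unshelve. all: by end_near. Qed.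

Let K_lip i k s t N C : (k <= n)%N -> 0 <= s -> s <= t -> t <= N ->
  (forall t, 0 <= t <= N -> 0 <= q i k t <= C) ->
  0 <= K i k t - K i k s <= C * (t - s).
Proof.
move=> kn s0 st tN hC; have [_ _ _ hK _] := q_clocks i.
have := hK k kn s t 0 C s0 st; rewrite mul0r; apply => u /andP[su ut].
by apply: hC; rewrite (le_trans s0 su) (le_trans ut tN).
Qed.

Lemma eventually_lipschitz k N : (k <= n)%N -> exists2 L, 0 <= L &
  forall e, 0 < e -> \forall i \near U, forall s t, 0 <= s -> s <= t -> t <= N ->
    `|q i k t - q i k s| <= L * (t - s) + e.
Proof.
move=> kn; have [C C0 hC] := eventually_bounded N kn.
exists (inrate k + mu k + nu * C).
  by rewrite !addr_ge0 ?inrate_ge0// ?mulr_ge0// ltW.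
move=> e e0; have e2 : 0 < e / 2 by rewrite divr_gt0.
near=> i => s t s0 st tN.
have t0 := le_trans s0 st; have sN := le_trans st tN.
have r : forall t, 0 <= t <= N -> `|residual la nu mu (q i) (J i) (K i) k t| <= e / 2.
  by near: i; exact: q_residual.
have c : forall t, 0 <= t <= N -> 0 <= q i k t <= C by near: i.
have /andP[a1 a2] := K_lip kn s0 st tN c.
have /andP[b1 b2] := J_lip i kn s0 st.
have /andP[d1 d2] := inflow_lip i kn s0 st.
have := r t; rewrite t0 tN => /(_ isT).
have := r s; rewrite s0 sN => /(_ isT).
rewrite /residual !ler_norml => /andP[r1 r2] /andP[r3 r4].
have m1 := mulr_ge0 (ltW (mu_gt0 k)) b1.
have m2 := mulr_ge0 (ltW nu_gt0) a1.
have m3 := ler_wpM2l (ltW (mu_gt0 k)) b2.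
have m4 := ler_wpM2l (ltW nu_gt0) a2.
have m5 := mulr_ge0 (inrate_ge0 k) (_ : 0 <= t - s); have {}m5 := m5 ltac:(by rewrite subr_ge0).
rewrite !mulrDl -!(mulrA nu).
by apply/andP; split; lra.
Unshelve. all: by end_near. Qed.

(* Along an ultrafilter every bounded function converges, so that no
   subsequence has to be extracted. *)
Let z k (t : R) : R := if (k <= n)%N then lim (q i k (Num.max t 0) @[i --> U]) else 0.
Let Jl k (t : R) : R := lim (J i k (Num.max t 0) @[i --> U]).
Let Kl k (t : R) : R := lim (K i k (Num.max t 0) @[i --> U]).

Let q_cvg k (t : R) : (k <= n)%N -> 0 <= t -> q i k t @[i --> U] --> z k t.
Proof.
move=> kn t0; rewrite /z kn (max_idPl t0).
have [C C0 hC] := eventually_bounded t kn.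
apply: (@ultra_bounded_cvg _ _ _ _ _ 0 C).
by apply: filterS hC => i; apply; rewrite t0 lexx.
Qed.

Let J_cvg k (t : R) : (k <= n)%N -> 0 <= t -> J i k t @[i --> U] --> Jl k t.
Proof.
move=> kn t0; rewrite /Jl (max_idPl t0).
apply: (@ultra_bounded_cvg _ _ _ _ _ 0 t).
by apply: filterE => i; exact: J_bound.
Qed.

Let K_cvg k (t : R) : (k <= n)%N -> 0 <= t -> K i k t @[i --> U] --> Kl k t.
Proof.
move=> kn t0; rewrite /Kl (max_idPl t0).
have [C C0 hC] := eventually_bounded t kn.
apply: (@ultra_bounded_cvg _ _ _ _ _ 0 (C * t)).
apply: filterS hC => i hC; have [_ h _ _ _] := q_clocks i.
have [_ K0 _] := h k kn.
by have := K_lip kn (lexx 0) t0 (lexx t) hC; rewrite K0 !subr0.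
Qed.

Let q_uniform k N : (k <= n)%N ->
  (exists2 L, 0 <= L & forall s t, 0 <= s -> s <= t -> t <= N ->
     `|z k t - z k s| <= L * (t - s)) /\
  (forall e, 0 < e ->
     \forall i \near U, forall t, 0 <= t <= N -> `|q i k t - z k t| < e).
Proof.
move=> kn; have [L L0 hL] := eventually_lipschitz N kn.
have qz t : 0 <= t <= N -> q i k t @[i --> U] --> z k t.
  by move=> /andP[t0 _]; exact: q_cvg.
by have [] := equicontinuous_uniform_cvg L0 hL qz; split => //; exists L.
Qed.

Let max_max t : Num.max t 0 = Num.max (Num.max t 0) 0 :> R.
Proof. by rewrite -maxA maxxx. Qed.

Let z_continuous k : (k <= n)%N -> continuous (z k).
Proof.
move=> kn; apply: lipschitz_half_line_continuous => [t|N].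
  by rewrite /z kn -max_max.
by have [] := q_uniform N kn.
Qed.

Let Jl_lip k (s t : R) : (k <= n)%N -> 0 <= s -> s <= t -> 0 <= Jl k t - Jl k s <= t - s.
Proof.
move=> kn s0 st.
have h : J i k t - J i k s @[i --> U] --> Jl k t - Jl k s.
  exact: cvgB (J_cvg kn (le_trans s0 st)) (J_cvg kn s0).
by apply/andP; split; [apply: (limit_ge h)|apply: (limit_le h)];
  apply: filterE => i; have /andP[] := J_lip i kn s0 st.
Qed.

Let Jl_continuous k : (k <= n)%N -> continuous (Jl k).
Proof.
move=> kn; apply: lipschitz_half_line_continuous => [t|N].
  by rewrite /Jl -max_max.
exists 1 => // s t s0 st _; have /andP[h1 h2] := Jl_lip kn s0 st.
by rewrite mul1r ger0_norm.
Qed.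

Let Kl_continuous k : (k <= n)%N -> continuous (Kl k).
Proof.
move=> kn; apply: lipschitz_half_line_continuous => [t|N].
  by rewrite /Kl -max_max.
have [C C0 hC] := eventually_bounded N kn.
exists C => // s t s0 st tN.
have h : `|K i k t - K i k s| @[i --> U] --> `|Kl k t - Kl k s|.
  exact: cvg_norm (cvgB (K_cvg kn (le_trans s0 st)) (K_cvg kn s0)).
apply: (limit_le h); apply: filterS hC => i hC.
by have /andP[h1 h2] := K_lip kn s0 st tN hC; rewrite ger0_norm.
Qed.

Let z_ge0 k (t : R) : 0 <= z k t.
Proof.
rewrite /z; case: ifPn => // kn.
have m0 : 0 <= Num.max t 0 by rewrite le_max lexx orbT.
have := q_cvg kn m0; rewrite /z kn -max_max => h.
by apply: (limit_ge h); apply: filterE => i; have [q0 _ _ _ _] := q_clocks i; exact: q0.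
Qed.

Let z_start k : (k <= n)%N -> z k 0 = x k.
Proof.
by move=> kn; apply: cvg_unique (q_cvg kn (lexx 0)) (q_start kn).
Qed.

Let inflow_cvg k (t : R) : (k <= n)%N -> 0 <= t ->
  inflow (la * t) (fun j => mu j * J i j t) k @[i --> U]
    --> inflow (la * t) (fun j => mu j * Jl j t) k.
Proof.
case: k => [|k] kn t0 /=; first exact: cvg_cst.
by apply: cvgM; [exact: cvg_cst|exact: J_cvg (ltnW kn) t0].
Qed.

Let z_residual k (t : R) : (k <= n)%N -> 0 <= t -> residual la nu mu z Jl Kl k t = 0.
Proof.
move=> kn t0.
have h : residual la nu mu (q i) (J i) (K i) k t @[i --> U]
    --> residual la nu mu z Jl Kl k t.
  apply: cvgB; first exact: q_cvg.
  apply: cvgB; last by apply: cvgM; [exact: cvg_cst|exact: K_cvg].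
  apply: cvgB; last by apply: cvgM; [exact: cvg_cst|exact: J_cvg].
  by apply: cvgD; [exact: q_cvg|exact: inflow_cvg].
apply/eqP; rewrite -normr_le0; apply/ler_addgt0Pr => e e0; rewrite add0r.
have {}h : `|residual la nu mu (q i) (J i) (K i) k t| @[i --> U]
    --> `|residual la nu mu z Jl Kl k t| by exact: cvg_norm.
apply: (limit_le h).
by apply: filterS (q_residual t kn e0) => i; apply; rewrite t0 lexx.
Qed.

Let z_eq k (t : R) : (k <= n)%N -> 0 <= t ->
  z k t = x k + inflow (la * t) (fun j => mu j * Jl j t) k - mu k * Jl k t - nu * Kl k t.
Proof.
by move=> kn t0; have /eqP := z_residual kn t0; rewrite subr_eq0 z_start// => /eqP.
Qed.

Let JK_start k : (k <= n)%N -> [/\ Jl k 0 = 0, Kl k 0 = 0 & forall t, 0 <= t -> 0 <= Kl k t].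
Proof.
move=> kn; split.
- apply: cvg_unique (J_cvg kn (lexx 0)) _ => //.
  rewrite (_ : (fun i => _) = fun=> 0); first exact: cvg_cst.
  by apply/funext => i; have [_ h _ _ _] := q_clocks i; have [] := h k kn.
- apply: cvg_unique (K_cvg kn (lexx 0)) _ => //.
  rewrite (_ : (fun i => _) = fun=> 0); first exact: cvg_cst.
  by apply/funext => i; have [_ h _ _ _] := q_clocks i; have [] := h k kn.
- move=> t t0; apply: (limit_ge (K_cvg kn t0)); apply: filterE => i.
  by have [_ h _ _ _] := q_clocks i; have [_ _] := h k kn; exact.
Qed.

Let sum_Jl s t : 0 <= s -> s <= t -> \sum_(k < n.+1) (Jl k t - Jl k s) <= t - s.
Proof.
move=> s0 st; have h : \sum_(k < n.+1) (J i k t - J i k s) @[i --> U]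
    --> \sum_(k < n.+1) (Jl k t - Jl k s).
  apply: (@cvg_bigsum _ _ _ _ n.+1 (fun k i => J i k t - J i k s) (fun k => Jl k t - Jl k s)) => k kn.
  exact: cvgB (J_cvg kn (le_trans s0 st)) (J_cvg kn s0).
apply: (limit_le h); apply: filterE => i; have [_ _ _ _] := q_clocks i; exact.
Qed.

Let q_joint_cvg k (t : R) : (k <= n)%N -> 0 < t ->
  q p.1 k p.2 @[p --> filter_prod U (nbhs t)] --> z k t.
Proof.
move=> kn t0; apply/cvgrPdist_lt => e e0; have e2 : 0 < e / 2 by rewrite divr_gt0.
have [_ /(_ _ e2) hU] := q_uniform (t + 1) kn.
have /cvgrPdist_lt /(_ _ e2) hz : z k s @[s --> t] --> z k t by exact: z_continuous.
have m0 : 0 < Num.min t 1 by rewrite lt_min t0 ltr01.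
have /cvgrPdist_lt /(_ _ m0) ht : s @[s --> t] --> t by exact: cvg_id.
exists ([set i | forall s, 0 <= s <= t + 1 -> `|q i k s - z k s| < e / 2],
        [set s | `|z k t - z k s| < e / 2 /\ `|t - s| < Num.min t 1]) => /=.
  by split => //=; exact: filterI.
move=> [i s] /= [h1 [h2]]; rewrite lt_min !ltr_norml => /andP[/andP[? ?] /andP[? ?]].
have s1 : 0 <= s <= t + 1 by apply/andP; split; lra.
have := h1 s s1; move: h2; rewrite !ltr_norml => /andP[? ?] /andP[? ?].
by apply/andP; split; lra.
Qed.

Let Kl_derive k (t : R) : (k <= n)%N -> 0 < t -> is_derive t 1 (Kl k) (z k t).
Proof.
move=> kn t0; apply: (primitive_limit_is_derive (f := fun i => q i k) (F := fun i => K i k) t0 _ _ (q_joint_cvg kn t0)) => [i|s s0].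
  by have [_ _ _ h _] := q_clocks i; exact: h.
exact: K_cvg.
Qed.

Let w t := workload n mu (z ^~ t).
Let W t := \sum_(k < n.+1) work n mu k * Kl k t.

Let w_eq (t : R) : 0 <= t ->
  w t + nu * W t - surplus n la mu * t = w 0 + (t - \sum_(k < n.+1) Jl k t).
Proof.
move=> t0.
have -> : w t = w 0 + (work n mu 0 * (la * t) - \sum_(k < n.+1) Jl k t) - nu * W t.
  rewrite -(sum_work_inflow n mu_gt0 _ (fun k => Jl k t)) /w /workload /W mulr_sumr -big_split/= -sumrB.
  apply: eq_bigr => k _; have kn : (k <= n)%N by rewrite -ltnS.
  by rewrite z_eq// z_start//; ring.
by rewrite /surplus; ring.
Qed.

(** This bound does not depend on the initial state.  It keeps the limit away
    from the origin at positive times, where the shares are discontinuous. *)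
Lemma limit_workload (t : R) : 0 <= t ->
  surplus n la mu / nu * (1 - expR (- nu * t)) <= w t.
Proof.
move=> t0; apply: (@workload_lower_bound _ _ nu_gt0 w W) => //.
- by rewrite /W big1// => k _; have [_ -> _] := JK_start (ltn_ord k : (k <= n)%N); rewrite mulr0.
- move=> u _; apply: (@cvg_bigsum _ _ _ _ n.+1 (fun k u => work n mu k * Kl k u) (fun k => work n mu k * Kl k u)) => k kn.
  by apply: cvgM; [exact: cvg_cst|exact: Kl_continuous].
- move=> u u0; apply: (@is_derive_bigsum _ _ _ (fun k u => work n mu k * Kl k u) (fun k => work n mu k * z k u)) => k kn.
  exact: is_derive_scale (Kl_derive kn u0).
- by apply: workload_ge0.
- move=> s u s0 su; rewrite !w_eq// ?(le_trans s0 su)// lerD2l.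
  by have := sum_Jl s0 su; rewrite sumrB; lra.
Qed.

Let mass_lower (d t : R) : 0 < d -> d <= t ->
  0 < surplus n la mu / nu * (1 - expR (- nu * d)) / work n mu 0
    <= mass n (z ^~ t).
Proof.
move=> d0 dt; have w0 := work0_gt0 la_gt0 overload.
have s0 := surplus_gt0 overload.
apply/andP; split.
  rewrite divr_gt0// mulr_gt0 ?divr_gt0// subr_gt0 -[ltRHS]expR0 ltr_expR.
  by rewrite mulNr oppr_lt0 mulr_gt0.
rewrite ler_pdivrMr// [leRHS]mulrC.
apply: le_trans (workload_le n mu_gt0 _) => //.
apply: le_trans (limit_workload (le_trans (ltW d0) dt)).
apply: ler_wpM2l; first by rewrite divr_ge0// ltW.
rewrite lerD2l lerN2 ler_expR.
by rewrite !mulNr lerN2 ler_wpM2l// ltW.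
Qed.

Let mass_gt0 (t : R) : 0 < t -> 0 < mass n (z ^~ t).
Proof. by move=> t0; have /andP[] := mass_lower t0 (lexx t); exact: lt_le_trans. Qed.

Let Jl_derive k (t : R) : (k <= n)%N -> 0 < t ->
  is_derive t 1 (Jl k) (share n (z ^~ t) k).
Proof.
move=> kn t0; apply: (primitive_limit_is_derive (U := U) (f := fun i u => share n ((q i) ^~ u) k) (F := fun i => J i k) t0) => [i|s s0|].
- by have [_ _ h _ _] := q_clocks i; exact: h.
- exact: J_cvg.
- apply: cvgM; first exact: q_joint_cvg.
  apply: cvgV; first by rewrite gt_eqF// mass_gt0.
  apply: (@cvg_bigsum _ _ _ _ n.+1 (fun k p => q p.1 k p.2) (fun k => z k t)) => j jn.
  exact: q_joint_cvg.
Qed.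

(** The approximate solutions are asymptotically Lipschitz, so their pointwise
    limit is locally uniform.  At positive times the limit is not the origin,
    hence the shares converge too, and the limits of [J] and [K] have the
    derivatives that the fluid equations require. *)
Theorem ultra_fluid_limit : exists z J K,
  [/\ fluid_solution n la nu mu z, clocks n z J K,
      forall k t, (k <= n)%N -> 0 <= t -> residual la nu mu z J K k t = 0,
      forall k, (k <= n)%N -> z k 0 = x k
    & forall k N e, (k <= n)%N -> 0 < e ->
        \forall i \near U, forall t, 0 <= t <= N -> `|q i k t - z k t| < e].
Proof.
exists z, Jl, Kl; split; first split.
- move=> k kn; split; first exact: z_continuous.
  by move=> t t0; rewrite /z kn maxxx (max_idPr t0).
- exact: z_ge0.
- move=> d d0; have /andP[c0 _] := mass_lower d0 (lexx d).
  by eexists; [exact: c0|move=> t dt; have /andP[] := mass_lower d0 dt].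
- move=> t k t0 kn.
  apply: (@near_eq_is_derive _ _ _ (fun t => x k + inflow (la * t) (fun j => mu j * Jl j t) k - mu k * Jl k t - nu * Kl k t)).
    near=> s; rewrite z_eq// ltW//; near: s; exact: lt_nbhsr.
  rewrite -[drift _ _ _ _ _ _]/(_ - _ - _).
  apply: is_derive_sub; last exact: is_derive_scale (Kl_derive kn t0).
  apply: is_derive_sub; last exact: is_derive_scale (Jl_derive kn t0).
  rewrite -[X in is_derive _ _ _ X]add0r; apply: is_derive_add.
  case: k kn => [|k] kn /=; last exact: is_derive_scale (Jl_derive (ltnW kn) t0).
  by rewrite -[X in is_derive _ _ _ X]mulr1; exact: is_derive_scale.
- split.
  + by move=> k t _; exact: z_ge0.
  + exact: JK_start.
  + move=> k kn; apply: primitive_of_derivative => [u _|u u0]; first exact: Jl_continuous.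
    exact: Jl_derive.
  + move=> k kn; apply: primitive_of_derivative => [u _|u u0]; first exact: Kl_continuous.
    exact: Kl_derive.
  + exact: sum_Jl.
- exact: z_residual.
- exact: z_start.
- by move=> k N e kn e0; have [_] := q_uniform N kn; exact.
Unshelve. all: by end_near. Qed.

End fluid_limit.

(** * Uniqueness from a nonzero state *)

Section analysis_facts.
Context {R : realType}.

Lemma sqr_sum_le m (a : nat -> R) :
  (\sum_(k < m) a k) ^+ 2 <= m%:R * \sum_(k < m) (a k) ^+ 2.
Proof.
have -> : m%:R * \sum_(k < m) (a k) ^+ 2
    = \sum_(j < m) \sum_(k < m) ((a j) ^+ 2 / 2 + (a k) ^+ 2 / 2).
  under [RHS]eq_bigr do rewrite big_split/= sumr_const card_ord.
  rewrite big_split/= sumr_const card_ord sumrMnl -mulr_suml -mulr2n.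
  by rewrite -mulrnA mulnC mulrnA -[_ *+ 2]mulr_natr divfK// mulr_natl.
rewrite expr2 big_distrlr/=; apply: ler_sum => j _; apply: ler_sum => k _.
have := sqr_ge0 (a j - a k); nra.
Qed.

(** Since [\int_0 dt / t] diverges, a bounded [V] with [V' <= - g V / t] is
    zero. *)
Lemma log_decay_zero (V dV : R -> R) (B g t1 : R) : 0 < g ->
  (forall t : R, 0 < t -> is_derive t 1 V (dV t)) ->
  (forall t, 0 < t -> 0 <= V t <= B) ->
  (forall t, 0 < t -> dV t <= - (g / t) * V t) ->
  0 < t1 -> V t1 = 0.
Proof.
move=> g0 dVt VB hdV t10; apply/eqP; rewrite eq_le; have /andP[-> _] := VB t1 t10.
rewrite andbT leNgt; apply/negP => eta0.
have cV (t : R) : 0 < t -> {for t, continuous V}.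
  by move=> t0; exact: is_derive_continuous (dVt t t0).
have mono (s t : R) : 0 < s -> s <= t -> V t <= V s.
  move=> s0 st; apply: (@derivative_le0 R dV) => // [u /andP[su _]|u /andP[su _]|u /andP[su _]].
  - exact: dVt (lt_trans s0 su).
  - exact: cV (lt_le_trans s0 su).
  - have u0 := lt_trans s0 su; apply: le_trans (hdV u u0) _.
    rewrite mulNr oppr_le0; apply: mulr_ge0; first by rewrite divr_ge0// ltW.
    by have /andP[] := VB u u0.
pose b := g * V t1.
have b0 : 0 < b by rewrite mulr_gt0.
have B0 : 0 <= B by have /andP[h1 h2] := VB t1 t10; exact: le_trans h2.
(* From [t1] back to [s], the function [b * ln] drops by [B]. *)
pose s := t1 * expR (- (B / b)).
have s0 : 0 < s by rewrite mulr_gt0 ?expR_gt0.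
have st : s <= t1.
  rewrite -[leRHS]mulr1; apply: ler_wpM2l; first exact: ltW.
  rewrite -[leRHS]expR0 ler_expR oppr_le0.
  by rewrite divr_ge0// ltW.
have dh (u : R) : 0 < u -> is_derive u 1 (fun u => V u + b * ln u) (dV u + b * u^-1).
  move=> u0; apply: is_derive_add; first exact: dVt.
  by apply: is_derive_scale; exact: is_derive1_ln.
have : V t1 + b * ln t1 <= V s + b * ln s.
  apply: (@derivative_le0 R (fun u => dV u + b * u^-1) (fun u => V u + b * ln u)) => // [u /andP[su _]|u /andP[su _]|u /andP[su ut]].
  - exact: dh (lt_trans s0 su).
  - exact: is_derive_continuous (dh u (lt_le_trans s0 su)).
  - have u0 := lt_trans s0 su.
    have h1 := hdV u u0; have h2 := mono u t1 u0 (ltW ut).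
    have : g / u * V t1 <= g / u * V u by rewrite ler_wpM2l// ltW// divr_gt0.
    rewrite (_ : b * u^-1 = g / u * V t1); last by rewrite /b; ring.
    lra.
rewrite /s lnM ?posrE ?expR_gt0// expRK.
have /andP[_ h] := VB s s0.
have : b * (B / b) = B by rewrite mulrC divfK// gt_eqF.
rewrite mulrDr mulrN; lra.
Qed.

End analysis_facts.

Section uniqueness.
Context {R : realType}.
Variables (n : nat) (la nu : R) (mu : nat -> R).
Hypotheses (la_gt0 : 0 < la) (nu_gt0 : 0 < nu) (mu_gt0 : forall k, 0 < mu k).
Hypothesis overload : 1 < la * \sum_(k < n.+1) (mu k)^-1.
Implicit Types (z y : nat -> R -> R) (x : nat -> R).

(** The difference of shares is the sum of two quotients by [mass n x1], whose
    numerators are a difference of contents and a share times a difference of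
    masses. *)
Lemma share_lipschitz x1 x2 c k : 0 < c ->
  (forall k, 0 <= x1 k) -> (forall k, 0 <= x2 k) ->
  c <= mass n x1 -> c <= mass n x2 -> (k <= n)%N ->
  `|share n x1 k - share n x2 k| <= 2 / c * \sum_(j < n.+1) `|x1 j - x2 j|.
Proof.
move=> c0 x10 x20 cx1 cx2 kn.
set D := \sum_(j < n.+1) _.
have D0 : 0 <= D by apply: sumr_ge0.
have M1 := lt_le_trans c0 cx1; have M2 := lt_le_trans c0 cx2.
have dk : `|x1 k - x2 k| <= D.
  rewrite /D (bigD1 (Ordinal (kn : (k < n.+1)%N)))//= lerDl.
  exact: sumr_ge0.
have dM : `|mass n x2 - mass n x1| <= D.
  rewrite distrC /mass -sumrB; exact: ler_norm_sum.
have -> : share n x1 k - share n x2 k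
    = (x1 k - x2 k) / mass n x1 + share n x2 k * ((mass n x2 - mass n x1) / mass n x1).
  by rewrite /share; field; rewrite !gt_eqF.
have iM : (mass n x1)^-1 <= c^-1 by rewrite lef_pV2.
have iM0 : 0 <= (mass n x1)^-1 by rewrite invr_ge0 ltW.
apply: le_trans (ler_normD _ _) _.
have quot a : `|a| <= D -> `|a / mass n x1| <= D / c.
  by move=> aD; rewrite normrM (ger0_norm iM0) ler_pM.
have -> : 2 / c * D = D / c + D / c by ring.
rewrite lerD ?quot//.
rewrite normrM (ger0_norm (share_ge0 n k x20)) -[leRHS]mul1r.
by rewrite ler_pM ?share_ge0 ?share_le1 ?quot.
Qed.

Lemma mass_continuous z : fluid_solution n la nu mu z -> continuous (fun t => mass n (z ^~ t)).
Proof.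
move=> [zc _ _ _] t; apply: (@cvg_bigsum _ _ _ _ n.+1 z (fun k => z k t)) => k kn.
by have [h _] := zc k kn; exact: h.
Qed.

Lemma mass_away_from_zero z : fluid_solution n la nu mu z -> 0 < mass n (z ^~ 0) ->
  exists2 c, 0 < c & forall t, 0 <= t -> c <= mass n (z ^~ t).
Proof.
move=> zs m0; have [_ _ zm _] := zs.
have m2 : 0 < mass n (z ^~ 0) / 2 by rewrite divr_gt0.
have : mass n (z ^~ t) @[t --> (0:R)] --> mass n (z ^~ 0) by exact: mass_continuous.
move=> /cvgrPdist_lt /(_ _ m2) /nbhs_ballP[d /= d0 hd].
have d2 : 0 < d / 2 by rewrite divr_gt0.
have [c c0 hc] := zm _ d2.
exists (Num.min c (mass n (z ^~ 0) / 2)); first by rewrite lt_min c0 m2.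
move=> t t0; have [td|td] := leP (d / 2) t.
  by rewrite ge_min hc.
rewrite ge_min; apply/orP; right.
have : ball 0 d t by rewrite /ball/= sub0r normrN ger0_norm//; lra.
move=> /hd/=; rewrite ltr_norml => /andP[_]; lra.
Qed.

(** Both solutions stay away from the origin, where the drift is Lipschitz, and
    the squared distance obeys Gronwall's inequality. *)
Lemma unique_from_nonzero z y : fluid_solution n la nu mu z -> fluid_solution n la nu mu y ->
  (forall k, (k <= n)%N -> z k 0 = y k 0) -> 0 < mass n (z ^~ 0) ->
  forall k t, (k <= n)%N -> 0 <= t -> z k t = y k t.
Proof.
move=> zs ys zy m0.
have [c1 c10 hc1] := mass_away_from_zero zs m0.
have m0' : 0 < mass n (y ^~ 0).
  apply: lt_le_trans m0 _; apply: ler_sum => k _.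
  by rewrite zy// -ltnS.
have [c2 c20 hc2] := mass_away_from_zero ys m0'.
pose c := Num.min c1 c2.
have c0 : 0 < c by rewrite lt_min c10.
have cz t : 0 <= t -> c <= mass n (z ^~ t) by move=> t0; rewrite ge_min hc1.
have cy t : 0 <= t -> c <= mass n (y ^~ t) by move=> t0; rewrite ge_min hc2// orbT.
have [zc z0 _ dz] := zs; have [yc y0 _ dy] := ys.
pose E t := \sum_(k < n.+1) (z k t - y k t) * (z k t - y k t).
pose dd t k := drift n la nu mu (z ^~ t) k - drift n la nu mu (y ^~ t) k.
pose dE t := \sum_(k < n.+1) (dd t k * (z k t - y k t) + (z k t - y k t) * dd t k).
pose S := \sum_(k < n.+1) mu k.
have muS k : (k <= n)%N -> mu k <= S.
  move=> kn; rewrite /S (bigD1 (Ordinal (kn : (k < n.+1)%N)))//= lerDl.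
  by apply: sumr_ge0 => i _; exact: ltW.
have S0 : 0 <= S by apply: sumr_ge0 => i _; exact: ltW.
pose D t := \sum_(j < n.+1) `|z j t - y j t|.
have D0 t : 0 <= D t by apply: sumr_ge0.
have shD t k : 0 <= t -> (k <= n)%N ->
    `|share n (z ^~ t) k - share n (y ^~ t) k| <= 2 / c * D t.
  by move=> t0 kn; apply: share_lipschitz => //; [exact: cz|exact: cy].
pose L := S * (2 / c) + S * (2 / c) + nu.
have ddL t k : 0 <= t -> (k <= n)%N -> `|dd t k| <= L * D t.
  move=> t0 kn.
  have -> : dd t k = inflow 0 (fun j => mu j * (share n (z ^~ t) j - share n (y ^~ t) j)) k
      - mu k * (share n (z ^~ t) k - share n (y ^~ t) k) - nu * (z k t - y k t).
    by rewrite /dd /drift; case: k {kn} => [|k] /=; ring.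
  have b j : (j <= n)%N -> `|mu j * (share n (z ^~ t) j - share n (y ^~ t) j)| <= S * (2 / c) * D t.
    move=> jn; rewrite normrM -mulrA ler_pM// ?shD//.
    by rewrite gtr0_norm ?muS.
  have b0 : `|inflow 0 (fun j => mu j * (share n (z ^~ t) j - share n (y ^~ t) j)) k| <= S * (2 / c) * D t.
    case: k kn => [|k] kn /=; last exact: b (ltnW kn).
    by rewrite normr0 !mulr_ge0// invr_ge0 ltW.
  have dk : `|nu * (z k t - y k t)| <= nu * D t.
    rewrite normrM gtr0_norm// ler_pM2l// /D (bigD1 (Ordinal (kn : (k < n.+1)%N)))//= lerDl.
    exact: sumr_ge0.
  rewrite /L 2!mulrDl.
  apply: le_trans (ler_normB _ _) _; apply: lerD => //.
  by apply: le_trans (ler_normB _ _) _; apply: lerD => //; exact: b.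
have E0 t : 0 <= E t by apply: sumr_ge0 => k _; rewrite -expr2 sqr_ge0.
have Ez t : 0 <= t -> E t = 0.
  move=> t0; apply: (@gronwall_zero R E dE (2 * L * n.+1%:R)) => //.
  - by rewrite /E big1// => k _; rewrite zy ?subrr ?mul0r// -ltnS.
  - move=> u _; apply: (@cvg_bigsum _ _ _ _ n.+1 (fun k u => (z k u - y k u) * (z k u - y k u)) (fun k => (z k u - y k u) * (z k u - y k u))) => k kn.
    have h : z k s - y k s @[s --> u] --> z k u - y k u.
      by apply: cvgB; [have [h _] := zc k kn; exact: h|have [h _] := yc k kn; exact: h].
    exact: cvgM.
  - move=> u /andP[u0 _].
    apply: (@is_derive_bigsum _ _ _ (fun k u => (z k u - y k u) * (z k u - y k u)) (fun k => (dd u k * (z k u - y k u) + (z k u - y k u) * dd u k))) => k kn.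
    have h : is_derive u 1 (fun s => z k s - y k s) (dd u k).
      by apply: is_derive_sub; [exact: dz|exact: dy].
    exact: is_derive_mul.
  - move=> u /andP[u0 _]; have {}u0 := ltW u0.
    have h1 : dE u <= 2 * (L * D u) * D u.
      rewrite /dE {2}/D mulr_sumr; apply: ler_sum => k _.
      rewrite (_ : _ + _ = 2 * (dd u k * (z k u - y k u))); last by ring.
      rewrite -[leRHS]mulrA ler_pM2l//.
      apply: le_trans (ler_norm _) _; rewrite normrM ler_wpM2r//.
      by apply: ddL => //; rewrite -ltnS.
    apply: le_trans h1 _.
    have h2 : D u ^+ 2 <= n.+1%:R * E u.
      apply: le_trans (sqr_sum_le n.+1 (fun j => `|z j u - y j u|)) _.
      rewrite ler_wpM2l//; apply: ler_sum => k _.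
      by rewrite -normrX ger0_norm ?sqr_ge0// expr2.
    have L0 : 0 <= 2 * L.
      have cc : 0 <= 2 / c by rewrite divr_ge0// ltW.
      apply: mulr_ge0 => //; apply: addr_ge0; last exact: ltW.
      by apply: addr_ge0; exact: mulr_ge0.
    have := ler_wpM2l L0 h2; rewrite expr2; lra.
move=> k t kn t0; have := Ez t t0.
rewrite /E => /eqP; rewrite psumr_eq0; last by move=> i _; rewrite -expr2 sqr_ge0.
move=> /allP /(_ (Ordinal (kn : (k < n.+1)%N))); rewrite mem_index_enum => /(_ isT)/=.
by rewrite mulf_eq0 orbb subr_eq0 => /eqP.
Qed.

End uniqueness.

(** * Uniqueness from the empty state *)

Section zero_start.
Context {R : realType}.
Variables (n : nat) (la nu : R) (mu : nat -> R).
Hypotheses (la_gt0 : 0 < la) (nu_gt0 : 0 < nu) (mu_gt0 : forall k, 0 < mu k).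
Hypothesis overload : 1 < la * \sum_(k < n.+1) (mu k)^-1.
Implicit Types (z y : nat -> R -> R) (x p : nat -> R).

Lemma sum_inflow_total a (F : nat -> R) :
  \sum_(k < n.+1) (inflow a F k - F k) = a - F n.
Proof.
pose c k : R := (k <= n)%:R.
rewrite (eq_bigr (fun k : 'I_n.+1 => c k * (inflow a F k - F k))); last first.
  by move=> k _; rewrite /c -ltnS ltn_ord mul1r.
rewrite sum_inflow; last by rewrite /c ltnn.
rewrite {1}/c leq0n mul1r big_ord_recr/= big1 ?add0r.
  by rewrite /c leqnn ltnn subr0 mul1r.
move=> i _; rewrite /c; have -> : (widen_ord (leqnSn n) i <= n)%N by rewrite /= ltnW.
by have -> : (i.+1 <= n)%N by []; rewrite subrr mul0r.
Qed.

(** Internal transfers cancel: customers enter at stage [0], leave after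
    stage [n] and abandon everywhere. *)
Lemma sum_drift x : \sum_(k < n.+1) drift n la nu mu x k
  = la - mu n * share n x n - nu * mass n x.
Proof.
by rewrite /drift sumrB -(sum_inflow_total la (fun j => mu j * share n x j)) /mass mulr_sumr.
Qed.

(** With time run at speed [1 / mass] and [expR (nu * t) * z] in place of [z], the
    fluid equations become linear.  This profile solves the equation for an
    eigenvector of that linear system with eigenvalue [rho], except that its
    total need not be [1]. *)
Fixpoint growth_profile (rho : R) k : R :=
  if k is j.+1 then growth_profile rho j * mu j / (rho + mu k) else la / (rho + mu 0%N).

Lemma growth_profile_gt0 rho k : 0 <= rho -> 0 < growth_profile rho k.
Proof.
move=> r0; elim: k => [|k IH] /=; first by rewrite divr_gt0// ltr_wpDl.
by rewrite divr_gt0 ?mulr_gt0// ltr_wpDl.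
Qed.

Lemma growth_profile_eq rho k : 0 <= rho ->
  (rho + mu k) * growth_profile rho k
    = inflow la (fun j => mu j * growth_profile rho j) k.
Proof.
move=> r0; have rm j : rho + mu j != 0 by rewrite gt_eqF// ltr_wpDl.
by case: k => [|k] /=; rewrite [LHS]mulrC divfK// mulrC.
Qed.

Lemma growth_profile_continuous (rho : R) k : 0 <= rho ->
  {for rho, continuous (growth_profile ^~ k)}.
Proof.
move=> r0; have hc j : (rho' + mu j)^-1 @[rho' --> rho] --> (rho + mu j)^-1.
  apply: cvgV; first by rewrite gt_eqF// ltr_wpDl.
  by apply: cvgD; [exact: cvg_id|exact: cvg_cst].
elim: k => [|k IH] /=; first by apply: cvgM; [exact: cvg_cst|exact: hc].
by apply: cvgM; [apply: cvgM; [exact: IH|exact: cvg_cst]|exact: hc].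
Qed.

(** The total mass of the profile is larger than [1] at [rho = 0], by overload,
    and at most [1] at [rho = la], because [rho] times this mass is the net
    inflow [la - mu n * growth_profile rho n]. *)
Lemma growth_rate : exists (rho : R) (v : nat -> R),
  [/\ 0 < rho, forall k, 0 < v k, \sum_(k < n.+1) v k = 1
    & forall k, (rho + mu k) * v k = inflow la (fun j => mu j * v j) k].
Proof.
pose f rho := \sum_(k < n.+1) growth_profile rho k.
have f0 : f 0 = la * \sum_(k < n.+1) (mu k)^-1.
  rewrite mulr_sumr; apply: eq_bigr => -[k _] _ /=.
  elim: k => [|k IH] /=; first by rewrite add0r.
  by rewrite IH add0r divfK// gt_eqF.
have f1 : f la <= 1.
  rewrite -(ler_pM2l la_gt0) mulr1.
  have -> : la * f la = la - mu n * growth_profile la n.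
    rewrite -(sum_inflow_total la (fun j => mu j * growth_profile la j)) mulr_sumr.
    apply: eq_bigr => k _; rewrite -growth_profile_eq; last exact: ltW.
    by ring.
  by rewrite gerBl mulr_ge0// ltW// growth_profile_gt0// ltW.
have fc : {within `[0, la], continuous f}.
  apply: continuous_withinT => rho; rewrite in_itv/= => /andP[r0 _].
  apply: (@cvg_bigsum _ _ _ _ n.+1 (fun k r => growth_profile r k) (growth_profile rho)) => k _.
  exact: growth_profile_continuous.
have [rho] : exists2 c, c \in `[0, la] & f c = 1.
  apply: IVT => //; first exact: ltW.
  by rewrite ge_min f1 orbT/= le_max f0 (ltW overload).
rewrite in_itv/= => /andP[r0 _] frho.
have rp : 0 < rho.
  rewrite lt_def r0 andbT; apply/eqP => rho0.
  by move: overload; rewrite -f0 -rho0 frho ltxx.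
exists rho, (growth_profile rho); split=> // k; first exact: growth_profile_gt0.
exact: growth_profile_eq.
Qed.

Section profile.
Variables (rho : R) (v : nat -> R).
Hypotheses (rho_gt0 : 0 < rho) (v_gt0 : forall k, 0 < v k).
Hypothesis v_sum : \sum_(k < n.+1) v k = 1.
Hypothesis v_eq : forall k, (rho + mu k) * v k = inflow la (fun j => mu j * v j) k.

Let av p := \sum_(k < n.+1) v k * p k.

(** In the ratios [p k = z k / v k] the linear dynamics is the generator of a
    Markov chain plus a multiple of the identity: from stage [k.+1] the chain
    jumps to [k], and from stage [0] to a stage drawn from [v].  The invariant
    measure is [weight]. *)
Definition jump p k : R := (rho + mu k) * (inflow (av p) p k - p k).

Let tail k : R := \sum_(k <= j < n.+1) v j.

Definition weight k : R := tail k / (rho + mu k).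

Let rate_gt0 k : 0 < rho + mu k. Proof. exact: addr_gt0. Qed.

Let tail0 : tail 0 = 1. Proof. by rewrite /tail big_mkord. Qed.

Let tailS k : (k < n.+1)%N -> tail k - tail k.+1 = v k.
Proof. by move=> kn; rewrite /tail big_ltn// addrK. Qed.

Let tail_last : tail n.+1 = 0. Proof. by rewrite /tail big_geq. Qed.

Let tail_gt0 k : (k < n.+1)%N -> 0 < tail k.
Proof.
move=> kn; rewrite /tail big_ltn// ltr_pwDl//.
by apply: sumr_ge0 => j _; exact: ltW.
Qed.

Let tail_ge0 k : 0 <= tail k.
Proof. by apply: sumr_ge0 => j _; exact: ltW. Qed.

Let weight_gt0 k : (k < n.+1)%N -> 0 < weight k.
Proof. by move=> kn; rewrite divr_gt0 ?tail_gt0. Qed.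

Let sum_tail a p : \sum_(k < n.+1) tail k * (inflow a p k - p k) = a - av p.
Proof.
rewrite sum_inflow// tail0 mul1r; congr (_ - _).
by apply: eq_bigr => k _; rewrite tailS.
Qed.

Let weight_jump p k : weight k * jump p k = tail k * (inflow (av p) p k - p k).
Proof. by rewrite /weight /jump; field; rewrite gt_eqF. Qed.

Lemma weight_invariant p : \sum_(k < n.+1) weight k * jump p k = 0.
Proof. by under eq_bigr do rewrite weight_jump; rewrite sum_tail subrr. Qed.

Lemma jump_shift p c k : jump (fun k => p k - c) k = jump p k.
Proof.
rewrite /jump; congr (_ * _).
have -> : av (fun k => p k - c) = av p - c.
  rewrite /av; under eq_bigr do rewrite mulrBr.
  by rewrite sumrB -mulr_suml v_sum mul1r.
by case: k => [|k] /=; ring.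
Qed.

(** At stages above [0] this is [2 a (b - a) <= b^2 - a^2], and the differences of
    squares sum to zero by invariance.  At stage [0] the variance of [p] under [v] about [p 0] is
    kept. *)
Lemma jump_dissipation p :
  2 * \sum_(k < n.+1) weight k * (p k * jump p k)
    <= - \sum_(k < n.+1) v k * (p k - p 0%N) ^+ 2.
Proof.
have -> : - \sum_(k < n.+1) v k * (p k - p 0%N) ^+ 2
    = \sum_(k < n.+1) tail k * (inflow (av (fun j => p j ^+ 2)) (fun j => p j ^+ 2) k - p k ^+ 2)
      - \sum_(k < n.+1) v k * (p k - p 0%N) ^+ 2.
  by rewrite (sum_tail _ (fun j => p j ^+ 2)) subrr sub0r.
have v2 : \sum_(k < n.+1) v k * (p k - p 0%N) ^+ 2
    = av (fun j => p j ^+ 2) - 2 * p 0%N * av p + p 0%N ^+ 2.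
  have -> : p 0%N ^+ 2 = \sum_(k < n.+1) v k * p 0%N ^+ 2 by rewrite -mulr_suml v_sum mul1r.
  rewrite /av mulr_sumr -sumrB -big_split/=.
  by apply: eq_bigr => k _; ring.
rewrite mulr_sumr.
under eq_bigr do rewrite [weight _ * _]mulrCA weight_jump.
rewrite !big_ord_recl/= tail0 !mul1r.
set a2 := av (fun j => p j ^+ 2).
have -> : v 0%N * (p 0%N - p 0%N) ^+ 2 = 0 by rewrite subrr expr2 !mulr0.
have v2' : \sum_(i < n) v i.+1 * (p i.+1 - p 0%N) ^+ 2 = a2 - 2 * p 0%N * av p + p 0%N ^+ 2.
  by rewrite -v2 big_ord_recl/= subrr expr2 !mulr0 add0r.
rewrite add0r v2'.
have : \sum_(i < n) 2 * (p i.+1 * (tail i.+1 * (p i - p i.+1)))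
    <= \sum_(i < n) tail i.+1 * (p i ^+ 2 - p i.+1 ^+ 2).
  apply: ler_sum => i _.
  rewrite (_ : 2 * _ = tail i.+1 * (2 * p i.+1 * (p i - p i.+1))); last by ring.
  by rewrite ler_wpM2l//; have := sqr_ge0 (p i - p i.+1); nra.
lra.
Qed.

(** The dissipation compares each [p k] with [p 0] directly, so the spectral
    gap inequality is immediate. *)
Lemma spectral_gap : exists2 g, 0 < g & forall p,
  \sum_(k < n.+1) weight k * p k = 0 ->
  g * (\sum_(k < n.+1) weight k * p k ^+ 2)
    <= - (2 * \sum_(k < n.+1) weight k * (p k * jump p k)).
Proof.
pose G := \sum_(k < n.+1) weight k / v k.
have Gk k : (k < n.+1)%N -> weight k / v k <= G.
  move=> kn; rewrite /G (bigD1 (Ordinal kn))//= lerDl; apply: sumr_ge0 => i _.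
  by rewrite divr_ge0// ltW// weight_gt0.
have G0 : 0 < G by apply: lt_le_trans (Gk 0%N _) => //; rewrite divr_gt0// weight_gt0.
exists G^-1 => [|p p0]; first by rewrite invr_gt0.
rewrite lerNr; apply: le_trans (jump_dissipation p) _; rewrite lerN2.
rewrite ler_pdivrMl//.
have h1 : \sum_(k < n.+1) weight k * (p k - p 0%N) ^+ 2 <= G * \sum_(k < n.+1) v k * (p k - p 0%N) ^+ 2.
  rewrite mulr_sumr; apply: ler_sum => k _; rewrite mulrA ler_wpM2r ?sqr_ge0//.
  by rewrite -ler_pdivrMr// Gk.
apply: le_trans h1.
have -> : \sum_(k < n.+1) weight k * (p k - p 0%N) ^+ 2
   = \sum_(k < n.+1) weight k * p k ^+ 2 + p 0%N ^+ 2 * \sum_(k < n.+1) weight k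
     - 2 * p 0%N * \sum_(k < n.+1) weight k * p k.
  rewrite !mulr_sumr -big_split/= -sumrB; apply: eq_bigr => k _; ring.
rewrite p0 mulr0 subr0 lerDl mulr_ge0 ?sqr_ge0//.
by apply: sumr_ge0 => k _; rewrite ltW// weight_gt0.
Qed.

Variable z : nat -> R -> R.
Hypothesis z_sol : fluid_solution n la nu mu z.
Hypothesis z_zero : forall k, (k <= n)%N -> z k 0 = 0.

Let Z t := mass n (z ^~ t).
Let P t k := z k t / v k.
Let s t := \sum_(k < n.+1) weight k * P t k.
Let p t k := P t k / s t.

Let z_ge0 k t : 0 <= z k t. Proof. by case: z_sol. Qed.

Let Z_gt0 (t : R) : 0 < t -> 0 < Z t.
Proof. by move=> t0; have [_ _ h _] := z_sol; have [c c0 /(_ t (lexx t))] := h t t0; exact: lt_le_trans. Qed.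

Let Z_av t : Z t = av (P t).
Proof. by apply: eq_bigr => k _; rewrite /P mulrC divfK// gt_eqF. Qed.

Let P_ge0 t k : 0 <= P t k.
Proof. by rewrite divr_ge0// ltW. Qed.

Let s_gt0 (t : R) : 0 < t -> 0 < s t.
Proof.
move=> t0; have s0 : 0 <= s t.
  by apply: sumr_ge0 => k _; rewrite mulr_ge0// ltW// weight_gt0.
rewrite lt_def s0 andbT; apply/eqP => st.
have : Z t = 0.
  rewrite /Z /mass big1// => k _; have kn := ltn_ord k.
  move/eqP: st; rewrite psumr_eq0; last first.
    by move=> i _; rewrite mulr_ge0// ltW// weight_gt0.
  move=> /allP /(_ k); rewrite mem_index_enum => /(_ isT)/=.
  rewrite mulf_eq0 (gt_eqF (weight_gt0 kn))/= /P mulf_eq0 invr_eq0 (gt_eqF (v_gt0 k)) orbF.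
  by move/eqP.
by move=> Z0; have := Z_gt0 t0; rewrite Z0 ltxx.
Qed.

Let dP (t : R) k : 0 < t -> (k <= n)%N ->
  is_derive t 1 (fun t => P t k) (jump (P t) k / Z t + (rho / Z t - nu) * P t k).
Proof.
move=> t0 kn; have [_ _ _ /(_ t k t0 kn) dz] := z_sol.
have Z0 : Z t != 0 by rewrite gt_eqF// Z_gt0.
have v0 : v k != 0 by rewrite gt_eqF.
have dz' := is_derive_scale (v k)^-1 dz.
rewrite (_ : (fun t => P t k) = (fun u => (v k)^-1 * z k u)); last first.
  by apply/funext => u; rewrite /P mulrC.
rewrite (_ : _ + _ = (v k)^-1 * drift n la nu mu (z^~ t) k)//.
rewrite /jump -Z_av /drift /share -/(Z t).
case: k kn v0 {dz dz'} => [|k] kn v0 /=.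
  have -> : la = (rho + mu 0%N) * v 0%N by rewrite v_eq.
  by rewrite /P; field; rewrite Z0.
have vk : v k != 0 by rewrite gt_eqF.
have -> : mu k * (z k t / Z t) = (rho + mu k.+1) * v k.+1 * (P t k / Z t).
  by rewrite v_eq /= /P; field; rewrite Z0.
by rewrite /P; field; rewrite vk Z0.
Qed.

Let ds (t : R) : 0 < t -> is_derive t 1 s ((rho / Z t - nu) * s t).
Proof.
move=> t0.
have -> : (rho / Z t - nu) * s t = \sum_(k < n.+1) weight k * (jump (P t) k / Z t + (rho / Z t - nu) * P t k).
  under [RHS]eq_bigr do rewrite mulrDr mulrA.
  rewrite big_split/= -mulr_suml weight_invariant mul0r add0r /s mulr_sumr.
  by apply: eq_bigr => k _; rewrite mulrCA.
apply: (@is_derive_bigsum _ _ _ (fun k t => weight k * P t k) (fun k => weight k * (jump (P t) k / Z t + (rho / Z t - nu) * P t k))) => k kn.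
exact: is_derive_scale (dP t0 _).
Qed.

Let jump_scale (q : nat -> R) c k : jump (fun j => q j * c) k = jump q k * c.
Proof.
rewrite /jump (_ : av (fun j => q j * c) = av q * c); last first.
  by rewrite /av mulr_suml; apply: eq_bigr => j _; rewrite mulrA.
by case: k => [|k] /=; ring.
Qed.

Let dp (t : R) k : 0 < t -> (k <= n)%N ->
  is_derive t 1 (fun t => p t k) (jump (p t) k / Z t).
Proof.
move=> t0 kn; have s0 : s t != 0 by rewrite gt_eqF// s_gt0.
have Z0 : Z t != 0 by rewrite gt_eqF// Z_gt0.
have := is_derive_mul (dP t0 kn) (is_derive_inv s0 (ds t0)).
rewrite (_ : jump (p t) k = jump (P t) k / s t); last exact: jump_scale.
by move=> h; apply: (is_derive_eq h); field; rewrite s0 Z0.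
Qed.

Let Pi := \sum_(k < n.+1) weight k.
Let Pi_gt0 : 0 < Pi.
Proof.
rewrite /Pi big_ord_recl/= ltr_pwDl ?weight_gt0//.
by apply: sumr_ge0 => i _; rewrite ltW// weight_gt0// ltnS.
Qed.

Let r t k := p t k - Pi^-1.

Let sum_p (t : R) : 0 < t -> \sum_(k < n.+1) weight k * p t k = 1.
Proof.
move=> t0; under eq_bigr do rewrite /p mulrA.
by rewrite -mulr_suml divff// gt_eqF// s_gt0.
Qed.

Let sum_r (t : R) : 0 < t -> \sum_(k < n.+1) weight k * r t k = 0.
Proof.
move=> t0; under eq_bigr do rewrite mulrBr.
by rewrite sumrB sum_p// -mulr_suml divff ?subrr// gt_eqF.
Qed.

Let V t := \sum_(k < n.+1) weight k * (r t k * r t k).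
Let dV t := \sum_(k < n.+1) weight k *
  (jump (p t) k / Z t * r t k + r t k * (jump (p t) k / Z t)).

Let V_derive (t : R) : 0 < t -> is_derive t 1 V (dV t).
Proof.
move=> t0; apply: (@is_derive_bigsum _ _ _ (fun k t => weight k * (r t k * r t k)) (fun k => weight k * (jump (p t) k / Z t * r t k + r t k * (jump (p t) k / Z t)))) => k kn.
have h : is_derive t 1 (fun u => r u k) (jump (p t) k / Z t).
  rewrite -[X in is_derive _ _ _ X]subr0; apply: is_derive_sub; first exact: dp.
apply: is_derive_scale; exact: is_derive_mul.
Qed.

Let V_bound (t : R) : 0 < t -> 0 <= V t <= \sum_(k < n.+1) weight k * ((weight k)^-1 + Pi^-1) ^+ 2.
Proof.
move=> t0; apply/andP; split.
  by apply: sumr_ge0 => k _; rewrite mulr_ge0 -?expr2 ?sqr_ge0// ltW// weight_gt0.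
apply: ler_sum => k _; have wk := weight_gt0 (ltn_ord k).
rewrite ler_pM2l// -expr2.
have p0 j : 0 <= p t j by rewrite divr_ge0// ltW// s_gt0.
have pk : p t k <= (weight k)^-1.
  rewrite -(ler_pM2l wk) divff ?gt_eqF// -(sum_p t0).
  rewrite [leRHS](bigD1 k)//= lerDl; apply: sumr_ge0 => i _.
  by rewrite mulr_ge0// ltW// weight_gt0.
have ip : 0 < Pi^-1 by rewrite invr_gt0.
have pk0 := p0 k.
rewrite /r; nra.
Qed.

Let Z_le (t : R) : 0 < t -> Z t <= la * t.
Proof.
move=> t0; have [zc _ _ dz] := z_sol.
pose h u := Z u - la * u.
have : h t <= h 0.
  apply: (@derivative_le0 R (fun u => \sum_(k < n.+1) drift n la nu mu (z ^~ u) k - la * 1)) => //.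
  - exact: ltW.
  - move=> u /andP[u0 _].
    have hl : is_derive u 1 (fun w => la * w) (la * 1).
      by apply: is_derive_scale; exact: is_derive_id.
    apply: is_derive_sub hl.
    apply: (@is_derive_bigsum _ _ _ z (fun k => drift n la nu mu (z ^~ u) k)) => k kn.
    exact: dz.
  - move=> u _; apply: cvgB; first exact: (mass_continuous z_sol).
    by apply: cvgM; [exact: cvg_cst|exact: cvg_id].
  - move=> u /andP[u0 _]; rewrite sum_drift mulr1.
    have := mulr_ge0 (ltW (mu_gt0 n)) (share_ge0 n n (z_ge0 ^~ u)).
    have := mulr_ge0 (ltW nu_gt0) (ltW (Z_gt0 u0)); rewrite /Z; lra.
rewrite /h /Z /mass [X in _ <= X - _]big1 ?mulr0 ?subr0; first by rewrite subr_le0.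
by move=> k _; rewrite z_zero// -ltnS.
Qed.

(** Divide the ratios [P] by their weighted sum [s], which removes the growth.
    The weighted variance [V] of the result is bounded, because the normalised
    ratios are nonnegative, and [V' <= - g * V / Z] by the spectral gap.  As
    [Z t <= la * t], the integral of [1 / Z] diverges at [0] and [V] vanishes. *)
Lemma profile_of_zero_start (t : R) k : 0 < t -> (k <= n)%N -> z k t = v k * Z t.
Proof.
move=> t0 kn; have [g g0 gap] := spectral_gap.
have V0 : V t = 0.
  apply: (log_decay_zero (g := g / la) _ V_derive V_bound _ t0); first by rewrite divr_gt0.
  move=> u u0; have Zu := Z_gt0 u0.
  have VE : V u = \sum_(k < n.+1) weight k * r u k ^+ 2 by [].
  have -> : dV u = (2 * \sum_(k < n.+1) weight k * (r u k * jump (r u) k)) / Z u.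
    rewrite /dV mulr_sumr mulr_suml; apply: eq_bigr => j _.
    by rewrite jump_shift; field; rewrite gt_eqF.
  rewrite mulNr -lerNr -mulNr.
  have h := gap (r u) (sum_r u0); rewrite -VE in h.
  have V0 : 0 <= V u by have /andP[] := V_bound u0.
  apply: (@le_trans _ _ (g * V u / Z u)); last by rewrite ler_pM2r ?invr_gt0.
  rewrite -mulrA (mulrAC _ _ (V u)) -[leLHS]mulrA -[leLHS]mulrA.
  rewrite ler_pM2l// mulrCA ler_wpM2l//.
  by rewrite -invfM lef_pV2 ?posrE ?mulr_gt0// Z_le.
have rk j : (j < n.+1)%N -> P t j = s t / Pi.
  move=> jn; move/eqP: V0; rewrite psumr_eq0; last first.
    by move=> i _; rewrite mulr_ge0 -?expr2 ?sqr_ge0// ltW// weight_gt0.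
  move=> /allP /(_ (Ordinal jn)); rewrite mem_index_enum => /(_ isT)/=.
  rewrite mulf_eq0 (gt_eqF (weight_gt0 jn))/= mulf_eq0 orbb subr_eq0 => /eqP <-.
  by rewrite /p mulrC divfK// gt_eqF// s_gt0.
have -> : Z t = s t / Pi.
  rewrite Z_av /av (eq_bigr (fun k : 'I_n.+1 => v k * (s t / Pi))).
    by rewrite -mulr_suml v_sum mul1r.
  by move=> i _; rewrite rk.
by rewrite -(rk k)// /P mulrC divfK// gt_eqF.
Qed.

End profile.

(** Both solutions have the composition [v], so their masses solve the same
    linear equation with constant coefficients. *)
Lemma unique_from_zero z y : fluid_solution n la nu mu z -> fluid_solution n la nu mu y ->
  (forall k, (k <= n)%N -> z k 0 = 0) -> (forall k, (k <= n)%N -> y k 0 = 0) ->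
  forall k t, (k <= n)%N -> 0 <= t -> z k t = y k t.
Proof.
move=> zs ys z0 y0 k t kn; rewrite le_eqVlt => /predU1P[<-|t0].
  by rewrite z0// y0.
have [rho [v [r0 v0 vs ve]]] := growth_rate.
pose D u := mass n (z ^~ u) - mass n (y ^~ u).
pose dD u := \sum_(k < n.+1) drift n la nu mu (z ^~ u) k - \sum_(k < n.+1) drift n la nu mu (y ^~ u) k.
have mass0 (x : nat -> R -> R) : (forall k, (k <= n)%N -> x k 0 = 0) -> mass n (x ^~ 0) = 0 :> R.
  by move=> x0; rewrite /mass big1// => i _; rewrite x0// -ltnS.
have D0 : D t * D t = 0.
  apply: (@gronwall_zero R (fun u => D u * D u) (fun u => dD u * D u + D u * dD u) 0) => //.
  - exact: ltW.
  - by rewrite /D !mass0// subrr mul0r.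
  - by move=> u _; rewrite -expr2 sqr_ge0.
  - move=> u _; have h : D w @[w --> u] --> D u.
      by apply: cvgB; [exact: (mass_continuous zs)|exact: (mass_continuous ys)].
    exact: cvgM.
  - move=> u /andP[u0 _].
    have h : is_derive u 1 D (dD u).
      apply: is_derive_sub.
        apply: (@is_derive_bigsum _ _ _ z (fun k => drift n la nu mu (z ^~ u) k)) => j jn.
        by have [_ _ _] := zs; exact.
      apply: (@is_derive_bigsum _ _ _ y (fun k => drift n la nu mu (y ^~ u) k)) => j jn.
      by have [_ _ _] := ys; exact.
    exact: is_derive_mul.
  - move=> u /andP[u0 _].
    have sh (x : nat -> R -> R) : fluid_solution n la nu mu x -> (forall k, (k <= n)%N -> x k 0 = 0) ->
        share n (x ^~ u) n = v n.
      move=> xs x0; rewrite /share (profile_of_zero_start r0 v0 vs ve xs x0)//.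
      rewrite mulfK// gt_eqF//; have [_ _ h _] := xs.
      by have [c c0 /(_ u (lexx u))] := h u u0; exact: lt_le_trans.
    rewrite /dD !sum_drift !sh//.
    rewrite (_ : _ + _ = - (2 * nu * D u ^+ 2)); last by rewrite /D; ring.
    by rewrite mul0r oppr_le0; apply: mulr_ge0; [rewrite mulr_ge0// ltW|exact: sqr_ge0].
rewrite (profile_of_zero_start r0 v0 vs ve zs z0)// (profile_of_zero_start r0 v0 vs ve ys y0)//.
by move/eqP: D0; rewrite mulf_eq0 orbb subr_eq0 => /eqP ->.
Qed.

Theorem fluid_solution_unique z y : fluid_solution n la nu mu z -> fluid_solution n la nu mu y ->
  (forall k, (k <= n)%N -> z k 0 = y k 0) ->
  forall k t, (k <= n)%N -> 0 <= t -> z k t = y k t.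
Proof.
move=> zs ys zy; have [_ z0 _ _] := zs.
have := mass_ge0 n (z0 ^~ 0); rewrite le_eqVlt => /predU1P[m0|m0].
  have zz k : (k <= n)%N -> z k 0 = 0.
    move=> kn; apply/eqP; rewrite eq_le z0 andbT [leRHS]m0.
    by apply: (mass_ge (x := z ^~ 0)) => // j; exact: z0.
  by apply: unique_from_zero => // k kn; rewrite -zy// zz.
by move=> k t; exact: (unique_from_nonzero nu_gt0 mu_gt0 zs ys zy m0).
Qed.

End zero_start.

(** * Step functions and their integrals *)

Section step_functions.
Context {R : realType}.
Implicit Types (f g : nat -> R) (h : R).

Definition step_fun f h t : R := f (Num.truncn (t / h)).

(** The integral of [step_fun f h] over [[0, t]]. *)
Definition step_int f h t : R := let m := Num.truncn (t / h) in
  h * \sum_(0 <= k < m) f k + (t - h * m%:R) * f m.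

Lemma step_int0 f h : step_int f h 0 = 0.
Proof. by rewrite /step_int mul0r truncn0 big_geq// !mulr0 subrr mul0r addr0. Qed.

Lemma step_int_cst c h t : step_int (fun=> c) h t = c * t.
Proof.
by rewrite /step_int sumr_const_nat subn0 -mulr_natl; ring.
Qed.

Lemma step_int_scale c f h t : step_int (fun m => c * f m) h t = c * step_int f h t.
Proof. by rewrite /step_int -mulr_sumr; ring. Qed.

Lemma step_int_sub f g h t :
  step_int (fun m => f m - g m) h t = step_int f h t - step_int g h t.
Proof. by rewrite /step_int sumrB; ring. Qed.

Lemma step_int_sum n (f : nat -> nat -> R) h t :
  step_int (fun m => \sum_(k < n) f k m) h t = \sum_(k < n) step_int (f k) h t.
Proof.
rewrite /step_int big_split/= -mulr_sumr; congr (_ * _ + _).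
  by rewrite exchange_big.
by rewrite -mulr_sumr.
Qed.

Lemma step_int_upper f h s t M : 0 < h -> 0 <= s -> s <= t ->
  (forall u, s <= u <= t -> step_fun f h u <= M) ->
  step_int f h t - step_int f h s <= M * (t - s).
Proof.
move=> h0 s0 st fM; rewrite /step_int.
have sh : 0 <= s / h by rewrite divr_ge0// ltW.
have th : 0 <= t / h by rewrite divr_ge0 ?(le_trans s0 st)// ltW.
set a := Num.truncn (s / h); set b := Num.truncn (t / h).
have ab : (a <= b)%N by apply: le_truncn; rewrite ler_pM2r ?invr_gt0.
have fa : f a <= M by apply: (fM s); rewrite lexx.
have fb : f b <= M by apply: (fM t); rewrite st lexx.
have /andP[a1 a2] := truncn_itv sh; have /andP[b1 b2] := truncn_itv th.
rewrite -/a -/b in a1 a2 b1 b2.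
move: a1 a2 b1; rewrite ler_pdivlMr// ltr_pdivrMr// ler_pdivlMr// => a1 a2 b1 {b2}.
move: ab; rewrite leq_eqVlt => /predU1P[<-|ab].
  have -> : h * \sum_(0 <= k < a) f k + (t - h * a%:R) * f a
      - (h * \sum_(0 <= k < a) f k + (s - h * a%:R) * f a) = f a * (t - s) by ring.
  by rewrite ler_wpM2r// subr_ge0.
have -> : \sum_(0 <= k < b) f k = \sum_(0 <= k < a) f k + f a + \sum_(a.+1 <= k < b) f k.
  by rewrite (big_cat_nat (n := a.+1))//= big_nat_recr.
have mid : \sum_(a.+1 <= k < b) f k <= M * (b%:R - a%:R - 1).
  have -> : M * (b%:R - a%:R - 1) = \sum_(a.+1 <= k < b) M.
    by rewrite sumr_const_nat -[RHS]mulr_natr natrB// -natr1; ring.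
  rewrite big_seq [leRHS]big_seq; apply: ler_sum => k; rewrite mem_index_iota => /andP[ak kb].
  have := fM (k%:R * h); rewrite /step_fun mulfK ?gt_eqF// natrK; apply.
  apply/andP; split; last by apply: le_trans b1; rewrite ler_pM2r// ler_nat ltnW.
  by apply: le_trans (ltW a2) _; rewrite ler_pM2r// ler_nat.
have mid' := ler_wpM2l (ltW h0) mid.
have e1 : 0 <= a.+1%:R * h - s by rewrite subr_ge0 ltW.
have e2 : 0 <= t - b%:R * h by rewrite subr_ge0.
have k1 := ler_wpM2l e1 fa; have k2 := ler_wpM2l e2 fb.
move: k1 k2 mid'; rewrite -natr1; nra.
Qed.

Lemma step_int_primitive f h : 0 < h -> mean_value_primitive (step_fun f h) (step_int f h).
Proof.
move=> h0 s t m M s0 st fmM; apply/andP; split; last first.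
  by apply: step_int_upper => // u /fmM/andP[].
have : - 1 * step_int f h t - - 1 * step_int f h s <= - m * (t - s).
  rewrite -!step_int_scale; apply: step_int_upper => // u /fmM/andP[+ _].
  by rewrite /step_fun mulN1r lerN2.
lra.
Qed.

Lemma step_int_ge0 f h t : 0 < h -> 0 <= t -> (forall m, 0 <= f m) -> 0 <= step_int f h t.
Proof.
move=> h0 t0 f0; rewrite /step_int addr_ge0//.
  by apply: mulr_ge0; [exact: ltW|exact: sumr_ge0].
apply: mulr_ge0 => //.
rewrite subr_ge0 mulrC -ler_pdivlMr//.
by have /andP[] := truncn_itv (divr_ge0 t0 (ltW h0)).
Qed.

End step_functions.

(** * Existence and the fluid limit *)

Section existence.
Context {R : realType}.
Variables (n : nat) (la nu : R) (mu : nat -> R).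
Hypotheses (la_gt0 : 0 < la) (nu_gt0 : 0 < nu) (mu_gt0 : forall k, 0 < mu k).
Hypothesis overload : 1 < la * \sum_(k < n.+1) (mu k)^-1.

Section euler.
Variables (x : nat -> R) (h : R).

Fixpoint euler (m : nat) : nat -> R :=
  if m is m'.+1 then
    fun k => if (k <= n)%N then euler m' k + h * drift n la nu mu (euler m') k else 0
  else x.

Variable c : R.
Hypotheses (x_ge0 : forall k, 0 <= x k) (c_gt0 : 0 < c).
Hypotheses (c_start : c <= workload n mu x) (c_surplus : c <= surplus n la mu / nu).
Hypotheses (h_gt0 : 0 < h)
  (h_small : h * (\sum_(k < n.+1) mu k * (work n mu 0 / c) + nu) <= 1).

Let W0 : 0 < work n mu 0. Proof. exact: work0_gt0 overload. Qed.

(** A step removes from stage [k] the fraction [h * (mu k / mass + nu)] of its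
    content, which is at most [1] while the workload is at least [c]; and the
    workload, which moves towards [surplus / nu], does not fall below [c]. *)
Lemma euler_invariant m : (forall k, 0 <= euler m k) /\ c <= workload n mu (euler m).
Proof.
elim: m => [|m [IH0 IHc]] //=.
have M0 : 0 < mass n (euler m).
  rewrite -(pmulr_rgt0 _ W0); apply: lt_le_trans (workload_le n mu_gt0 IH0).
  exact: lt_le_trans IHc.
have share0 k := share_ge0 n k IH0.
split=> [k|].
  case: ifPn => // kn.
  have -> : euler m k + h * drift n la nu mu (euler m) k
      = euler m k * (1 - h * (mu k / mass n (euler m) + nu))
        + h * inflow la (fun j => mu j * share n (euler m) j) k.
    by rewrite /drift {2}/share; field; rewrite gt_eqF.
  have hk : 0 <= 1 - h * (mu k / mass n (euler m) + nu).
    rewrite subr_ge0; apply: le_trans h_small; rewrite ler_pM2l// lerD2r.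
    have mk : mu k / mass n (euler m) <= mu k * (work n mu 0 / c).
      rewrite ler_pM2l// ler_pdivlMr// ler_pdivrMl//.
      by rewrite mulrC; exact: le_trans (workload_le n mu_gt0 IH0).
    apply: le_trans mk _; rewrite (bigD1 (Ordinal (kn : (k < n.+1)%N)))//= lerDl.
    by apply: sumr_ge0 => i _; apply: mulr_ge0; [exact: ltW|rewrite divr_ge0// ltW].
  apply: addr_ge0; first exact: mulr_ge0.
  apply: mulr_ge0; first exact: ltW.
  case: k {kn hk} => [|k] /=; first exact: ltW.
  by apply: mulr_ge0; first exact: ltW.
have -> : workload n mu (fun k => if (k <= n)%N then euler m k + h * drift n la nu mu (euler m) k else 0)
    = workload n mu (euler m) + h * (surplus n la mu - nu * workload n mu (euler m)).
  rewrite -(workload_drift la nu mu_gt0) ?gt_eqF// mulr_sumr -big_split/=.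
  apply: eq_bigr => k _; rewrite -ltnS ltn_ord; ring.
have hnu : h * nu <= 1.
  apply: le_trans h_small; rewrite ler_pM2l// lerDr.
  by apply: sumr_ge0 => i _; apply: mulr_ge0; [exact: ltW|rewrite divr_ge0// ltW].
have cs : c * nu <= surplus n la mu by rewrite -ler_pdivlMr.
have h1 : 0 <= (1 - h * nu) * (workload n mu (euler m) - c).
  by rewrite mulr_ge0// subr_ge0.
have h2 : 0 <= h * (surplus n la mu - c * nu) by rewrite mulr_ge0 ?subr_ge0// ltW.
lra.
Qed.

Lemma euler_ge0 m k : 0 <= euler m k. Proof. by have [] := euler_invariant m. Qed.

Lemma euler_mass_gt0 m : 0 < mass n (euler m).
Proof.
have [IH0 IHc] := euler_invariant m.
rewrite -(pmulr_rgt0 _ W0); apply: lt_le_trans (workload_le n mu_gt0 IH0).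
exact: lt_le_trans IHc.
Qed.

Lemma euler_mass m : mass n (euler m) <= mass n x + la * (h * m%:R).
Proof.
elim: m => [|m IH]; first by rewrite !mulr0 addr0.
have -> : mass n (euler m.+1) = mass n (euler m) + h * \sum_(k < n.+1) drift n la nu mu (euler m) k.
  by rewrite mulr_sumr -big_split; apply: eq_bigr => k _ /=; rewrite -ltnS ltn_ord.
have : \sum_(k < n.+1) drift n la nu mu (euler m) k <= la.
  rewrite sum_drift.
  have := mulr_ge0 (ltW (mu_gt0 n)) (share_ge0 n n (euler_ge0 m)).
  have := mulr_ge0 (ltW nu_gt0) (ltW (euler_mass_gt0 m)); lra.
by move=> /(ler_wpM2l (ltW h_gt0)); rewrite -natr1; lra.
Qed.

Let q k := step_fun (fun m => euler m k) h.
Let J k := step_int (fun m => share n (euler m) k) h.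
Let K k := step_int (fun m => euler m k) h.

Lemma euler_clocks : clocks n q J K.
Proof.
split.
- by move=> k t _; exact: euler_ge0.
- move=> k kn; split; [exact: step_int0|exact: step_int0|].
  by move=> t t0; apply: step_int_ge0 => // m; exact: euler_ge0.
- by move=> k kn; exact: (@step_int_primitive _ (fun m => share n (euler m) k) h h_gt0).
- by move=> k kn; exact: (@step_int_primitive _ (fun m => euler m k) h h_gt0).
- move=> s t s0 st; rewrite sumrB.
  rewrite -!(step_int_sum n.+1 (fun k m => share n (euler m) k)) -[t - s]mul1r.
  apply: step_int_upper => // u _; rewrite /step_fun sum_share// gt_eqF//.
  exact: euler_mass_gt0.
Qed.

(** The scheme is exact at multiples of [h], and the drift is bounded in
    between. *)
Lemma euler_residual k t : (k <= n)%N -> 0 <= t ->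
  `|residual la nu mu q J K k t|
    <= h * (inflow la mu k + mu k + nu * (mass n x + la * t)).
Proof.
move=> kn t0; set m := Num.truncn (t / h).
have drift_int : inflow (la * t) (fun j => mu j * J j t) k - mu k * J k t - nu * K k t
    = step_int (fun m => drift n la nu mu (euler m) k) h t.
  rewrite /drift !step_int_sub !step_int_scale; congr (_ - _ - _).
  by case: k {kn} => [|k] /=; rewrite ?step_int_cst// step_int_scale.
have tel j : euler j k = x k + h * \sum_(0 <= i < j) drift n la nu mu (euler i) k.
  elim: j => [|j IH]; first by rewrite big_geq// mulr0 addr0.
  by rewrite /= kn big_nat_recr//= {1}IH; ring.
have -> : residual la nu mu q J K k t = - ((t - h * m%:R) * drift n la nu mu (euler m) k).
  rewrite /residual.
  have -> : q k 0 = x k by rewrite /q /step_fun mul0r truncn0.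
  have -> : x k + inflow (la * t) (fun j => mu j * J j t) k - mu k * J k t - nu * K k t
     = x k + step_int (fun m => drift n la nu mu (euler m) k) h t.
    by rewrite -drift_int; ring.
  by rewrite /step_int -/m /q /step_fun -/m tel; ring.
have /andP[m1 m2] := truncn_itv (divr_ge0 t0 (ltW h_gt0)).
rewrite -/m in m1 m2.
move: m1 m2; rewrite ler_pdivlMr// ltr_pdivrMr// -natr1 => m1 m2.
have a0 : 0 <= t - h * m%:R by rewrite subr_ge0 mulrC.
rewrite normrN normrM (ger0_norm a0) ler_pM//; first by lra.
have e0 := euler_ge0 m.
have ek : euler m k <= mass n x + la * t.
  apply: le_trans (mass_ge e0 kn) _; apply: le_trans (euler_mass m) _.
  by rewrite lerD2l ler_pM2l// mulrC.
have s0 := share_ge0 n k e0; have s1 := share_le1 e0 kn.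
have i0 : 0 <= inflow la (fun j => mu j * share n (euler m) j) k <= inflow la mu k.
  case: k kn {drift_int tel ek s0 s1} => [|k] kn /=; first by rewrite lexx ltW.
  have s0 := share_ge0 n k e0; have s1 := share_le1 e0 (ltnW kn).
  by rewrite mulr_ge0//= ?ler_piMr// ltW.
move: i0 => /andP[i0 i1].
have k1 := ler_wpM2l (ltW (mu_gt0 k)) s1.
have k2 := ler_wpM2l (ltW nu_gt0) ek.
have k3 := mulr_ge0 (ltW (mu_gt0 k)) s0.
have k4 := mulr_ge0 (ltW nu_gt0) (e0 k).
have i2 := le_trans i0 i1.
have m3 := ltW (mu_gt0 k).
rewrite /drift ler_norml; apply/andP; split; lra.
Qed.

End euler.

Lemma exists_from_nonzero (x : nat -> R) : (forall k, 0 <= x k) -> 0 < mass n x ->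
  exists z J K, [/\ fluid_solution n la nu mu z, clocks n z J K,
    forall k t, (k <= n)%N -> 0 <= t -> residual la nu mu z J K k t = 0
  & forall k, (k <= n)%N -> z k 0 = x k].
Proof.
move=> x0 m0.
pose c := Num.min (workload n mu x) (surplus n la mu / nu).
have c0 : 0 < c.
  by rewrite lt_min workload_gt0// divr_gt0// (surplus_gt0 overload).
pose B := \sum_(k < n.+1) mu k * (work n mu 0 / c) + nu.
have B0 : 0 < B.
  apply: ltr_wpDl => //; apply: sumr_ge0 => i _.
  by apply: mulr_ge0; [exact: ltW|apply: divr_ge0; [exact: work_ge0|exact: ltW]].
(* [B^-1] is the largest step to which [euler_invariant] applies. *)
pose h (i : nat) := B^-1 / i.+1%:R.
have h0 i : 0 < h i by rewrite divr_gt0 ?invr_gt0.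
have hB i : h i * B <= 1.
  by rewrite /h mulrAC mulVf ?gt_eqF// mul1r invf_le1// ler1n.
have [U [UU sU]] := ultraFilterLemma (F := \oo) _.
have cw : c <= workload n mu x by rewrite ge_min lexx.
have cs : c <= surplus n la mu / nu by rewrite ge_min lexx orbT.
have [||z [J [K [zs zc zr z0 _]]]] := @ultra_fluid_limit R n la nu mu la_gt0 nu_gt0 mu_gt0 overload _ U UU
  (fun i k => step_fun (fun m => euler x (h i) m k) (h i))
  (fun i k => step_int (fun m => share n (euler x (h i) m) k) (h i))
  (fun i k => step_int (fun m => euler x (h i) m k) (h i)) x
  (fun i => euler_clocks x0 c0 cw cs (h0 i) (hB i)).
- move=> k N e kn e0; apply: sU.
  pose C := inflow la mu k + mu k + nu * (mass n x + la * `|N|).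
  have in0 : 0 <= inflow la mu k by case: (k) => [|j]; [exact: ltW|exact: ltW (mu_gt0 j)].
  have C0 : 0 < C.
    apply: ltr_pwDl; first by rewrite ltr_wpDl.
    apply: mulr_ge0; first exact: ltW.
    by apply: addr_ge0; [exact: ltW|rewrite mulr_ge0// ltW].
  have d0 : 0 < e / C * B by rewrite mulr_gt0// divr_gt0.
  near=> i => t /andP[t0 tN].
  apply: le_trans (euler_residual x0 c0 cw cs (h0 i) (hB i) kn t0) _.
  have hi : h i * C <= e.
    rewrite -ler_pdivlMr// /h ler_pdivrMl// [leRHS]mulrC.
    by apply: ltW; near: i; exact: near_infty_natSinv_lt (PosNum d0).
  apply: le_trans hi; rewrite ler_pM2l// lerD2l ler_pM2l// lerD2l ler_pM2l//.
  by rewrite (le_trans tN)// ler_norm.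
- move=> k kn; rewrite (_ : (fun i => _) = fun=> x k); first exact: cvg_cst.
  by apply/funext => i; rewrite /step_fun mul0r truncn0.
- by exists z, J, K.
Unshelve. all: by end_near. Qed.

(** The solutions issued from [(1 / i.+1, ..., 1 / i.+1)] are themselves
    approximate solutions issued from the empty state. *)
Lemma exists_from_zero :
  exists z J K, [/\ fluid_solution n la nu mu z, clocks n z J K,
    forall k t, (k <= n)%N -> 0 <= t -> residual la nu mu z J K k t = 0
  & forall k, (k <= n)%N -> z k 0 = 0].
Proof.
have /choice[z] : forall i : nat, exists z, exists J K, [/\ fluid_solution n la nu mu z, clocks n z J K,
    forall k t, (k <= n)%N -> 0 <= t -> residual la nu mu z J K k t = 0
  & forall k, (k <= n)%N -> z k 0 = i.+1%:R^-1].
  move=> i; apply: (exists_from_nonzero (x := fun=> i.+1%:R^-1)) => [k|].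
    by rewrite invr_ge0.
  by rewrite /mass sumr_const card_ord pmulrn_lgt0// invr_gt0.
move=> /choice[J] /choice[K] H.
have [U [UU sU]] := ultraFilterLemma (F := \oo) _.
have [|||z' [J' [K' [zs zc zr z0 _]]]] := @ultra_fluid_limit R n la nu mu la_gt0 nu_gt0 mu_gt0 overload _ U UU
  z J K (fun=> 0).
- by move=> i; have [] := H i.
- move=> k N e kn e0; apply: filterE => i t /andP[t0 _]; have [_ _ -> //] := H i.
  by rewrite normr0 ltW.
- move=> k kn; have h : z i k 0 @[i --> \oo] --> (0 : R).
    rewrite (_ : (fun i => _) = fun i => i.+1%:R^-1); last first.
      by apply/funext => i; have [_ _ _ ->] := H i.
    exact: cvg_harmonic.
  exact: cvg_trans (cvg_app _ sU) h.
- by exists z', J', K'.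
Qed.

Theorem fluid_solution_exists (x : nat -> R) : (forall k, 0 <= x k) ->
  exists z J K, [/\ fluid_solution n la nu mu z, clocks n z J K,
    forall k t, (k <= n)%N -> 0 <= t -> residual la nu mu z J K k t = 0
  & forall k, (k <= n)%N -> z k 0 = x k].
Proof.
move=> x0; have := mass_ge0 n x0; rewrite le_eqVlt => /predU1P[m0|]; last exact: exists_from_nonzero.
have xz k : (k <= n)%N -> x k = 0.
  by move=> kn; apply/eqP; rewrite eq_le x0 andbT [leRHS]m0; exact: mass_ge.
have [z [J [K [zs zc zr z0]]]] := exists_from_zero.
by exists z, J, K; split=> // k kn; rewrite z0// xz.
Qed.

(** Every ultrafilter above [F] has a limit that is a fluid model solution
    issued from [x], and there is only one. *)
Theorem fluid_limit (X : Type) (F : set_system X) {FF : ProperFilter F}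
    (q J K : X -> nat -> R -> R) (x : nat -> R) (z : nat -> R -> R) :
  (forall i, clocks n (q i) (J i) (K i)) ->
  (forall k N e, (k <= n)%N -> 0 < e -> \forall i \near F, forall t, 0 <= t <= N ->
    `|residual la nu mu (q i) (J i) (K i) k t| <= e) ->
  (forall k, (k <= n)%N -> q i k 0 @[i --> F] --> x k) ->
  fluid_solution n la nu mu z -> (forall k, (k <= n)%N -> z k 0 = x k) ->
  forall N e, 0 < e -> \forall i \near F, forall k t, (k <= n)%N -> 0 <= t <= N ->
    `|q i k t - z k t| < e.
Proof.
move=> qc qr q0 zs z0 N e e0; apply: ultra_near => U UU sU.
have [||z' [J' [K' [zs' _ _ z0' H]]]] := @ultra_fluid_limit R n la nu mu la_gt0 nu_gt0 mu_gt0 overload _ U UU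
  q J K x qc.
- by move=> k M e' kn e'0; apply: sU; exact: qr.
- by move=> k kn; exact: cvg_trans (cvg_app _ sU) (q0 k kn).
- have : \forall i \near U, forall k : 'I_n.+1, forall t, 0 <= t <= N -> `|q i k t - z' k t| < e.
    apply: filter_forall => k; apply: H => //; by rewrite -ltnS.
  apply: filterS => i h k t kn tN.
  have := h (Ordinal (kn : (k < n.+1)%N)) t tN; rewrite /=.
  rewrite (fluid_solution_unique la_gt0 nu_gt0 mu_gt0 overload zs zs')// ?(andP tN).1//.
    by move=> j jn; rewrite z0// z0'.
Qed.

End existence.

(** * Integrals and scaled counting paths *)

Section integrals.
Context {R : realType}.
Implicit Types (f g : R -> R).
Local Notation leb := (@lebesgue_measure R).

(** Such a function is the limit of step functions that sample it at the next
    multiple of [1 / m.+1] strictly to the right. *)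
Lemma right_continuous_measurable f : (forall t : R, f s @[s --> t^'+] --> f t) ->
  measurable_fun setT f.
Proof.
move=> fr.
pose p (m : nat) (k : int) : R := (k + 1)%:~R / m.+1%:R.
pose fm (m : nat) (t : R) := f (p m (Num.floor (m.+1%:R * t))).
have cv (t : R) : fm m t @[m --> \oo] --> f t.
  apply: (cvg_comp _ _ _ (fr t)).
  move=> A [e /= e0 hA]; rewrite /fmap/=.
  near=> m; apply: hA => /=.
    have /andP[h1 h2] := floor_itv (m.+1%:R * t).
    have m0 : 0 < m.+1%:R :> R by [].
    have k1 : p m (Num.floor (m.+1%:R * t)) - t <= m.+1%:R^-1.
      have : (Num.floor (m.+1%:R * t))%:~R / m.+1%:R <= t => [|hk]; first by rewrite ler_pdivrMr// [t * _]mulrC.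
      by rewrite /p intrD mulr1z mulrDl mul1r lerBlDr [leLHS]addrC lerD2l.
    have k2 : t < p m (Num.floor (m.+1%:R * t)).
      by rewrite /p ltr_pdivlMr// [t * _]mulrC.
    rewrite ltr0_norm ?subr_lt0// opprB; apply: le_lt_trans k1 _.
    by near: m; exact: near_infty_natSinv_lt (PosNum e0).
  have /andP[_] := floor_itv (m.+1%:R * t).
  by rewrite /p ltr_pdivlMr// [t * _]mulrC.
refine (@measurable_fun_cvg _ _ R setT fm f _ (fun t _ => cv t)) => m.
  move=> _ B mB; rewrite setTI.
  rewrite [X in measurable X](_ : _ = \bigcup_(k : int)
      [set t | B (f (p m k)) /\ k%:~R / m.+1%:R <= t < (k + 1)%:~R / m.+1%:R]).
    apply: countable_bigcupT_measurable => // k.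
    have [Bk|Bk] := pselect (B (f (p m k))); last first.
      rewrite [X in measurable X](_ : _ = set0)//.
      by apply/seteqP; split => // t [].
    rewrite [X in measurable X](_ : _ = `[k%:~R / m.+1%:R, (k + 1)%:~R / m.+1%:R[%classic)//.
    by apply/seteqP; split => t /=; rewrite in_itv/=; [case|].
  apply/seteqP; split => t /=.
    move=> Bt; exists (Num.floor (m.+1%:R * t)) => //=; split => //.
    have /andP[h1 h2] := floor_itv (m.+1%:R * t).
    by rewrite ler_pdivrMr// ltr_pdivlMr// [t * _]mulrC h1.
  move=> [k _ /= [Bk /andP[h1 h2]]].
  rewrite /fm (floor_def (m := k))//.
  by rewrite [_ * t]mulrC -ler_pdivrMr// h1 -ltr_pdivlMr.
Unshelve. all: by end_near. Qed.

Lemma measurable_nneg_inv f : measurable_fun setT f -> (forall t, 0 <= f t) ->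
  measurable_fun setT (fun t => (f t)^-1).
Proof.
move=> mf f0; rewrite (_ : (fun t => _) = (fun t => (powR (f t) (-1)))); last first.
  by apply/funext => t; rewrite powR_inv1.
exact: (measurableT_comp (measurable_powR (-1))).
Qed.

Definition locally_bounded f := forall N, exists C, forall t, 0 <= t <= N -> `|f t| <= C.

Lemma locally_bounded_integrable f (a b : R) : measurable_fun setT f -> locally_bounded f ->
  0 <= a -> leb.-integrable `[a, b] (EFin \o f).
Proof.
move=> mf fb a0; have [C hC] := fb b.
apply: measurable_bounded_integrable => //.
- rewrite /= lebesgue_measure_itv/=; case: ifPn => // _.
  by rewrite -EFinB ltry.
- exact: measurable_funTS.
- exists C; split; first exact: num_real.
  move=> M CM t /=; rewrite in_itv/= => /andP[at_ tb].
  by apply: le_trans (ltW CM); apply: hC; rewrite (le_trans a0).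
Qed.

Lemma integral_increment f (s t : R) : measurable_fun setT f -> locally_bounded f ->
  0 <= s -> s <= t ->
  \int[leb]_(u in `[0, t]) f u - \int[leb]_(u in `[0, s]) f u = \int[leb]_(u in `]s, t]) f u.
Proof.
move=> mf fb s0 st; rewrite Rintegral_itvB//.
by apply: locally_bounded_integrable.
Qed.

Let oc_integrable f (s t : R) : measurable_fun setT f -> locally_bounded f ->
  0 <= s -> leb.-integrable `]s, t] (EFin \o f).
Proof.
move=> mf fb s0; apply: integrableS (locally_bounded_integrable t mf fb s0) => //.
by apply: subset_itvr; rewrite bnd_simp.
Qed.

Let oc_cst (s t c : R) : s <= t -> \int[leb]_(u in `]s, t]) c = c * (t - s).
Proof.
move=> st; rewrite Rintegral_cst//= lebesgue_measure_itv/= lte_fin.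
by move: st; rewrite le_eqVlt => /predU1P[->|->]; rewrite ?ltxx ?subrr//.
Qed.

Lemma cst_locally_bounded c : locally_bounded (fun=> c).
Proof. by move=> N; exists `|c|. Qed.

Lemma integral_primitive f : measurable_fun setT f -> locally_bounded f ->
  mean_value_primitive f (fun t => \int[leb]_(u in `[0, t]) f u).
Proof.
move=> mf fb s t m M s0 st fmM; rewrite integral_increment//.
rewrite -!oc_cst//; apply/andP; split; apply: le_Rintegral => //;
  try exact: oc_integrable; try (apply: oc_integrable => //; exact: cst_locally_bounded);
  by move=> u /=; rewrite in_itv/= => /andP[su ut]; have /andP[] : m <= f u <= M
    by apply: fmM; rewrite (ltW su).
Qed.

Lemma integral_primitive_sum n (f : 'I_n -> R -> R) (M : R) (s t : R) :
  (forall k, measurable_fun setT (f k)) -> (forall k, locally_bounded (f k)) ->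
  (forall u, \sum_(k < n) f k u <= M) -> 0 <= s -> s <= t ->
  \sum_(k < n) (\int[leb]_(u in `[0, t]) f k u - \int[leb]_(u in `[0, s]) f k u)
    <= M * (t - s).
Proof.
move=> mf fb fM s0 st; under eq_bigr do rewrite integral_increment//.
have [int_sum sum_int] : leb.-integrable `]s, t] (EFin \o (fun u => \sum_(k < n) f k u)) /\
    \sum_(k < n) \int[leb]_(u in `]s, t]) f k u = \int[leb]_(u in `]s, t]) (\sum_(k < n) f k u).
  elim: n f mf fb {fM} => [|n IH] f mf fb.
    rewrite (_ : (fun u => _) = fun=> 0); last by apply/funext => u; rewrite big_ord0.
    by split; [exact: oc_integrable (cst_locally_bounded 0) s0|rewrite big_ord0 oc_cst// mul0r].
  have [IH1 IH2] := IH (fun k => f (widen_ord (leqnSn n) k)) (fun k => mf _) (fun k => fb _).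
  rewrite (_ : (fun u => \sum_(k < n.+1) f k u)
     = (fun u => \sum_(k < n) f (widen_ord (leqnSn n) k) u + f ord_max u)); last first.
    by apply/funext => u; rewrite big_ord_recr.
  have h := oc_integrable t (mf ord_max) (fb ord_max) s0.
  split; last by rewrite big_ord_recr/= IH2 RintegralD.
  apply: eq_integrable (integrableD _ IH1 h) => // u _ /=.
rewrite sum_int -oc_cst//; apply: le_Rintegral => //.
by apply: oc_integrable => //; exact: cst_locally_bounded.
Qed.

Lemma primitive_rescale f F (a r : R) : 0 < a -> 0 < r -> mean_value_primitive f F ->
  mean_value_primitive (fun u => a * f (r * u)) (fun t => a / r * F (r * t)).
Proof.
move=> a0 r0 fF s t m M s0 st fmM.
have /andP[h1 h2] : m / a * (r * t - r * s) <= F (r * t) - F (r * s) <= M / a * (r * t - r * s).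
  apply: fF; [by rewrite mulr_ge0// ltW|by rewrite ler_pM2l|].
  move=> u /andP[su ut].
  have /fmM : s <= u / r <= t by rewrite ler_pdivlMr// ler_pdivrMr// mulrC su mulrC.
  rewrite [r * _]mulrC divfK ?gt_eqF// => /andP[h1 h2].
  by rewrite ler_pdivrMr// ler_pdivlMr// [f u * a]mulrC h1.
have ar : 0 < a / r by rewrite divr_gt0.
have k1 := ler_wpM2l (ltW ar) h1; have k2 := ler_wpM2l (ltW ar) h2.
have e x : a / r * (x / a * (r * t - r * s)) = x * (t - s).
  by field; rewrite !gt_eqF.
by rewrite !e in k1 k2; rewrite -mulrBr k1 k2.
Qed.

End integrals.

Section law_of_large_numbers.
Context {R : realType}.

(** Beyond some time [T1] the relative error is small; up to [T1] both [N] and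
    its compensator are bounded by a constant, which the division by [r]
    makes small. *)
Lemma scaled_count_uniform (N : R -> nat) (rate B e : R) :
  (forall s t, 0 <= s -> s <= t -> (N s <= N t)%N) ->
  (N t)%:R / t @[t --> +oo] --> rate -> 0 < rate -> 0 < e ->
  \forall r \near +oo, forall y, 0 <= y <= B -> `|(N (r * y))%:R / r - rate * y| <= e.
Proof.
move=> mono lim rate0 e0.
have B1 : 0 < `|B| + 1 by rewrite ltr_wpDl.
have d0 : 0 < e / (`|B| + 1) by rewrite divr_gt0.
move/cvgrPdist_lt : lim => /(_ _ d0) [T [_ hT]].
pose T1 := Num.max T 0 + 1.
have T10 : 0 < T1 by rewrite ltr_wpDl// le_max lexx orbT.
have TT1 : T < T1 by rewrite ltr_pwDr// le_max lexx.
pose C := (N T1)%:R + rate * T1.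
have C0 : 0 <= C by rewrite addr_ge0// mulr_ge0// ltW.
near=> r.
have r0 : 0 < r by near: r; exact: nbhs_pinfty_gt.
have rC : C / e <= r by near: r; apply: nbhs_pinfty_ge; exact: num_real.
move=> y /andP[y0 yB].
have ry : 0 <= r * y by rewrite mulr_ge0// ltW.
have -> : (N (r * y))%:R / r - rate * y = ((N (r * y))%:R - rate * (r * y)) / r.
  by field; rewrite gt_eqF.
rewrite normrM normfV (gtr0_norm r0) ler_pdivrMr//.
have [h|h] := leP T1 (r * y).
  have := hT _ (lt_le_trans TT1 h).
  have ry0 : 0 < r * y by exact: lt_le_trans h.
  rewrite distrC => hh.
  have -> : (N (r * y))%:R - rate * (r * y) = ((N (r * y))%:R / (r * y) - rate) * (r * y).
    by rewrite mulrBl divfK// gt_eqF.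
  rewrite normrM (gtr0_norm ry0); apply: le_trans (ler_wpM2r (ltW ry0) (ltW hh)) _.
  have -> : e / (`|B| + 1) * (r * y) = e * r * (y / (`|B| + 1)) by ring.
  apply: ler_piMr; first by rewrite mulr_ge0// ltW.
  rewrite ler_pdivrMr// mul1r.
  by rewrite (le_trans yB)// (le_trans (ler_norm B))// lerDl.
have n1 : (N (r * y))%:R <= (N T1)%:R :> R by rewrite ler_nat mono// ltW.
have n2 : rate * (r * y) <= rate * T1 by rewrite ler_pM2l// ltW.
have n3 : 0 <= rate * (r * y) by rewrite mulr_ge0// ltW.
have n4 : 0 <= (N (r * y))%:R :> R by [].
have n5 : 0 <= rate * T1 by rewrite mulr_ge0// ltW.
have n6 : 0 <= (N T1)%:R :> R by [].
have : C <= e * r by rewrite mulrC -ler_pdivrMr.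
by rewrite /C => hC; rewrite ler_norml; apply/andP; split; lra.
Unshelve. all: by end_near. Qed.

End law_of_large_numbers.

(** * Paths of the queue in fluid scale *)

Section coordinates.
Context {R : realType} {n : nat}.
Implicit Types (x : 'rV[R]_n.+1) (f : R -> 'rV[R]_n.+1).

(** Out of range, [inord k] is stage [0]. *)
Definition stage x (k : nat) : R := x 0 (inord k).

Lemma stage_ord x (i : 'I_n.+1) : stage x i = x 0 i.
Proof. by rewrite /stage inord_val. Qed.

Lemma mass_stage x : (forall i, 0 <= x 0 i) -> mass n (stage x) = norm1 x.
Proof.
by move=> x0; apply: eq_bigr => i _; rewrite stage_ord ger0_norm.
Qed.

Lemma rV_norm_lt x e : 0 < e ->
  `|x| < e <-> forall k, (k <= n)%N -> `|stage x k| < e.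
Proof.
move=> e0; rewrite -[`|x|]/(mx_norm x) mx_normrE; split.
  move=> /bigmax_ltP[_ h] k kn; exact: (h (0, inord k) isT).
move=> h; apply: bigmax_lt => // -[i j] _ /=; rewrite (ord1 i) -stage_ord.
by apply: h; rewrite -ltnS.
Qed.

Lemma stage_cvg_at k x : stage y k @[y --> x] --> stage x k.
Proof. exact: coord_continuous. Qed.

Lemma cvg_stage (X : Type) (F : set_system X) {FF : Filter F} (f : X -> 'rV[R]_n.+1) x :
  f i @[i --> F] --> x <-> forall k, (k <= n)%N -> stage (f i) k @[i --> F] --> stage x k.
Proof.
split.
  by move=> fx k kn; exact: (cvg_comp f (stage ^~ k) fx (@stage_cvg_at k x)).
move=> h; apply/cvgrPdist_lt => e e0.
have : \forall i \near F, forall k : 'I_n.+1, `|stage x k - stage (f i) k| < e.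
  apply: filter_forall => k; have kn : (k <= n)%N by rewrite -ltnS.
  by have /cvgrPdist_lt /(_ e e0) := h k kn.
apply: filterS => i hi; apply/rV_norm_lt => // k kn.
by have := hi (Ordinal (kn : (k < n.+1)%N)); rewrite /stage !mxE.
Qed.

End coordinates.

Section queue_paths.
Context {R : realType}.
Variables (n : nat) (la nu : R) (mu : 'I_n.+1 -> R).
Hypotheses (la_gt0 : 0 < la) (nu_gt0 : 0 < nu) (mu_gt0 : forall k, 0 < mu k).
Hypothesis overload : 1 < la * \sum_(k < n.+1) (mu k)^-1.

Definition stage_rate (k : nat) : R := mu (inord k).

Lemma stage_rate_gt0 k : 0 < stage_rate k. Proof. exact: mu_gt0. Qed.

Lemma stage_overload : 1 < la * \sum_(k < n.+1) (stage_rate k)^-1.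
Proof.
by under eq_bigr do rewrite /stage_rate inord_val.
Qed.

Section one_path.
Variables (A : R -> nat) (Ps Pa : 'I_n.+1 -> R -> nat) (r : R) (q : skorokhod R n.+1).
Hypothesis r_gt0 : 0 < r.
Hypothesis A_mono : forall s t, 0 <= s -> s <= t -> (A s <= A t)%N.
Hypothesis q_eq : queue_equations mu nu r A Ps Pa q.

Let q_ge0 t k : 0 <= stage (q t) k.
Proof. by case: (sample_path_cadlag q) => _ h _ _; exact: h. Qed.

Let q_measurable k : measurable_fun setT (fun t => stage (q t) k).
Proof.
apply: right_continuous_measurable => t; case: (sample_path_cadlag q) => _ _ h _.
exact: (cvg_comp q (stage ^~ k) (h t) (@stage_cvg_at R n k (q t))).
Qed.

Let share_measurable k : measurable_fun setT (fun t => share n (stage (q t)) k).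
Proof.
apply: measurable_funM; first exact: q_measurable.
apply: measurable_nneg_inv; last by move=> t; exact: mass_ge0.
by apply: measurable_sum => i; exact: q_measurable.
Qed.

Let D (i : 'I_n.+1) t := service_departures mu Ps q i t.
Let B (i : 'I_n.+1) t := abandonments nu r Pa q i t.

Lemma queue_stage_eq t k : 0 <= t -> (k <= n)%N ->
  stage (q t) k = stage (q 0) k + inflow (A t)%:R (fun j => (D (inord j) t)%:R) k
    - (D (inord k) t)%:R - (B (inord k) t)%:R.
Proof.
move=> t0 kn; have [e1 e2] := q_eq t0.
case: k kn => [|k] kn /=.
  by rewrite /stage e1// inordK.
by rewrite /stage (e2 (inord k.+1) (inord k))// !inordK// ltnW.
Qed.

(** Services move customers forward and abandonments remove them, so only
    arrivals increase their number. *)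
Lemma queue_mass_bound t : 0 <= t -> mass n (stage (q t)) <= mass n (stage (q 0)) + (A t)%:R.
Proof.
move=> t0.
have -> : mass n (stage (q t)) = mass n (stage (q 0))
    + (\sum_(k < n.+1) (inflow (A t)%:R (fun j => (D (inord j) t)%:R) k - (D (inord k) t)%:R))
    - \sum_(k < n.+1) (B (inord k) t)%:R.
  rewrite /mass -big_split -sumrB; apply: eq_bigr => k _ /=.
  have kn : (k <= n)%N by rewrite -ltnS.
  by rewrite queue_stage_eq// addrA.
rewrite (sum_inflow_total n (A t)%:R (fun j => (D (inord j) t)%:R)).
have h1 : 0 <= \sum_(k < n.+1) (B (inord k) t)%:R :> R by apply: sumr_ge0.
have h2 : 0 <= (D (inord n) t)%:R :> R by [].
lra.
Qed.

Let q_bounded k : (k <= n)%N -> locally_bounded (fun t => stage (q t) k).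
Proof.
move=> kn N; exists (mass n (stage (q 0)) + (A N)%:R) => t /andP[t0 tN].
rewrite ger0_norm//; apply: le_trans (mass_ge (q_ge0 t) kn) _.
by apply: le_trans (queue_mass_bound t0) _; rewrite lerD2l ler_nat A_mono.
Qed.

Let share_bounded k : (k <= n)%N -> locally_bounded (fun t => share n (stage (q t)) k).
Proof.
move=> kn N; exists 1 => t _; rewrite ger0_norm ?share_ge0// share_le1//.
Qed.

Let qs k t := stage (fluid_scaling r q t) k.
Let J k t := 1 / r * \int[lebesgue_measure]_(u in `[0, r * t]) (stage (q u) k / mass n (stage (q u))).
Let K k t := r^-1 / r * \int[lebesgue_measure]_(u in `[0, r * t]) stage (q u) k.

Let qsE k t : qs k t = r^-1 * stage (q (r * t)) k.
Proof. by rewrite /qs /stage/= mxE gtr0_norm. Qed.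

Let share_qs k t : share n (qs ^~ t) k = share n (stage (q (r * t))) k.
Proof.
rewrite /share; have -> : mass n (qs ^~ t) = r^-1 * mass n (stage (q (r * t))).
  by rewrite /mass mulr_sumr; apply: eq_bigr => i _; rewrite qsE.
rewrite qsE; have [->|m0] := eqVneq (mass n (stage (q (r * t)))) 0.
  by rewrite mulr0 invr0 !mulr0.
by field; rewrite m0 gt_eqF.
Qed.

Lemma queue_clocks : clocks n qs J K.
Proof.
split.
- by move=> k t _; rewrite qsE mulr_ge0// invr_ge0 ltW.
- move=> k kn; split.
  + by rewrite /J mulr0 set_itv1 Rintegral_set1 mulr0.
  + by rewrite /K mulr0 set_itv1 Rintegral_set1 mulr0.
  + move=> t t0; rewrite /K mulr_ge0//; first by rewrite divr_ge0 ?invr_ge0// ltW.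
    exact: Rintegral_ge0.
- move=> k kn.
  rewrite (_ : (fun u => _) = (fun u => 1 * share n (stage (q (r * u))) k)); last first.
    by apply/funext => u; rewrite mul1r share_qs.
  have h := integral_primitive (share_measurable k) (share_bounded kn).
  exact: (primitive_rescale ltr01 r_gt0 h).
- move=> k kn.
  rewrite (_ : qs k = (fun u => r^-1 * stage (q (r * u)) k)); last first.
    by apply/funext => u; rewrite qsE.
  have h := integral_primitive (q_measurable k) (q_bounded kn).
  have ri : 0 < r^-1 by rewrite invr_gt0.
  exact: (primitive_rescale ri r_gt0 h).
- move=> s t s0 st; rewrite /J.
  under eq_bigr do rewrite -mulrBr.
  rewrite -mulr_sumr mul1r ler_pdivrMl// mulrBr -[leRHS]mul1r.
  apply: (@integral_primitive_sum _ n.+1 (fun (k : 'I_n.+1) u => share n (stage (q u)) k) 1 (r * s) (r * t)).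
  + by move=> k; exact: share_measurable.
  + by move=> k; apply: share_bounded; rewrite -ltnS.
  + move=> u; have [m0|m0] := eqVneq (mass n (stage (q u))) 0; last by rewrite sum_share.
    by rewrite /share m0 invr0; under eq_bigr do rewrite mulr0; rewrite sumr_const mul0rn.
  + by rewrite mulr_ge0// ltW.
  + by rewrite ler_pM2l.
Qed.

Let DE k t : (k <= n)%N -> 0 <= t ->
  D (inord k) (r * t) = Ps (inord k) (r * (stage_rate k * J k t)).
Proof.
move=> kn t0; rewrite /D /service_departures; congr (Ps _ _).
rewrite /J mul1r /stage_rate [RHS]mulrCA mulVKf ?gt_eqF//; congr (_ * _).
apply: eq_Rintegral => u _; congr (_ / _).
by rewrite mass_stage// => i; have := q_ge0 u i; rewrite stage_ord.
Qed.

Let BE k t : B (inord k) (r * t) = Pa (inord k) (r * (nu * K k t)).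
Proof.
rewrite /B /abandonments; congr (Pa _ _).
by rewrite /K; field; rewrite gt_eqF.
Qed.

(** The Poisson processes are evaluated at [r * (mu * J)] and [r * (nu * K)].
    After division by [r], the linear terms cancel in the residual and only
    the fluctuations of the scaled Poisson processes remain: those of the
    input, of the services and of the abandonments, which explains the factor
    [3]. *)
Lemma queue_residual k t e : (k <= n)%N -> 0 <= t ->
  `|(A (r * t))%:R / r - la * t| <= e ->
  (forall j, (j <= n)%N -> `|(Ps (inord j) (r * (stage_rate j * J j t)))%:R / r - 1 * (stage_rate j * J j t)| <= e) ->
  `|(Pa (inord k) (r * (nu * K k t)))%:R / r - 1 * (nu * K k t)| <= e ->
  `|residual la nu stage_rate qs J K k t| <= 3 * e.
Proof.
move=> kn t0 hA hPs hPa.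
have rt0 : 0 <= r * t by rewrite mulr_ge0// ltW.
have -> : residual la nu stage_rate qs J K k t =
    inflow ((A (r * t))%:R / r - la * t)
      (fun j => (Ps (inord j) (r * (stage_rate j * J j t)))%:R / r - 1 * (stage_rate j * J j t)) k
    - ((Ps (inord k) (r * (stage_rate k * J k t)))%:R / r - 1 * (stage_rate k * J k t))
    - ((Pa (inord k) (r * (nu * K k t)))%:R / r - 1 * (nu * K k t)).
  rewrite /residual !qsE mulr0 queue_stage_eq// BE DE//.
  have alg q0 a b c li lj lk : r^-1 * (q0 + a - b - c) - (r^-1 * q0 + li - lj - lk)
      = (a / r - li) - (b / r - 1 * lj) - (c / r - 1 * lk) :> R by ring.
  rewrite alg; congr (_ - _ - _).
  by case: k kn {hPa} => [|k] kn //=; rewrite DE ?mul1r// ltnW.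
have hin : `|inflow ((A (r * t))%:R / r - la * t)
      (fun j => (Ps (inord j) (r * (stage_rate j * J j t)))%:R / r - 1 * (stage_rate j * J j t)) k| <= e.
  by case: k kn {hPa} => [|k] kn //=; exact: hPs (ltnW kn).
have hk := hPs k kn.
have -> : 3 * e = e + e + e by ring.
apply: le_trans (ler_normB _ _) _; apply: lerD => //.
by apply: le_trans (ler_normB _ _) _; apply: lerD.
Qed.

Lemma queue_clock_bounds k t N C : (k <= n)%N -> 0 <= t <= N ->
  mass n (qs ^~ 0) + (A (r * N))%:R / r <= C ->
  0 <= J k t <= N /\ 0 <= K k t <= C * N.
Proof.
move=> kn /andP[t0 tN] hC; have [qs0 JK0 hJ hK _] := queue_clocks.
have [J0 K0 _] := JK0 k kn.
have C0 : 0 <= C.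
  apply: le_trans hC; apply: addr_ge0; last by rewrite divr_ge0// ltW.
  by apply: mass_ge0 => j; exact: qs0.
have := hJ k kn 0 t 0 1 (lexx 0) t0.
rewrite J0 !subr0 mul0r mul1r => hJ'.
have := hK k kn 0 t 0 C (lexx 0) t0.
rewrite K0 !subr0 mul0r => hK'.
split.
  have /andP[-> h] : 0 <= J k t <= t.
    by apply: hJ' => u _; rewrite share_qs share_ge0// share_le1.
  exact: le_trans tN.
have /andP[-> h] : 0 <= K k t <= C * t.
  apply: hK' => u /andP[u0 ut]; rewrite qs0//=; apply: le_trans hC.
  have ru0 : 0 <= r * u by rewrite mulr_ge0// ltW.
  have -> : mass n (qs ^~ 0) = r^-1 * mass n (stage (q 0)).
    by rewrite /mass mulr_sumr; apply: eq_bigr => i _; rewrite qsE mulr0.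
  rewrite qsE [_ / r]mulrC -mulrDr ler_pM2l ?invr_gt0//.
  apply: le_trans (mass_ge (q_ge0 _) kn) _; apply: le_trans (queue_mass_bound ru0) _.
  by rewrite lerD2l ler_nat A_mono// ler_pM2l// (le_trans ut).
by apply: le_trans h _; rewrite ler_wpM2l.
Qed.

End one_path.

(** The sources are fixed sample paths that obey the law of large numbers.  On
    [[0, N]] the arguments [mu * J] and [nu * K] at which they are evaluated
    stay in a fixed compact interval, so the residuals vanish. *)
Theorem queue_fluid_limit (X : Type) (F : set_system X) {FF : ProperFilter F}
    (A : R -> nat) (Ps Pa : 'I_n.+1 -> R -> nat)
    (rr : X -> R) (qq : X -> skorokhod R n.+1) (x : nat -> R) (z : nat -> R -> R) :
  (forall s t, 0 <= s -> s <= t -> (A s <= A t)%N) ->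
  (forall i s t, 0 <= s -> s <= t -> (Ps i s <= Ps i t)%N) ->
  (forall i s t, 0 <= s -> s <= t -> (Pa i s <= Pa i t)%N) ->
  (A t)%:R / t @[t --> +oo] --> la ->
  (forall i, (Ps i t)%:R / t @[t --> +oo] --> (1:R)) ->
  (forall i, (Pa i t)%:R / t @[t --> +oo] --> (1:R)) ->
  (forall i, 0 < rr i) -> rr i @[i --> F] --> +oo ->
  (forall i, queue_equations mu nu (rr i) A Ps Pa (qq i)) ->
  (forall k, (k <= n)%N -> stage (fluid_scaling (rr i) (qq i) 0) k @[i --> F] --> x k) ->
  fluid_solution n la nu stage_rate z -> (forall k, (k <= n)%N -> z k 0 = x k) ->
  forall N e, 0 < e -> \forall i \near F, forall k t, (k <= n)%N -> 0 <= t <= N ->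
    `|stage (fluid_scaling (rr i) (qq i) t) k - z k t| < e.
Proof.
move=> Am Psm Pam Al Psl Pal rr0 rry qe q0 zs z0.
apply: (fluid_limit la_gt0 nu_gt0 stage_rate_gt0 stage_overload
  (fun i => queue_clocks (rr0 i) Am (qe i)) _ q0 zs z0).
move=> k N e kn e0; have e3 : 0 < e / 3 by rewrite divr_gt0.
(* [C] eventually bounds the mass of the scaled queue on [[0, N]], and [M] the
   arguments of the service processes. *)
pose C := mass n x + 1 + (la * `|N| + 1).
pose M := \sum_(j < n.+1) stage_rate j * `|N|.
have hA := scaled_count_uniform `|N| Am Al la_gt0 e3.
have hA1 := scaled_count_uniform `|N| Am Al la_gt0 ltr01.
have hPs : \forall r \near +oo, forall (i : 'I_n.+1) y, 0 <= y <= M -> `|(Ps i (r * y))%:R / r - 1 * y| <= e / 3.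
  by apply: filter_forall => i; exact: (scaled_count_uniform M (Psm i) (Psl i) ltr01 e3).
have hPa := scaled_count_uniform (nu * (C * `|N|)) (Pam (inord k)) (Pal (inord k)) ltr01 e3.
have m0 : \forall i \near F, mass n (fun k => stage (fluid_scaling (rr i) (qq i) 0) k) < mass n x + 1.
  have h : mass n (fun k => stage (fluid_scaling (rr i) (qq i) 0) k) @[i --> F] --> mass n x.
    exact: (@cvg_bigsum _ _ _ _ n.+1 (fun k i => stage (fluid_scaling (rr i) (qq i) 0) k) x).
  have /cvgrPdist_lt /(_ _ ltr01) := h.
  by apply: filterS => i; rewrite ltr_norml => /andP[]; lra.
have := rry _ hA; have := rry _ hA1; have := rry _ hPs; have := rry _ hPa.
rewrite /fmap/= => kPa kPs kA1 kA.
near=> i => t tN.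
have N0 : 0 <= `|N| by [].
have /andP[t0 tN'] := tN.
have tNN : 0 <= t <= `|N| by rewrite t0 (le_trans tN')// ler_norm.
have mi : mass n (fun k => stage (fluid_scaling (rr i) (qq i) 0) k) < mass n x + 1 by near: i.
have aA1 : forall y, 0 <= y <= `|N| -> `|(A (rr i * y))%:R / rr i - la * y| <= 1 by near: i.
have aA : forall y, 0 <= y <= `|N| -> `|(A (rr i * y))%:R / rr i - la * y| <= e / 3 by near: i.
have aPs : forall (j : 'I_n.+1) y, 0 <= y <= M -> `|(Ps j (rr i * y))%:R / rr i - 1 * y| <= e / 3 by near: i.
have aPa : forall y, 0 <= y <= nu * (C * `|N|) -> `|(Pa (inord k) (rr i * y))%:R / rr i - 1 * y| <= e / 3 by near: i.
have hC : mass n (fun k => stage (fluid_scaling (rr i) (qq i) 0) k) + (A (rr i * `|N|))%:R / rr i <= C.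
  have := aA1 `|N|; rewrite lexx normr_ge0 => /(_ isT); rewrite ler_norml => /andP[_].
  by rewrite /C; move: mi; lra.
have bd j := @queue_clock_bounds A Ps Pa (rr i) (qq i) (rr0 i) Am (qe i) j t `|N| C.
have -> : e = 3 * (e / 3) by field.
apply: (queue_residual (rr0 i) (qe i) kn t0).
- exact: aA.
- move=> j jn; apply: aPs; have [/andP[j0 jN] _] := bd j jn tNN hC.
  rewrite mulr_ge0 ?(ltW (stage_rate_gt0 j))//=.
  apply: (@le_trans _ _ (stage_rate j * `|N|)); first by rewrite ler_pM2l ?stage_rate_gt0.
  rewrite /M (bigD1 (Ordinal (jn : (j < n.+1)%N)))//= lerDl.
  by apply: sumr_ge0 => l _; rewrite mulr_ge0// ltW// stage_rate_gt0.
- apply: aPa; have [_ /andP[j0 jN]] := bd k kn tNN hC.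
  by rewrite mulr_ge0 ?(ltW nu_gt0)//= ler_pM2l.
Unshelve. all: by end_near. Qed.

End queue_paths.

(** * Law of large numbers for Poisson processes *)

Section poisson_tails.
Context {R : realType}.

Lemma expR_quadratic (x : R) : `|x| <= 1 / 2 -> expR x <= 1 + x + 2 * x ^+ 2.
Proof.
rewrite ler_norml => /andP[x1 x2].
have h1 : 0 < 1 - x by lra.
have h2 : 1 - x <= expR (- x) by exact: expR_ge1Dx.
have -> : expR x = (expR (- x))^-1 by rewrite expRN invrK.
have h3 : (expR (- x))^-1 <= (1 - x)^-1 by rewrite lef_pV2 ?posrE ?expR_gt0.
apply: le_trans h3 _; rewrite -[leLHS]mul1r ler_pdivrMr//.
have := sqr_ge0 x; nra.
Qed.

Lemma poisson_pmf_sum (m : R) : 0 < m -> (\sum_(j <oo) (poisson_pmf m j)%:E = 1)%E.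
Proof.
move=> m0; have := probability_setT (poisson_prob m 0).
rewrite /= /poisson_prob m0 -nneseries_esumT//.
by move=> j; rewrite lee_fin poisson_pmf_ge0.
Qed.

(** This gives the exponential moments of the Poisson law from its total mass. *)
Lemma poisson_pmf_tilt (m th : R) j : 0 < m ->
  poisson_pmf m j * expR (th * j%:R) = expR (m * (expR th - 1)) * poisson_pmf (m * expR th) j.
Proof.
move=> m0; rewrite /poisson_pmf m0 mulr_gt0 ?expR_gt0//.
rewrite exprMn -expRM_natr.
have -> : m * (expR th - 1) = - m + m * expR th by ring.
rewrite expRD expRN [expR (- (m * _))]expRN; field.
by rewrite !gt_eqF ?expR_gt0// ltr0n fact_gt0.
Qed.

End poisson_tails.

Section poisson_lln.
Context {R : realType} {d : measure_display} {T : measurableType d} (P : probability T R).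
Variables (rate : R) (N : T -> R -> nat).
Hypotheses (rate_gt0 : 0 < rate) (N_poisson : poisson_process P rate N).

Let N_event (t : R) (S : set nat) : 0 <= t -> measurable [set w | S (N w t)].
Proof.
move=> t0; have [mN _ _ _] := N_poisson.
by have := mN t t0 measurableT S I; rewrite setTI.
Qed.

Let N_law (t : R) j : 0 < t -> P [set w | N w t = j] = (poisson_pmf (rate * t) j)%:E.
Proof.
move=> t0; have [_ N0 _ law] := N_poisson.
have := law 0 t (lexx 0) t0 j; rewrite subr0 => <-; congr (P _).
by apply/seteqP; split => w /=; have [-> _ _] := N0 w; rewrite subn0.
Qed.

(** On the event, [expR (th * (N - rate * t) - c)] is at least [1]. *)
Lemma poisson_chernoff (t th c : R) : 0 < t ->
  (P [set w | (c <= th * ((N w t)%:R - rate * t))%R]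
    <= (expR (- c + rate * t * (expR th - 1 - th)))%:E)%E.
Proof.
move=> t0; pose m := rate * t.
have m0 : 0 < m by rewrite mulr_gt0.
pose S := [set j : nat | c <= th * (j%:R - m)].
have mS : measurable [set w | S (N w t)] by exact: N_event (ltW t0).
have mE j : measurable [set w | N w t = j /\ S j].
  exact: (N_event [set i | i = j /\ S j] (ltW t0)).
rewrite (_ : [set w | _] = \bigcup_j [set w | N w t = j /\ S j]); last first.
  apply/seteqP; split => w /=; first by move=> h; exists (N w t).
  by move=> [j _ [-> ]].
rewrite measure_bigcup//; last first.
  by apply/trivIsetP => i j _ _ ij; apply/seteqP; split => // w /= [[-> _] [e _]]; move: ij; rewrite e eqxx.
apply: (@le_trans _ _ (\sum_(j <oo) ((expR (- c - th * m + m * (expR th - 1)))%:E * (poisson_pmf (m * expR th) j)%:E))%E).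
  rewrite (eq_eseriesl (Q := predT)); last by move=> j; rewrite in_setT.
  apply: lee_nneseries => // j _.
  have e1 : ((expR (- c - th * m + m * (expR th - 1)))%:E * (poisson_pmf (m * expR th) j)%:E
     = (poisson_pmf m j * expR (th * (j%:R - m) - c))%:E)%E.
    rewrite -EFinM; congr EFin.
    have -> : - c - th * m + m * (expR th - 1) = m * (expR th - 1) + (- c - th * m) by ring.
    rewrite expRD mulrAC -poisson_pmf_tilt// -mulrA -expRD; congr (_ * expR _); ring.
  rewrite e1; have [Sj|nSj] := pselect (S j).
    rewrite (_ : [set w | _] = [set w | N w t = j]); last first.
      by apply/seteqP; split => w /= [].
    rewrite [leLHS](N_law j t0) lee_fin -[leLHS]mulr1 ler_wpM2l ?poisson_pmf_ge0//.
    by rewrite -[leLHS]expR0 ler_expR subr_ge0.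
  rewrite (_ : [set w | _] = set0) ?measure0; last by apply/seteqP; split => w // [].
  by rewrite lee_fin mulr_ge0 ?expR_ge0 ?poisson_pmf_ge0.
rewrite nneseriesZl; last by move=> j _; rewrite lee_fin poisson_pmf_ge0.
rewrite poisson_pmf_sum ?mulr_gt0 ?expR_gt0// mule1 lee_fin ler_expR -/m; lra.
Qed.

Let deviation (e : R) (k : nat) : set T :=
  [set w | e * (rate * k.+1%:R) <= `|(N w k.+1%:R)%:R - rate * k.+1%:R|].

Let deviation_measurable e k : measurable (deviation e k).
Proof.
exact: (N_event [set j : nat | e * (rate * k.+1%:R) <= `|j%:R - rate * k.+1%:R|]).
Qed.

(* The exponent of [poisson_chernoff] is at most
   [rate * k.+1 * (2 * th ^+ 2 - e * `|th|)], and [th = e / 4] minimises it. *)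
Let deviation_bound (e : R) k : 0 < e -> e <= 1 ->
  (P (deviation e k) <= (2 * expR (- (e ^+ 2 * rate / 8) * k.+1%:R))%:E)%E.
Proof.
move=> e0 e1; have k0 : 0 < k.+1%:R :> R by [].
pose c := e ^+ 2 * (rate * k.+1%:R) / 4.
pose tail th := [set w | c <= th * ((N w k.+1%:R)%:R - rate * k.+1%:R)].
have mtail th : measurable (tail th).
  exact: (N_event [set j : nat | c <= th * (j%:R - rate * k.+1%:R)]).
have sub : deviation e k `<=` tail (e / 4) `|` tail (- (e / 4)).
  move=> w /=; rewrite /deviation/tail/= ler_normr => /orP[h|h]; [left|right].
    have := ler_wpM2l (ltW e0) h; rewrite /c expr2; lra.
  have := ler_wpM2l (ltW e0) h; rewrite /c expr2; lra.
have bnd th : `|th| = e / 4 -> (P (tail th) <= (expR (- (e ^+ 2 * rate / 8) * k.+1%:R))%:E)%E.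
  move=> the; apply: le_trans (poisson_chernoff th c k0) _.
  rewrite lee_fin ler_expR.
  have th2 : th ^+ 2 = e ^+ 2 / 16.
    by rewrite -[th ^+ 2]ger0_norm ?sqr_ge0// normrX the expr_div_n; congr (_ / _); ring.
  have : expR th <= 1 + th + 2 * th ^+ 2 by apply: expR_quadratic; rewrite the; lra.
  rewrite th2 => hq.
  have : rate * k.+1%:R * (expR th - 1 - th) <= rate * k.+1%:R * (2 * (e ^+ 2 / 16)).
    by rewrite ler_pM2l ?mulr_gt0//; lra.
  rewrite /c; lra.
apply: (@le_trans _ _ (P (tail (e / 4) `|` tail (- (e / 4))))).
  by apply: le_measure; rewrite ?inE//; exact: measurableU.
apply: le_trans (measureU2 _ _ _) _ => //.
have e4 : 0 <= e / 4 by rewrite divr_ge0// ltW.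
rewrite mulr_natl mulr2n EFinD; apply: leeD; apply: bnd.
  by rewrite ger0_norm.
by rewrite normrN ger0_norm.
Qed.

Let deviation_ae (e : R) : 0 < e -> e <= 1 ->
  {ae P, forall w, exists K, forall k, (K <= k)%N -> ~ deviation e k w}.
Proof.
move=> e0 e1; have h : P (lim_sup_set (deviation e)) = 0.
  apply: lim_sup_set_cvg0; first exact: deviation_measurable.
  pose x := expR (- (e ^+ 2 * rate / 8)).
  have c0 : 0 < e ^+ 2 * rate / 8 by rewrite divr_gt0// mulr_gt0// exprn_gt0.
  have x1 : x < 1 by rewrite -[ltRHS]expR0 ltr_expR oppr_lt0.
  have x0 : 0 < x by exact: expR_gt0.
  apply: (@le_lt_trans _ _ (2 / (1 - x))%:E); last exact: ltry.
  apply: lime_le.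
    by apply: is_cvg_nneseries => n _ _; exact: measure_ge0.
  apply: nearW => n.
  apply: (@le_trans _ _ (\sum_(0 <= k < n) (2 * x ^+ k)%:E)%E).
    apply: lee_sum => k _; apply: le_trans (deviation_bound k e0 e1) _.
    rewrite lee_fin ler_pM2l// expRM_natr -/x exprS.
    by rewrite ler_piMl ?exprn_ge0 ?ltW.
  rewrite sumEFin lee_fin -mulr_sumr ler_pM2l// -[leRHS]mul1r ler_pdivlMr ?subr_gt0//.
  have -> : (\sum_(0 <= k < n) x ^+ k) * (1 - x) = 1 - x ^+ n.
    elim: n => [|n IH]; first by rewrite big_geq// expr0 mul0r subrr.
    by rewrite big_nat_recr//= mulrDl IH exprS; ring.
  by rewrite gerBl exprn_ge0// ltW.
exists (lim_sup_set (deviation e)); split => //.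
  apply: bigcap_measurable => // n _; apply: bigcup_measurable => k _; exact: deviation_measurable.
move=> w /= nh n _; apply: contrapT => hn; apply: nh; exists n => k nk dk.
by apply: hn; exists k.
Qed.

(** The deviations along the integers are summable, so Borel and Cantelli
    apply; between integers [N] is monotone. *)
Theorem poisson_lln : {ae P, forall w, (N w t)%:R / t @[t --> +oo] --> rate}.
Proof.
have h : {ae P, forall w, forall j : nat, exists K, forall k, (K <= k)%N -> ~ deviation j.+1%:R^-1 k w}.
  apply/ae_foralln => j; apply: deviation_ae; first by rewrite invr_gt0.
  by rewrite invf_le1// ler1n.
apply: filterS h => w hw; have [_ N0 _ _] := N_poisson; have [_ mono _] := N0 w.
apply/cvgrPdist_le => e e0.
have e2 : 0 < e / (2 * rate) by rewrite divr_gt0// mulr_gt0.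
have [j hj] : exists j : nat, j.+1%:R^-1 <= e / (2 * rate).
  have [j _ hj] := near_infty_natSinv_lt (PosNum e2).
  by exists j; apply: ltW; exact: (hj j (leqnn j)).
set b := j.+1%:R^-1 in hj; have [K hK] := hw j.
have b0 : 0 < b by rewrite invr_gt0.
have be : b * rate <= e / 2.
  by move: hj; rewrite ler_pdivlMr ?mulr_gt0//; lra.
near=> t.
have t0 : 0 < t by near: t; exact: nbhs_pinfty_gt.
have tK : K.+2%:R <= t by near: t; apply: nbhs_pinfty_ge; exact: num_real.
have tC : (b * rate + rate) / (e / 2) <= t by near: t; apply: nbhs_pinfty_ge; exact: num_real.
have /andP[k1 k2] := truncn_itv (ltW t0).
set k := Num.truncn t in k1 k2.
have k1' : (k%:R <= t) && (t < k.+1%:R) by rewrite k1 k2.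
have Kk : (K.+1 <= k)%N.
  rewrite -ltnS -(ltr_nat R); apply: le_lt_trans k2; apply: le_trans tK.
  by rewrite ler_nat.
case: k k1 k2 Kk {k1'} => [//|k] k1 k2 Kk.
have /negP := hK k (Kk : (K <= k)%N); rewrite -ltNge -/b => d1.
have /negP := hK k.+1 (leqW Kk : (K <= k.+1)%N); rewrite -ltNge -/b => d2.
have m1 : (N w k.+1%:R)%:R <= (N w t)%:R :> R by rewrite ler_nat mono.
have m2 : (N w t)%:R <= (N w k.+2%:R)%:R :> R by rewrite ler_nat mono// ltW.
move: d1 d2; rewrite !ltr_norml => /andP[d1 _] /andP[_ d2].
have k2' : k.+2%:R <= t + 1 by rewrite -natr1 lerD2r.
have k1' : t <= k.+1%:R + 1 by rewrite natr1 ltW.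
have r1 : rate * k.+2%:R <= rate * (t + 1) by rewrite ler_pM2l.
have r2 : rate * t <= rate * (k.+1%:R + 1) by rewrite ler_pM2l.
have r3 : rate * k.+1%:R <= rate * t by rewrite ler_pM2l.
have r4 : rate * t <= rate * k.+2%:R by rewrite ler_pM2l// ltW.
have s1 : b * (rate * k.+2%:R) <= b * (rate * (t + 1)) by rewrite ler_pM2l.
have s2 : b * (rate * k.+1%:R) <= b * (rate * t) by rewrite ler_pM2l.
have key : `|(N w t)%:R - rate * t| <= b * rate * t + (b * rate + rate).
  have br0 : 0 < b * rate by rewrite mulr_gt0.
  by rewrite ler_norml; apply/andP; split; lra.
rewrite distrC.
have -> : (N w t)%:R / t - rate = ((N w t)%:R - rate * t) / t by field; rewrite gt_eqF.
rewrite normrM normfV (gtr0_norm t0) ler_pdivrMr//; apply: le_trans key _.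
have c1 : b * rate * t <= e / 2 * t by rewrite ler_pM2r.
have c2 : b * rate + rate <= t * (e / 2) by rewrite -ler_pdivrMr// divr_gt0.
lra.
Unshelve. all: by end_near. Qed.

End poisson_lln.

(** * The solution map into the Skorokhod space *)

Section skorokhod_facts.
Context {R : realType}.

(** The identity is a time change, so locally uniform convergence implies
    convergence in the J1 topology. *)
Lemma uniform_cvg_J1 (n : nat) (X : Type) (F : set_system X) {FF : Filter F}
    (f : X -> skorokhod R n.+1) (g : skorokhod R n.+1) :
  (forall N e, 0 < e -> \forall i \near F, forall k t, (k <= n)%N -> 0 <= t <= N ->
     `|stage (f i t) k - stage (g t) k| < e) ->
  f i @[i --> F] --> g.
Proof.
move=> fg A /J1_nbhsP[N [e [e0 hA]]]; apply: filterS (fg N e e0) => i hi; apply: hA.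
exists id; split => /=.
- by split => //; split => // s s0; exists s.
- by move=> s _; rewrite subrr normr0.
- move=> s sN; rewrite distrC; apply/(rV_norm_lt _ e0) => k kn.
  by have := hi k s kn sN; rewrite /stage !mxE.
Qed.

(** A time change [lam] between two paths becomes [s |-> r^-1 * lam (r * s)]
    between their scalings. *)
Lemma fluid_scaling_continuous (I : nat) (r : R) : 0 < r ->
  continuous (@fluid_scaling R I r).
Proof.
move=> r0 x A /J1_nbhsP[N [e [e0 hA]]]; apply/J1_nbhsP.
have ri : 0 < r^-1 by rewrite invr_gt0.
exists (r * N), (Num.min (r * e) (r * e)); rewrite minxx; split; first exact: mulr_gt0.
move=> y [lam [[lamb lamm] h1 h2]]; apply: hA.
have lam0 s : 0 <= s -> 0 <= lam s by case: lamb => + _ _; exact.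
have rs s : 0 <= s -> 0 <= r * s by move=> s0; rewrite mulr_ge0// ltW.
exists (fun s => r^-1 * lam (r * s)); split => /=.
- split; first split.
  + by move=> s /= s0; rewrite mulr_ge0 ?lam0 ?rs// ltW.
  + move=> s t /set_mem /= s0 /set_mem /= t0 /(mulfI (lt0r_neq0 ri)) => e1.
    case: lamb => _ inj _; have := inj (r * s) (r * t) _ _ e1.
    by rewrite !inE/= => /(_ (rs _ s0) (rs _ t0)) /(mulfI (lt0r_neq0 r0)).
  + move=> t /= t0; case: lamb => _ _ /(_ (r * t) (rs _ t0)) [s /= s0 st].
    exists (r^-1 * s); first by rewrite /= mulr_ge0// ltW.
    by rewrite mulVKf ?gt_eqF// st mulKf// gt_eqF.
  + move=> s t s0 st; rewrite ltr_pM2l//; apply: lamm; first exact: rs.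
    by rewrite ltr_pM2l.
- move=> s s0; have -> : r^-1 * lam (r * s) - s = r^-1 * (lam (r * s) - r * s).
    by field; rewrite gt_eqF.
  by rewrite normrM gtr0_norm// ltr_pdivrMl// h1// rs.
- move=> s /andP[s0 sN]; rewrite gtr0_norm// mulVKf ?gt_eqF//.
  rewrite -scalerBr normrZ gtr0_norm// ltr_pdivrMl//.
  by apply: h2; rewrite rs//= ler_pM2l.
Qed.

End skorokhod_facts.

Section fluid_paths.
Context {R : realType}.
Variables (n : nat) (la nu : R) (mu : 'I_n.+1 -> R).
Hypotheses (la_gt0 : 0 < la) (nu_gt0 : 0 < nu) (mu_gt0 : forall k, 0 < mu k).
Hypothesis overload : 1 < la * \sum_(k < n.+1) (mu k)^-1.
Local Notation rate := (stage_rate mu).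

Lemma fluid_model_stage (Z : skorokhod R n.+1) : fluid_model_solution la mu nu Z ->
  fluid_solution n la nu rate (fun k t => stage (Z t) k).
Proof.
move=> [Zc Zinf dZ]; have [Zneg Z0 _ _] := sample_path_cadlag Z.
have Zmax t : Z t = Z (Num.max t 0).
  have [t0|t0] := leP t 0; last by [].
  by move: t0; rewrite le_eqVlt => /predU1P[->//|/Zneg].
have massE t : mass n (stage (Z t)) = norm1 (Z t) by exact: mass_stage.
split.
- move=> k kn; split; last first.
    by move=> t t0; rewrite Zmax (max_idPr t0).
  move=> t.
  have h : stage (Z s) k @[s --> within [set t : R | 0 <= t] (nbhs (Num.max t 0))]
      --> stage (Z (Num.max t 0)) k.
    move/subspace_continuousP : Zc => /(_ (Num.max t 0)) h.
    have t0 : 0 <= Num.max t 0 by rewrite le_max lexx orbT.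
    exact: (cvg_comp Z (stage ^~ k) (h t0) (@stage_cvg_at R n k (Z (Num.max t 0)))).
  have hm : Num.max s 0 @[s --> t] --> within [set t : R | 0 <= t] (nbhs (Num.max t 0)).
    move=> A hA.
    have hc : Num.max s 0 @[s --> t] --> Num.max t 0.
      by apply: (@continuous_max _ _ (fun s : R => s) (fun=> 0)); [exact: cvg_id|exact: cvg_cst].
    have := hc _ hA; rewrite !nbhs_simpl/=; apply: filterS => s /=; apply.
    by rewrite le_max lexx orbT.
  rewrite (_ : (fun s => stage (Z s) k) = (fun s => stage (Z (Num.max s 0)) k)); last first.
    by apply/funext => s; rewrite -Zmax.
  exact: (cvg_comp (fun s => Num.max s 0) (fun s => stage (Z s) k) hm h).
- by move=> k t; exact: Z0.
- move=> d d0; have := Zinf d d0; set I0 := inf _ => i0; exists I0 => // t dt.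
  rewrite massE; apply: ge_inf; last by exists t.
  by exists 0 => _ [s _ <-]; apply: sumr_ge0.
- move=> t k t0 kn; have [d1 d2] := dZ t t0.
  rewrite /drift /share massE; case: k kn => [|k] kn /=.
    by apply: d1; rewrite inordK.
  by apply: d2; rewrite !inordK// ltnW.
Qed.

Section path_of_solution.
Variable z : nat -> R -> R.
Hypothesis z_sol : fluid_solution n la nu rate z.

Definition row_path (t : R) : 'rV[R]_n.+1 := \row_i z i t.

Lemma stage_row_path t k : (k <= n)%N -> stage (row_path t) k = z k t.
Proof. by move=> kn; rewrite /stage mxE inordK. Qed.

Lemma row_path_continuous : continuous row_path.
Proof.
move=> t; apply/cvg_stage => k kn; rewrite stage_row_path//.
under eq_fun do rewrite stage_row_path//.
by have [zc _ _ _] := z_sol; have [h _] := zc k kn; exact: h.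
Qed.

Lemma row_path_cadlag : cadlag_nneg row_path.
Proof.
have [zc z0 _ _] := z_sol; split.
- move=> t t0; apply/rowP => i; rewrite !mxE.
  by have [_ ->//] := zc i (ltn_ord i); exact: ltW.
- by move=> t i; rewrite mxE.
- by move=> t; apply: cvg_at_right_filter; exact: row_path_continuous.
- move=> t; apply: (cvgP (row_path t)).
  by apply: cvg_at_left_filter; exact: row_path_continuous.
Qed.

Lemma row_path_fluid_model : fluid_model_solution la mu nu (Skorokhod row_path_cadlag).
Proof.
have [zc z0 zm dz] := z_sol.
have massE t : mass n (z ^~ t) = norm1 (row_path t).
  by apply: eq_bigr => i _; rewrite mxE ger0_norm.
have rateE (i : 'I_n.+1) : rate i = mu i by rewrite /stage_rate inord_val.
split.
- exact: continuous_subspaceT row_path_continuous.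
- move=> d d0; have [c c0 hc] := zm d d0; apply: lt_le_trans c0 _.
  apply: lb_le_inf; first by exists (norm1 (row_path d)), d => //=.
  by move=> _ [t dt <-] /=; rewrite -massE hc.
- move=> t t0; split => [i i0|i j ij].
    have := dz t i t0 (ltn_ord i); rewrite /drift /share massE rateE i0/= => h.
    rewrite (_ : (fun s => _) = z i); last by apply/funext => s; rewrite /= mxE.
    by rewrite /= !mxE i0.
  have := dz t i t0 (ltn_ord i); rewrite /drift /share massE rateE ij/= rateE => h.
  rewrite (_ : (fun s => _) = z i); last by apply/funext => s; rewrite /= mxE.
  by rewrite /= !mxE ij.
Qed.

End path_of_solution.

(** Weak convergence of the initial states is tested with functions on the
    whole space [R^I]; taking positive parts extends the solution map to it.
    Continuity is the fluid limit theorem for solutions issued from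
    neighbouring states. *)
Lemma fluid_map : exists Psi : 'rV[R]_n.+1 -> skorokhod R n.+1,
  [/\ continuous Psi,
      forall x, fluid_model_solution la mu nu (Psi x),
      forall x k, (k <= n)%N -> stage (Psi x 0) k = Num.max (stage x k) 0
    & forall x Z, fluid_model_solution la mu nu Z ->
        (forall k, (k <= n)%N -> stage (Z 0) k = Num.max (stage x k) 0) -> Psi x = Z].
Proof.
have rate0 := stage_rate_gt0 mu_gt0; have over := stage_overload overload.
pose pos (x : 'rV[R]_n.+1) k : R := Num.max (stage x k) 0.
have pos0 x k : 0 <= pos x k by rewrite le_max lexx orbT.
have /choice[z /choice[J /choice[K H]]] : forall x : 'rV[R]_n.+1, exists z J K,
   [/\ fluid_solution n la nu rate z, clocks n z J K,
    forall k t, (k <= n)%N -> 0 <= t -> residual la nu rate z J K k t = 0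
  & forall k, (k <= n)%N -> z k 0 = pos x k].
  move=> x; exact: (fluid_solution_exists la_gt0 nu_gt0 rate0 over (pos0 x)).
have zs x : fluid_solution n la nu rate (z x) by have [] := H x.
pose Psi x := Skorokhod (row_path_cadlag (zs x)).
have PsiE x t k : (k <= n)%N -> stage (Psi x t) k = z x k t.
  by move=> kn; exact: stage_row_path.
exists Psi; split.
- move=> x; apply: (@uniform_cvg_J1 R n _ (nbhs x) (nbhs_filter x) Psi (Psi x)) => N e e0.
  have zres k M e' : (k <= n)%N -> 0 < e' -> \forall y \near nbhs x, forall t, 0 <= t <= M ->
      `|residual la nu rate (z y) (J y) (K y) k t| <= e'.
    move=> kn e'0; apply: filterE => y t /andP[t0 _]; have [_ _ -> //] := H y.
    by rewrite normr0 ltW.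
  have zstart k : (k <= n)%N -> z y k 0 @[y --> x] --> pos x k.
    move=> kn; rewrite (_ : (fun y => z y k 0) = pos ^~ k); last first.
      by apply/funext => y; have [_ _ _ ->] := H y.
    apply: (@continuous_max _ _ (fun y => stage y k) (fun=> 0)); last exact: cst_continuous.
    exact: coord_continuous.
  have zclocks y : clocks n (z y) (J y) (K y) by have [] := H y.
  have zx k : (k <= n)%N -> z x k 0 = pos x k by have [_ _ _] := H x; exact.
  have h := @fluid_limit R n la nu rate la_gt0 nu_gt0 rate0 over _ (nbhs x) (nbhs_pfilter x)
    z J K (pos x) (z x) zclocks zres zstart (zs x) zx N e e0.
  by apply: filterS h => y hy k t kn tN; rewrite !PsiE//; exact: hy.
- by move=> x; exact: row_path_fluid_model.
- by move=> x k kn; rewrite PsiE//; have [_ _ _ ->] := H x.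
- move=> x Z hZ Z0; apply: skorokhod_eq => t t0; apply/rowP => i.
  have iN : (i <= n)%N by rewrite -ltnS.
  rewrite -!stage_ord PsiE//.
  apply: (fluid_solution_unique la_gt0 nu_gt0 rate0 over (zs x) (fluid_model_stage hZ)) => // k kn.
  by rewrite Z0//; have [_ _ _ ->] := H x.
Qed.

End fluid_paths.

(** * Measurability and bounded convergence *)

Section borel_maps.

Lemma continuous_borel (S S' : ptopologicalType) (f : S -> S') : continuous f ->
  measurable_fun setT (f : borel S -> borel S').
Proof.
move=> fc; apply: (@measurability _ _ (borel S) (borel S') setT f (@open S')) => //.
move=> _ [B oB <-]; rewrite setTI; apply: sub_sigma_algebra.
by move: oB; apply: open_comp => x _; exact: fc.
Qed.

Lemma continuous_borel_real (R : realType) (S : ptopologicalType) (f : S -> R) : continuous f ->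
  measurable_fun setT (f : borel S -> R).
Proof.
move=> fc; apply: (measurability _ (RGenOpens.measurableE R)).
move=> _ [_ [x [y ->]] <-]; rewrite setTI; apply: sub_sigma_algebra.
by apply: open_comp; [move=> s _; exact: fc|exact: interval_open].
Qed.

Lemma random_element_comp (d : measure_display) (T : measurableType d)
    (S S' : ptopologicalType) (f : S -> S') (X : T -> S) :
  continuous f -> random_element X -> random_element (f \o X).
Proof. by move=> fc mX; exact: (measurableT_comp (continuous_borel fc) mX). Qed.

Lemma random_element_real (R : realType) (d : measure_display) (T : measurableType d)
    (S : ptopologicalType) (f : S -> R) (X : T -> S) :
  continuous f -> random_element X -> measurable_fun setT (f \o X).
Proof. by move=> fc mX; exact: (measurableT_comp (continuous_borel_real fc) mX). Qed.

End borel_maps.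

Section bounded_expectations.
Context {R : realType} {d : measure_display} {T : measurableType d} (P : probability T R).
Implicit Types (X Y : T -> R) (M : R).

Lemma bounded_integrable X M : measurable_fun setT X -> (forall w, `|X w| <= M) ->
  P.-integrable setT (EFin \o X).
Proof.
move=> mX XM; apply: measurable_bounded_integrable => //.
  by rewrite /= probability_setT ltry.
exists M; split; first exact: num_real.
by move=> M' MM' w _; exact: le_trans (ltW MM').
Qed.

Lemma expectation_Rintegral X M : measurable_fun setT X -> (forall w, `|X w| <= M) ->
  'E_P[X]%E = (\int[P]_w X w)%:E.
Proof.
move=> mX XM; rewrite unlock /Rintegral fineK//.
exact: (integrable_fin_num _ (bounded_integrable mX XM)).
Qed.

Lemma bounded_convergence (X : nat -> T -> R) Y M :
  (forall n, measurable_fun setT (X n)) -> measurable_fun setT Y ->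
  (forall n w, `|X n w| <= M) ->
  {ae P, forall w, X n w @[n --> \oo] --> Y w} ->
  \int[P]_w X n w @[n --> \oo] --> \int[P]_w Y w.
Proof.
move=> mX mY XM XY.
have mE (Z : T -> R) : measurable_fun setT Z -> measurable_fun setT (EFin \o Z).
  by move=> mZ; exact/measurable_EFinP.
have [] := @dominated_convergence _ _ _ P setT measurableT
  (fun n => EFin \o X n) (EFin \o Y) (fun=> M%:E) (fun n => mE _ (mX n)) (mE _ mY).
- by apply: filterS XY => w h _; apply: cvg_EFin => //; exact: nearW.
- apply: (@bounded_integrable (fun=> M) `|M|) => //.
- by apply: aeW => w n _; rewrite /= lee_fin.
- move=> iY _ h.
  apply: fine_cvg; rewrite /Rintegral fineK; first exact: h.
  exact: integrable_fin_num.
Qed.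

End bounded_expectations.

(** * Comparison of expectations *)

Section comparison.
Context {R : realType} {d : measure_display} {T : measurableType d} (P : probability T R).

(** The difference of [f n] and [g n] is controlled only where the cutoff [c m n]
    is positive; the mass that the cutoff misses is asymptotically
    [1 - kap m], small for large [m].  This is how tightness enters. *)
Lemma comparison_cvg (f g : nat -> T -> R) (c : nat -> nat -> T -> R) (M gam : R) (kap : nat -> R) :
  (forall n, measurable_fun setT (f n)) -> (forall n, measurable_fun setT (g n)) ->
  (forall m n, measurable_fun setT (c m n)) ->
  (forall n w, `|f n w| <= M) -> (forall n w, `|g n w| <= M) ->
  (forall m n w, 0 <= c m n w <= 1) ->
  (forall m, {ae P, forall w, (f n w - g n w) * c m n w @[n --> \oo] --> (0:R)}) ->
  \int[P]_w g n w @[n --> \oo] --> gam ->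
  (forall m, \int[P]_w c m n w @[n --> \oo] --> kap m) ->
  kap m @[m --> \oo] --> (1 : R) ->
  \int[P]_w f n w @[n --> \oo] --> gam.
Proof.
move=> mf mg mc fM gM c01 fgc gg ck k1.
have M0 : 0 <= M by apply: le_trans (fM 0%N point).
have c1 m n w : `|c m n w| <= 1.
  by have /andP[h0 h1] := c01 m n w; rewrite ger0_norm.
have fg2 n w : `|f n w - g n w| <= 2 * M.
  apply: le_trans (ler_normB _ _) _; have := fM n w; have := gM n w; lra.
have mfg n : measurable_fun setT (fun w => f n w - g n w) by exact: measurable_funB.
have mD m n : measurable_fun setT (fun w => (f n w - g n w) * c m n w).
  exact: measurable_funM.
have D2 m n w : `|(f n w - g n w) * c m n w| <= 2 * M.
  by rewrite normrM -[leRHS]mulr1 ler_pM.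
have Dcvg m : \int[P]_w ((f n w - g n w) * c m n w) @[n --> \oo] --> (0 : R).
  have := bounded_convergence (P := P) (Y := fun=> 0) (mD m) (measurable_cst _) (D2 m) (fgc m).
  by rewrite Rintegral_cst// mul0r.
have iP (h : T -> R) (B : R) : measurable_fun setT h -> (forall w, `|h w| <= B) -> P.-integrable setT (EFin \o h).
  exact: bounded_integrable.
have split_int m n : \int[P]_w f n w - \int[P]_w g n w - \int[P]_w ((f n w - g n w) * c m n w)
    = \int[P]_w ((f n w - g n w) * (1 - c m n w)).
  rewrite -RintegralB//; [|exact: (iP _ M)|exact: (iP _ M)].
  rewrite -RintegralB//; [|exact: (iP _ (2 * M))|exact: (iP _ (2 * M))].
  by apply: eq_Rintegral => w _; rewrite mulrBr mulr1.
have mc1 m n : measurable_fun setT (fun w => 1 - c m n w).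
  by apply: measurable_funB.
have c1' m n w : `|1 - c m n w| <= 1.
  by have /andP[h0 h1] := c01 m n w; rewrite ger0_norm ?subr_ge0// gerBl.
have bound m n : `|\int[P]_w ((f n w - g n w) * (1 - c m n w))| <= 2 * M * (1 - \int[P]_w c m n w).
  have mR : measurable_fun setT (fun w => (f n w - g n w) * (1 - c m n w)).
    exact: measurable_funM.
  have R2 w : `|(f n w - g n w) * (1 - c m n w)| <= 2 * M.
    by rewrite normrM -[leRHS]mulr1 ler_pM.
  apply: le_trans (le_normr_Rintegral _ _) _ => //; first exact: (iP _ (2 * M)).
  have -> : 1 - \int[P]_w c m n w = \int[P]_w (1 - c m n w).
    rewrite RintegralB//; [|exact: (iP (fun=> 1) `|1|)|exact: (iP _ 1)].
    by rewrite Rintegral_cst//= probability_setT/= mulr1.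
  rewrite -RintegralZl//; last exact: (iP _ 1).
  apply: le_Rintegral => //.
  - apply: (iP (fun w => `|(f n w - g n w) * (1 - c m n w)|) (2 * M)); last by move=> w; rewrite normr_id.
    exact: measurableT_comp.
  - apply: (iP (fun w => 2 * M * (1 - c m n w)) (2 * M)); first exact: measurable_funM.
    move=> w; rewrite normrM -[leRHS]mulr1 ler_pM//.
    by rewrite ger0_norm// mulr_ge0.
  - move=> w _; have /andP[h0 h1] := c01 m n w.
    by rewrite normrM ler_pM// ger0_norm ?subr_ge0.
apply/cvgrPdist_le => e e0.
have e4 : 0 < e / 4 by rewrite divr_gt0.
have e4M : 0 < e / 4 / (2 * M + 1) by rewrite divr_gt0// ltr_wpDl// mulr_ge0.
have [m hm] : exists m, `|1 - kap m| <= e / 4 / (2 * M + 1).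
  have /cvgrPdist_le /(_ _ e4M) [m _ hm] := k1.
  by exists m; apply: (hm m) => /=.
near=> n.
have h1 : `|gam - \int[P]_w g n w| <= e / 4.
  by near: n; move/cvgrPdist_le : gg; exact.
have h2 : `|0 - \int[P]_w ((f n w - g n w) * c m n w)| <= e / 4.
  by near: n; move/cvgrPdist_le : (Dcvg m); exact.
have h3 : `|kap m - \int[P]_w c m n w| <= e / 4 / (2 * M + 1).
  by near: n; move/cvgrPdist_le : (ck m); exact.
have h4 := bound m n; rewrite -split_int in h4.
have h5 : 2 * M * (1 - \int[P]_w c m n w) <= e / 2.
  have hk : 1 - \int[P]_w c m n w <= 2 * (e / 4 / (2 * M + 1)).
    move: hm h3; rewrite !ler_norml => /andP[_ hm] /andP[_ h3]; lra.
  apply: (@le_trans _ _ (2 * M * (2 * (e / 4 / (2 * M + 1))))).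
    by rewrite ler_wpM2l// mulr_ge0.
  have -> : 2 * M * (2 * (e / 4 / (2 * M + 1))) = e / 2 * (2 * M / (2 * M + 1)) by field; rewrite gt_eqF// ltr_wpDl// mulr_ge0.
  apply: ler_piMr; first by rewrite divr_ge0// ltW.
  by rewrite ler_pdivrMr ?ltr_wpDl ?mulr_ge0// mul1r lerDl.
move: h1 h2 (le_trans h4 h5); rewrite !ler_norml => /andP[? ?] /andP[? ?] /andP[? ?].
by apply/andP; split; lra.
Unshelve. all: by end_near. Qed.

End comparison.

Section cutoff.
Context {R : realType} {n : nat}.

Definition cutoff (m : nat) (y : 'rV[R]_n.+1) : R := Num.max 0 (Num.min 1 (m%:R + 1 - `|y|)).

Lemma cutoff_continuous m : continuous (cutoff m).
Proof.
move=> y.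
have h1 : m%:R + 1 - s @[s --> `|y|] --> m%:R + 1 - `|y|.
  by apply: cvgB; [exact: cvg_cst|exact: cvg_id].
have h2 : Num.min 1 (m%:R + 1 - s) @[s --> `|y|] --> Num.min 1 (m%:R + 1 - `|y|).
  apply: (@continuous_min _ _ (fun=> 1) (fun s : R => m%:R + 1 - s)) => //.
  exact: cvg_cst.
have h3 : Num.max 0 (Num.min 1 (m%:R + 1 - s)) @[s --> `|y|] --> Num.max 0 (Num.min 1 (m%:R + 1 - `|y|)).
  apply: (@continuous_max _ _ (fun=> 0) (fun s : R => Num.min 1 (m%:R + 1 - s))) => //.
  exact: cvg_cst.
exact: (cvg_comp _ _ (@norm_continuous _ _ y) h3).
Qed.

Lemma cutoff_itv m y : 0 <= cutoff m y <= 1.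
Proof. by rewrite /cutoff le_max lexx/= ge_max ler01 ge_min lexx. Qed.

Lemma cutoff_eq0 m y : m%:R + 1 <= `|y| -> cutoff m y = 0.
Proof.
move=> h; rewrite /cutoff; apply/max_idPl; rewrite ge_min subr_le0 h orbT //.
Qed.

Lemma cutoff_eq1 m y : `|y| <= m%:R -> cutoff m y = 1.
Proof.
move=> h; rewrite /cutoff (_ : Num.min 1 _ = 1); first by rewrite (max_idPr _).
by apply/min_idPl; lra.
Qed.

End cutoff.

(** * Weak convergence *)

Section pathwise.
Context {R : realType}.
Variables (n : nat) (la nu : R) (mu : 'I_n.+1 -> R).
Hypotheses (la_gt0 : 0 < la) (nu_gt0 : 0 < nu) (mu_gt0 : forall k, 0 < mu k).
Hypothesis overload : 1 < la * \sum_(k < n.+1) (mu k)^-1.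
Variable Psi : 'rV[R]_n.+1 -> skorokhod R n.+1.
Hypothesis Psi_continuous : continuous Psi.
Hypothesis Psi_fluid : forall x, fluid_model_solution la mu nu (Psi x).
Hypothesis Psi_start : forall x k, (k <= n)%N -> stage (Psi x 0) k = Num.max (stage x k) 0.
Variable F : skorokhod R n.+1 -> R.
Hypothesis F_continuous : continuous F.

(** Where the cutoff does not vanish the initial states are bounded, hence
    convergent along any ultrafilter; there both the scaled queue and the
    fluid solution issued from its own initial state converge to the fluid
    solution issued from the limit. *)
Lemma pathwise_comparison (A : R -> nat) (Ps Pa : 'I_n.+1 -> R -> nat)
    (r : nat -> R) (q : nat -> skorokhod R n.+1) (m : nat) :
  (forall s t, 0 <= s -> s <= t -> (A s <= A t)%N) ->
  (forall i s t, 0 <= s -> s <= t -> (Ps i s <= Ps i t)%N) ->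
  (forall i s t, 0 <= s -> s <= t -> (Pa i s <= Pa i t)%N) ->
  (A t)%:R / t @[t --> +oo] --> la ->
  (forall i, (Ps i t)%:R / t @[t --> +oo] --> (1:R)) ->
  (forall i, (Pa i t)%:R / t @[t --> +oo] --> (1:R)) ->
  (forall i, 0 < r i) -> r i @[i --> \oo] --> +oo ->
  (forall i, queue_equations mu nu (r i) A Ps Pa (q i)) ->
  (F (fluid_scaling (r i) (q i)) - F (Psi (fluid_scaling (r i) (q i) 0)))
    * cutoff m (fluid_scaling (r i) (q i) 0) @[i --> \oo] --> (0:R).
Proof.
move=> Am Psm Pam Al Psl Pal r0 ry qe.
pose X i := fluid_scaling (r i) (q i); pose Y i := X i 0.
have Y0 i k : 0 <= stage (Y i) k.
  by case: (sample_path_cadlag (X i)) => _ h _ _; exact: h.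
apply/cvgrPdist_lt => e e0; apply: ultra_near => U UU sU.
have [YU|YU] := in_ultra_setVsetC [set i | `|Y i| < m%:R + 1] UU; last first.
  apply: filterS YU => i /= /negP; rewrite -leNgt => h.
  by rewrite -/(Y i) cutoff_eq0// mulr0 subrr normr0.
have m1 : 0 < m%:R + 1 :> R by rewrite ltr_wpDl.
pose y : 'rV[R]_n.+1 := \row_k lim (stage (Y i) k @[i --> U]).
have Yy k : (k <= n)%N -> stage (Y i) k @[i --> U] --> stage y k.
  move=> kn; rewrite {2}/stage mxE.
  have -> : (fun i => stage (Y i) (inord k : 'I_n.+1)) = (fun i => stage (Y i) k).
    by apply/funext => i; rewrite inordK.
  apply: (@ultra_bounded_cvg _ _ _ _ _ 0 (m%:R + 1)).
  apply: filterS YU => i /= /(rV_norm_lt _ m1) /(_ k kn).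
  by rewrite Y0/= => /(le_lt_trans (ler_norm _))/ltW.
have y0 k : (k <= n)%N -> 0 <= stage y k.
  by move=> kn; apply: (limit_ge (Yy k kn)); apply: filterE => i; exact: Y0.
have YyU : Y i @[i --> U] --> y by apply/cvg_stage.
have Psi_y k : (k <= n)%N -> stage (Psi y 0) k = stage y k.
  by move=> kn; rewrite Psi_start//; apply/max_idPl; exact: y0.
have rU : r i @[i --> U] --> +oo by exact: cvg_trans (cvg_app _ sU) ry.
have XU : X i @[i --> U] --> Psi y.
  apply: (@uniform_cvg_J1 R n _ U _ X (Psi y)) => N e' e'0.
  exact: (@queue_fluid_limit R n la nu mu la_gt0 nu_gt0 mu_gt0 overload _ U _ A Ps Pa r q
    (stage y) (fun k t => stage (Psi y t) k) Am Psm Pam Al Psl Pal r0 rU qe Yy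
    (fluid_model_stage (Psi_fluid y)) Psi_y N e' e'0).
have Fy : F s @[s --> Psi y] --> F (Psi y) by exact: F_continuous.
have Py : Psi s @[s --> y] --> Psi y by exact: Psi_continuous.
have FX : F (X i) @[i --> U] --> F (Psi y) by exact: (cvg_comp X F XU Fy).
have FY : F (Psi (Y i)) @[i --> U] --> F (Psi y).
  exact: (cvg_comp (fun i => Psi (Y i)) F (cvg_comp Y Psi YyU Py) Fy).
have e2 : 0 < e / 2 by rewrite divr_gt0.
move/cvgrPdist_lt : FX => /(_ _ e2) FX; move/cvgrPdist_lt : FY => /(_ _ e2) FY.
apply: filterS (filterI FX FY) => i /= [h1 h2].
rewrite sub0r normrN -/(X i) -/(Y i) normrM.
have /andP[c0 c1] := cutoff_itv m (Y i).
apply: (@le_lt_trans _ _ (`|F (X i) - F (Psi (Y i))|)).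
  by rewrite (ger0_norm c0) ler_piMr.
move: h1 h2; rewrite !ltr_norml => /andP[? ?] /andP[? ?].
by apply/andP; split; lra.
Qed.

End pathwise.

Lemma eventually_positive (R : realType) (u : nat -> R) : u i @[i --> \oo] --> +oo ->
  exists r : nat -> R, [/\ forall i, 0 < r i, r i @[i --> \oo] --> +oo
    & \forall i \near \oo, r i = u i].
Proof.
move=> uy; exists (fun i => if 0 < u i then u i else 1).
have near_u : \forall i \near \oo, (if 0 < u i then u i else 1) = u i.
  by move/cvgryPgt : uy => /(_ 0); apply: filterS => i ->.
split => //; first by move=> i; case: ifPn.
apply: cvg_trans uy; apply: near_eq_cvg.
by apply: filterS near_u => i ->.
Qed.

Section weak_convergence.
Context {R : realType}.
Variables (n : nat) (la nu : R) (mu : 'I_n.+1 -> R).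
Hypotheses (la_gt0 : 0 < la) (nu_gt0 : 0 < nu) (mu_gt0 : forall k, 0 < mu k).
Hypothesis overload : 1 < la * \sum_(k < n.+1) (mu k)^-1.
Context {d : measure_display} {T : measurableType d} (P : probability T R).
Variables (A : T -> R -> nat) (Ps Pa : 'I_n.+1 -> T -> R -> nat)
  (Q : R -> T -> skorokhod R n.+1).
Hypothesis model : queue_model la mu nu P A Ps Pa Q.
Context {d' : measure_display} {T' : measurableType d'} (P' : probability T' R).
Variable z0 : T' -> 'rV[R]_n.+1.
Hypothesis init : cvg_in_distribution P (fun r w => fluid_scaling r (Q r w) 0) P' z0.
Variable Psi : 'rV[R]_n.+1 -> skorokhod R n.+1.
Hypothesis Psi_continuous : continuous Psi.
Hypothesis Psi_fluid : forall x, fluid_model_solution la mu nu (Psi x).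
Hypothesis Psi_start : forall x k, (k <= n)%N -> stage (Psi x 0) k = Num.max (stage x k) 0.

Let X r w := fluid_scaling r (Q r w).

Lemma scaled_queue_random_element r : 0 < r -> random_element (X r).
Proof.
move=> r0; have [_ _ _ h _] := model; have [mQ _] := h r r0.
exact: (random_element_comp (fluid_scaling_continuous r0) mQ).
Qed.

Lemma queue_ae (r : nat -> R) : (forall i, 0 < r i) ->
  {ae P, forall w, [/\ (A w t)%:R / t @[t --> +oo] --> la,
     forall i, (Ps i w t)%:R / t @[t --> +oo] --> (1:R),
     forall i, (Pa i w t)%:R / t @[t --> +oo] --> (1:R)
   & forall i, queue_equations mu nu (r i) (A w) (Ps ^~ w) (Pa ^~ w) (Q (r i) w)]}.
Proof.
move=> r0; have [pA pSA _ _ qe] := model.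
have h1 := poisson_lln la_gt0 pA.
have h2 : {ae P, forall w, forall i, (Ps i w t)%:R / t @[t --> +oo] --> (1:R)}.
  apply: filter_forall => i; have [p _] := pSA i; exact: poisson_lln ltr01 p.
have h3 : {ae P, forall w, forall i, (Pa i w t)%:R / t @[t --> +oo] --> (1:R)}.
  apply: filter_forall => i; have [_ p] := pSA i; exact: poisson_lln ltr01 p.
have h4 : {ae P, forall w, forall i, queue_equations mu nu (r i) (A w) (Ps ^~ w) (Pa ^~ w) (Q (r i) w)}.
  by apply/ae_foralln => i; exact: qe.
by apply: filterS (filterI (filterI h1 h2) (filterI h3 h4)) => w [[? ?] [? ?]].
Qed.

Lemma initial_expectation (r : nat -> R) (h : 'rV[R]_n.+1 -> R) (M : R) :
  (forall i, 0 < r i) -> r i @[i --> \oo] --> +oo ->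
  continuous h -> (forall y, `|h y| <= M) ->
  \int[P]_w h (X (r i) w 0) @[i --> \oo] --> \int[P']_w h (z0 w).
Proof.
move=> r0 ry hc hM; have [mY mz hE] := init.
have := hE h hc (ex_intro _ M hM).
rewrite (expectation_Rintegral P' (random_element_real hc mz) (fun w => hM _)) => hE'.
have {}hE' : ('E_P[h \o (fun w => X (r i) w 0%R)])%E @[i --> \oo] --> (\int[P']_w h (z0 w))%:E.
  exact: (cvg_comp r (fun s => 'E_P[h \o (fun w => X s w 0%R)]%E) ry hE').
have {}hE' : fine ('E_P[h \o (fun w => X (r i) w 0%R)])%E @[i --> \oo] --> \int[P']_w h (z0 w).
  exact: fine_cvg.
move: hE'; apply: cvg_trans; apply: near_eq_cvg; apply: nearW => i /=.
by rewrite (expectation_Rintegral P (random_element_real hc (mY _ (r0 i))) (fun w => hM _)).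
Qed.

(** For a bounded continuous [F], the expectation of [F (Psi (X r 0))] converges
    because [F \o Psi] is a bounded continuous function of the initial state,
    and [F (X r)] is compared with [F (Psi (X r 0))] along sequences. *)
Theorem queue_weak_convergence : cvg_in_distribution P X P' (Psi \o z0).
Proof.
have [mY mz hE] := init; split.
- exact: scaled_queue_random_element.
- exact: random_element_comp Psi_continuous mz.
move=> F Fc [M FM].
have GM y : `|F (Psi y)| <= M by exact: FM.
have Gc : continuous (F \o Psi).
  by move=> y; apply: continuous_comp; [exact: Psi_continuous|exact: Fc].
rewrite (@expectation_Rintegral _ _ _ P' (F \o (Psi \o z0)) M (random_element_real Gc mz) (fun w => FM _)).
have EX r : 0 < r -> 'E_P[F \o X r]%E = (\int[P]_w F (X r w))%:E.
  by move=> r0; exact: (expectation_Rintegral P (random_element_real Fc (scaled_queue_random_element r0)) (fun w => FM _)).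
apply/fine_cvgP; split.
  near=> r; rewrite EX//; near: r; exact: nbhs_pinfty_gt.
(* Nothing is assumed of the queue for [r <= 0]. *)
apply/cvg_pinftyP => u uy; have [r [r0 ry ru]] := eventually_positive uy.
suff : \int[P]_w F (X (r i) w) @[i --> \oo] --> \int[P']_w F (Psi (z0 w)).
  apply: cvg_trans; apply: near_eq_cvg; apply: filterS ru => i ri /=.
  by rewrite -ri EX.
have [pA pSA _ _ _] := model.
have c01 m y := @cutoff_itv R n m y.
have cM m y : `|@cutoff R n m y| <= 1.
  by have /andP[h0 h1] := c01 m y; rewrite ger0_norm.
apply: (@comparison_cvg R d T P _ (fun i w => F (Psi (X (r i) w 0)))
  (fun m i w => cutoff m (X (r i) w 0)) M _ (fun m => \int[P']_w cutoff m (z0 w))) => //.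
- by move=> i; exact: (random_element_real Fc (scaled_queue_random_element (r0 i))).
- by move=> i; exact: (random_element_real Gc (mY _ (r0 i))).
- by move=> m i; exact: (random_element_real (@cutoff_continuous R n m) (mY _ (r0 i))).
- move=> m; apply: filterS (queue_ae r0) => w [hA hPs hPa hq].
  have [_ A0 _ _] := pA; have [_ Am _] := A0 w.
  apply: (pathwise_comparison la_gt0 nu_gt0 mu_gt0 overload Psi_continuous Psi_fluid
    Psi_start Fc m Am _ _ hA hPs hPa r0 ry hq) => i.
    by have [[_ p _ _] _] := pSA i; have [_ + _] := p w.
  by have [_ [_ p _ _]] := pSA i; have [_ + _] := p w.
- exact: (initial_expectation r0 ry Gc GM).
- by move=> m; exact: (initial_expectation r0 ry (@cutoff_continuous R n m) (cM m)).
- have h := @bounded_convergence R d' T' P' (fun m w => cutoff m (z0 w)) (fun=> 1) 1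
    (fun m => random_element_real (@cutoff_continuous R n m) mz) (measurable_cst _) (fun m w => cM m _).
  have {}h := h _; rewrite Rintegral_cst//= probability_setT/= mulr1 in h; apply: h.
  apply: aeW => w.
  apply: cvg_near_cst; near=> m; rewrite cutoff_eq1//.
  by near: m; exact: nbhs_infty_ger.
Unshelve. all: by end_near. Qed.

End weak_convergence.

Theorem theorem4 (R : realType) (I : nat) (hI : (1 <= I)%N)
  (lambda : R) (mu : 'I_I -> R) (nu : R)
  (hlambda : 0 < lambda) (hmu : forall i, 0 < mu i) (hnu : 0 < nu)
  (overload : 1 < lambda * \sum_(i < I) (mu i)^-1)
  (d : measure_display) (T : measurableType d) (P : probability T R)
  (A : T -> R -> nat) (Ps Pa : 'I_I -> T -> R -> nat)
  (Q : R -> T -> skorokhod R I)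
  (hQ : queue_model lambda mu nu P A Ps Pa Q)
  (d' : measure_display) (T' : measurableType d') (P' : probability T' R)
  (z0 : T' -> 'rV[R]_I) (hz0 : forall w i, 0 <= z0 w 0 i)
  (hinit : cvg_in_distribution P (fun r w => fluid_scaling r (Q r w) 0) P' z0) :
  exists Z : T' -> skorokhod R I,
    (forall w, unique
       (fun z => fluid_model_solution lambda mu nu z /\ z 0 = z0 w) (Z w)) /\
    cvg_in_distribution P (fun r w => fluid_scaling r (Q r w)) P' Z.
Proof.
case: I hI mu hmu overload Ps Pa Q hQ z0 hz0 hinit => [//|n] _ mu hmu overload Ps Pa Q hQ z0 hz0 hinit.
have [Psi [Psic Psif Psi0 Psiu]] := fluid_map hlambda hnu hmu overload.
have start w k : (k <= n)%N -> Num.max (stage (z0 w) k) 0 = stage (z0 w) k.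
  by move=> kn; apply/max_idPl; exact: hz0.
exists (Psi \o z0); split.
- move=> w; split => [|Z [ZF Z0]].
    split; first exact: Psif.
    by apply/rowP => i; rewrite -!stage_ord /= Psi0 ?start// -ltnS.
  by apply: Psiu => // k kn; rewrite Z0 start.
- exact: (queue_weak_convergence hlambda hnu hmu overload hQ hinit Psic Psif Psi0).
Qed.
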